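(* Let $k\ge 0$ be an integer and let $(\mu=\nu+\eta,a)$ be a real-antipodal, $\mathbb{R}$-symmetric FS-pair on a strip $\{z\in\mathbb{C}: |\operatorname{Im} z|<\sigma_\mu\}$, where $\eta=\sum_{\gamma\in A}b(\gamma)\boldsymbol{\delta}_\gamma$, such that $\operatorname{ord}(\mu)\le 2(k+1)$ and $a(\cdot)$ has finite exponential growth. Then the expression $$F(z):=\frac12 a(0)+\sum_{\lambda>0}a(\lambda)e^{2\pi i\lambda z}$$ defines a holomorphic almost periodic map on the half-plane $\operatorname{Im} z>c$, for some $c>0$ depending on the exponential growth of $a(\cdot)$. Moreover, $F$ extends as a meromorphic map to $\mathbb{C}^+$ as $F(z)=N(z)+S(z)$ for some function $N\in\mathfrak{N}_{\le k}-\mathfrak{N}_{\le k}$ and some meromorphic map $S(z)$, given explicitly by $$F(z)=\frac{(z^2+1)^k}{2\pi i}\int_{\mathbb{R}}\frac{1+tz}{t-z}\cdot\frac{d\nu(t)}{(1+t^2)^{k+1}}+iQ_\rho(z)+\frac{(z^2+\rho^2)^k}{2\pi i}\sum_{\gamma\in A}\frac{\rho^2+\gamma z}{\gamma-z}\cdot\frac{b(\gamma)}{(\rho^2+\gamma^2)^{k+1}} ,$$ where $\rho>\sigma_\mu$ is any parameter, and $Q_\rho(z)$ is a polynomial with real coefficients of degree $\le 2k$, which depends on $\rho$.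
   Context: Notation: $\mathbb{C}^+=\{z\in\mathbb{C}:\operatorname{Im} z>0\}$; $\boldsymbol{\delta}_\gamma$ is the unit point mass at $\gamma$. Fourier transform: $\widehat f(\xi)=\int_{\mathbb{R}}f(t)e^{-2\pi i t\xi}\,dt$; for $\varphi\in C_c^\infty(\mathbb{R})$, $\widehat\varphi$ also denotes its entire extension to $\mathbb{C}$. Measures: a complex-valued Borel measure $\mu$ supported on a strip $\{|\operatorname{Im} z|<\sigma_\mu\}$, $0\le\sigma_\mu<\infty$ (or on $\mathbb{R}$), is strongly tempered if $\int (1+|z|^2)^{-k/2}\,d|\mu|(z)<\infty$ for some integer $k\ge0$; $\operatorname{ord}(\mu)$ is the smallest such $k$. It is admissible if $\mu=\nu+\eta$, where $\nu$ is a strongly tempered measure on $\mathbb{R}$ and $\eta=\sum_{\gamma\in A}b(\gamma)\boldsymbol{\delta}_\gamma$ is a strongly tempered discrete measure with $A\cap\mathbb{R}=\varnothing$ and with all finite limit points of $A$, if any, lying on $\mathbb{R}$. This decomposition is unique, and writing $\mu=\nu+\eta$ always refers to it. A function $a:\mathbb{R}\to\mathbb{C}$ is locally summable if $\{\lambda:a(\lambda)\ne0\}$ is countable and $\sum_{|\lambda|\le T}|a(\lambda)|<\infty$ for every $T>0$. It has finite exponential growth if $\sum_{\lambda\in\mathbb{R}}|a(\lambda)|e^{-\alpha|\lambda|}<\infty$ for some $\alpha>0$. Sums over $\lambda$ are over the countable support of $a$. FS-pair: a Fourier summation pair on a strip is a pair $(\mu,a)$ with $a:\mathbb{R}\to\mathbb{C}$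 locally summable and $\mu=\nu+\eta$ an admissible strongly tempered measure supported on a strip $\{|\operatorname{Im} z|<\sigma_\mu<\infty\}$ such that for every $\varphi\in C_c^\infty(\mathbb{R})$ $$\sum_{\lambda\in\mathbb{R}}a(\lambda)\varphi(\lambda)=\int_{\mathbb{R}}\widehat\varphi(t)\,d\nu(t)+\sum_{\gamma\in A}b(\gamma)\widehat\varphi(\gamma).$$ It is $\mathbb{R}$-symmetric if $\gamma\in A\iff\overline\gamma\in A$ and $b(\overline\gamma)=b(\gamma)$ for all $\gamma\in A$. It is real-antipodal if $\mu$ is real-valued and $\overline{a(\lambda)}=a(-\lambda)$ for all $\lambda\in\mathbb{R}$. Almost periodicity: a continuous $f:\mathbb{R}\to\mathbb{C}$ is almost periodic if for every $\varepsilon>0$ there is a relatively dense set $\tau_\varepsilon\subset\mathbb{R}$ (i.e. there is $l>0$ such that $\tau_\varepsilon$ meets every interval $(x,x+l)$) with $\sup_{x}|f(x+t)-f(x)|<\varepsilon$ for all $t\in\tau_\varepsilon$. $\mathcal{AP}(\mathbb{C}^+)$ is the set of holomorphic $F$ on $\mathbb{C}^+$ with $\sup_{\alpha<\operatorname{Im} z<\beta}|F(z)|<\infty$ for all $0<\alpha<\beta<\infty$ and $x\mapsto F(x+iy)$ almost periodic for each $y>0$. $F$ is holomorphic almost periodic on $\operatorname{Im} z>c$ if $z\mapsto F(z+ic)$ belongs to $\mathcal{AP}(\mathbb{C}^+)$. Nevanlinna class: $\mathfrak{N}_{\le k}$ is the set of holomorphic $F:\mathbb{C}^+\to\mathbb{C}$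 such that for every $N>0$ and $z_1,\dots,z_N\in\mathbb{C}^+$ the Hermitian matrix $\left[i\frac{F(z_n)+\overline{F(z_m)}}{z_n-\overline{z_m}}\right]_{1\le n,m\le N}$ has at most $k$ negative eigenvalues (with multiplicity). $\mathfrak{N}_{\le k}-\mathfrak{N}_{\le k}=\{F-G: F,G\in\mathfrak{N}_{\le k}\}$. *)

(* Defs.v *)
From HB Require Import structures.
From mathcomp Require Import all_boot all_order all_algebra.
From mathcomp Require Import all_classical all_reals all_analysis.
From mathcomp Require Import complex.

Set Implicit Arguments.
Unset Strict Implicit.
Unset Printing Implicit Defensive.

Import Order.TTheory GRing.Theory Num.Theory.
Import numFieldNormedType.Exports.

Local Open Scope classical_set_scope.
Local Open Scope complex_scope.
Local Open Scope ring_scope.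

(* Conventions.  Complex numbers are [R[i]] over an arbitrary [R : realType];
   [R[i]^o] is the same type with its topological (normed) structure.
   Functions on a subset of [R[i]] are total functions whose values outside
   that subset are irrelevant. *)

Section ComplexNumbers.
Variable R : realType.
Implicit Types (z : R[i]).

(* The modulus as an element of [R] (the generic [`|z|] lives in [R[i]]). *)
Definition cabs z : R := ComplexField.Normc.normc z.

Definition cexp z : R[i] :=
  (expR (complex.Re z))%:C * (cos (complex.Im z) +i* sin (complex.Im z)).

Definition upper_half_plane : set R[i] := [set z | 0 < complex.Im z].

End ComplexNumbers.

Section Sums.
Variables (R : realType) (T : choiceType).
Implicit Types (D : set T).

Definition csummable D (f : T -> R[i]) : Prop :=
  (\esum_(x in D) (cabs (f x))%:E < +oo)%E.

Let rsum D (g : T -> R) : R :=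
  fine (\esum_(x in D) (Num.max (g x) 0)%:E) -
  fine (\esum_(x in D) (Num.max (- g x) 0)%:E).

(* Unordered sum; the sum of [f] over [D] when [csummable D f]. *)
Definition csum D (f : T -> R[i]) : R[i] :=
  rsum D (fun x => complex.Re (f x)) +i* rsum D (fun x => complex.Im (f x)).

End Sums.

Section Measures.
Variable R : realType.
Local Notation BR := (measurableTypeR R).

(* A complex Borel measure nu on the line in polar form d nu = h d|nu|: the
   total variation |nu| is a positive Borel measure and the phase h has modulus
   one.  By Radon-Nikodym, every complex measure whose total variation is
   finite on bounded sets is of this form, |nu| being unique and h unique up to
   |nu|-null sets.  The polar form is used because |nu| is in general infinite,
   so that nu itself is only defined on bounded Borel sets. *)
Record cmeasure := CMeasure {
  cvariation : {measure set BR -> \bar R};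
  cphase : BR -> R[i];
  measurable_Re_cphase : measurable_fun setT (fun t => complex.Re (cphase t) : R);
  measurable_Im_cphase : measurable_fun setT (fun t => complex.Im (cphase t) : R);
  cabs_cphase : forall t, cabs (cphase t) = 1
}.

Definition cintegrable_wrt (m : {measure set BR -> \bar R}) (D : set R)
    (f : R -> R[i]) : Prop :=
  m.-integrable D (fun t => (complex.Re (f t))%:E) /\
  m.-integrable D (fun t => (complex.Im (f t))%:E).

Definition cintegral_wrt (m : {measure set BR -> \bar R}) (D : set R)
    (f : R -> R[i]) : R[i] :=
  (\int[m]_(t in D) complex.Re (f t)) +i* (\int[m]_(t in D) complex.Im (f t)).

Definition cintegrable (nu : cmeasure) (f : R -> R[i]) : Prop :=
  cintegrable_wrt (cvariation nu) setT (fun t => f t * cphase nu t).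

Definition cintegral (nu : cmeasure) (f : R -> R[i]) : R[i] :=
  cintegral_wrt (cvariation nu) setT (fun t => f t * cphase nu t).

(* nu(B), meaningful when B is a Borel set of finite total variation. *)
Definition cmeasure_val (nu : cmeasure) (B : set R) : R[i] :=
  cintegral_wrt (cvariation nu) B (cphase nu).

(* The data of mu = nu + eta with nu on the real line and
   eta = \sum_(gamma in A) b(gamma) delta_gamma. *)
Record strip_measure := StripMeasure {
  line_part : cmeasure;
  atoms : set R[i];
  weight : R[i] -> R[i]
}.

(* (1 + |z|^2)^(-j/2) *)
Definition temper (j : nat) (z : R[i]) : R :=
  (Num.sqrt (1 + cabs z ^+ 2)) ^- j.

(* As nu and eta are carried by disjoint sets, |mu| = |nu| + |eta|. *)
Definition tempered_at (mu : strip_measure) (j : nat) : Prop :=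
  (\int[cvariation (line_part mu)]_t (temper j t%:C)%:E +
   \esum_(g in atoms mu) (cabs (weight mu g) * temper j g)%:E < +oo)%E.

Definition strongly_tempered (mu : strip_measure) : Prop :=
  exists j, tempered_at mu j.

(* The least j with [tempered_at mu j] (and 0 if there is none). *)
Definition ord (mu : strip_measure) : nat :=
  if pselect (exists j, `[< tempered_at mu j >]) is left ex then ex_minn ex
  else 0%N.

Definition admissible (mu : strip_measure) : Prop :=
  [/\ strongly_tempered mu,
      forall g, atoms mu g -> complex.Im g != 0 &
      forall p, limit_point (atoms mu : set R[i]^o) p -> complex.Im p = 0].

Definition supported_on_strip (sigma : R) (mu : strip_measure) : Prop :=
  0 <= sigma /\ forall g, atoms mu g -> `|complex.Im g| < sigma.

End Measures.

Section SummationPairs.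
Variable R : realType.
Implicit Types (a phi : R -> R[i]) (mu : strip_measure R).

Definition locally_summable a : Prop :=
  countable [set l | a l != 0] /\
  forall T : R, 0 < T -> csummable [set l : R | `|l| <= T] a.

Definition exponential_growth_rate a (alpha : R) : Prop :=
  0 < alpha /\
  (\esum_(l in [set: R]) (cabs (a l) * expR (- (alpha * `|l|)))%:E < +oo)%E.

Definition finite_exponential_growth a : Prop :=
  exists alpha, exponential_growth_rate a alpha.

Definition smooth (f : R -> R) : Prop :=
  forall n x, derivable (derive1n n f) x 1.

Definition test_function phi : Prop :=
  [/\ smooth (fun t => complex.Re (phi t)), smooth (fun t => complex.Im (phi t)) &
      exists T : R, forall t, T < `|t| -> phi t = 0].

Definition fourier phi (z : R[i]) : R[i] :=
  cintegral_wrt (@lebesgue_measure R) setT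
    (fun t => phi t * cexp (- (2 * pi)%:C * 'i%C * t%:C * z)).

Definition FS_pair (sigma : R) mu a : Prop :=
  [/\ locally_summable a,
      admissible mu,
      supported_on_strip sigma mu &
      forall phi, test_function phi ->
        csum setT (fun l => a l * phi l) =
        cintegral (line_part mu) (fun t => fourier phi t%:C) +
        csum (atoms mu) (fun g => weight mu g * fourier phi g)].

Definition R_symmetric mu : Prop :=
  (forall g, atoms mu g <-> atoms mu g^*%C) /\
  (forall g, atoms mu g -> weight mu g^*%C = weight mu g).

Definition real_valued mu : Prop :=
  (forall (T : R) (B : set R), measurable (B : set (measurableTypeR R)) ->
     B `<=` [set t | `|t| <= T] -> complex.Im (cmeasure_val (line_part mu) B) = 0) /\
  (forall g, atoms mu g -> complex.Im (weight mu g) = 0).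

Definition real_antipodal mu a : Prop :=
  real_valued mu /\ forall l, (a l)^*%C = a (- l).

End SummationPairs.

Section Holomorphy.
Variable R : realType.
Implicit Types (F G : R[i] -> R[i]) (U : set R[i]).

Definition cderivable F (z : R[i]) : Prop := derivable (F : R[i]^o -> R[i]^o) z 1.

(* To be used for open U. *)
Definition holomorphic_on U F : Prop := forall z, U z -> cderivable F z.

Definition holomorphic_at F (p : R[i]) : Prop :=
  \forall z \near (p : R[i]^o), cderivable F z.

(* A pole is a non-removable one; the value assigned to F there is ignored. *)
Definition pole_at F (p : R[i]) : Prop :=
  exists (n : nat) G, [/\ (0 < n)%N, holomorphic_at G p, G p != 0 &
    \forall z \near (p : R[i]^o)^', F z = G z / (z - p) ^+ n].

Definition meromorphic_on U F : Prop :=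
  forall p, U p -> holomorphic_at F p \/ pole_at F p.

Definition relatively_dense (A : set R) : Prop :=
  exists2 l : R, 0 < l & forall x, exists2 t, A t & x < t < x + l.

Definition almost_periodic (f : R -> R[i]) : Prop :=
  continuous (f : R -> R[i]^o) /\
  forall eps : R, 0 < eps -> exists2 A : set R, relatively_dense A &
    forall t, A t ->
      (ereal_sup [set (cabs (f (x + t) - f x))%:E | x in [set: R]] < eps%:E)%E.

Definition AP_upper F : Prop :=
  [/\ holomorphic_on (@upper_half_plane R) F,
      forall alpha beta : R, 0 < alpha -> alpha < beta ->
        (ereal_sup [set (cabs (F z))%:E
                   | z in [set z | (alpha < complex.Im z < beta)%R]] < +oo)%E &
      forall y : R, 0 < y -> almost_periodic (fun x => F (x +i* y))].

Definition holomorphic_almost_periodic_above (c : R) F : Prop :=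
  AP_upper (fun z => F (z + 'i%C * c%:C)).

(* Number of negative eigenvalues, counted with multiplicity, of a Hermitian
   matrix; in the partial order of [R[i]], x < 0 means real and negative. *)
Definition num_negative_eigenvalues n (M : 'M[R[i]]_n) : nat :=
  count (fun x => x < 0) (sval (closed_field_poly_normal (char_poly M))).

Definition nevanlinna_matrix F n (z : 'I_n -> R[i]) : 'M[R[i]]_n :=
  \matrix_(p < n, q < n)
    ('i%C * ((F (z p) + (F (z q))^*%C) / (z p - (z q)^*%C))).

Definition nevanlinna_le (k : nat) F : Prop :=
  holomorphic_on (@upper_half_plane R) F /\
  forall (n : nat) (z : 'I_n -> R[i]), (0 < n)%N ->
    (forall j, upper_half_plane (z j)) ->
    (num_negative_eigenvalues (nevanlinna_matrix F z) <= k)%N.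

Definition nevanlinna_diff (k : nat) F : Prop :=
  exists G H, [/\ nevanlinna_le k G, nevanlinna_le k H &
    forall z, upper_half_plane z -> F z = G z - H z].

End Holomorphy.

Section MainFormula.
Variable R : realType.
Implicit Types (a : R -> R[i]) (mu : strip_measure R) (z : R[i]).

Definition dirichlet_term a z (l : R) : R[i] :=
  a l * cexp ((2 * pi)%:C * 'i%C * l%:C * z).

Definition dirichlet_series a z : R[i] :=
  a 0 / 2 + csum [set l : R | 0 < l] (dirichlet_term a z).

Definition line_kernel (k : nat) z (t : R) : R[i] :=
  (1 + t%:C * z) / (t%:C - z) / ((1 + t ^+ 2) ^+ k.+1)%:C.

Definition line_term mu (k : nat) z : R[i] :=
  (z ^+ 2 + 1) ^+ k / ((2 * pi)%:C * 'i%C) *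
  cintegral (line_part mu) (line_kernel k z).

Definition atom_term mu (k : nat) (rho : R) z (g : R[i]) : R[i] :=
  ((rho ^+ 2)%:C + g * z) / (g - z) *
  (weight mu g / ((rho ^+ 2)%:C + g ^+ 2) ^+ k.+1).

Definition atoms_term mu (k : nat) (rho : R) z : R[i] :=
  (z ^+ 2 + (rho ^+ 2)%:C) ^+ k / ((2 * pi)%:C * 'i%C) *
  csum (atoms mu) (atom_term mu k rho z).

Definition real_poly_eval (Q : {poly R}) z : R[i] :=
  (map_poly (real_complex R) Q).[z].

End MainFormula.

(* Main.v *)
(* Let p be a smooth even bump of integral 1 supported in [-e, e].  For z above
   the strip, e(l, z) = exp(2 pi i l z) cut off to l > 0 by a z-dependent
   smoothing of the step function is a limit of test functions, and its Fourier
   transform is the Cauchy kernel p^(w) / (2 pi i (w - z)); the summation formula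
   thus represents the smoothed series as the pairing of mu with that kernel.
   Below the strip the same holds for minus the conjugate series, by symmetry.
   The pairing does not survive e -> 0, mu being only tempered, but the
   regularized kernel
     (z^2 + r^2)^k (r^2 + w z) / (w - z) / (r^2 + w^2)^(k+1)
   differs from 1 / (w - z) by a polynomial in z of degree <= 2k.  Subtracting
   the Lagrange interpolation in z at 2k + 1 nodes removes that polynomial and
   restores absolute convergence, so the series minus the regularized pairing
   equals its own interpolant i Q(z) of degree <= 2k; the symmetry z -> conj z
   makes Q real.  Interpolation also shows that changing rho only changes Q.

   The line term is a difference of two terms with positive densities.  For a
   positive density, split (z^2 + 1)^k = (z + i)^k (z - i)^k: the Nevanlinna
   kernel is a positive kernel plus terms a(z) conj(w)^j and z^j b(w) with j < k,
   which vanish on vectors orthogonal to k given ones. *)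

(* The constant c is the growth rate [alpha] itself: since 2 pi > 1, the terms of the series are
   dominated by the summable weight |a(l)| exp(-alpha |l|) as soon as Im z > alpha. The
   representation is first reached only for Im z > max(sigma, alpha), where z also lies above every
   atom; continuation along vertical lines then lowers the threshold to alpha. Holomorphy is carried
   by a geometric Taylor estimate. It is stable under integration against a measure, so Cauchy
   integrals, sums over atoms and Dirichlet series inherit it without contour integrals, and it is
   strong enough for an identity theorem. The half-plane below the strip serves to make Q real: all
   interpolation nodes lie above the strip, but the interpolation identity is valid on both sides of
   it. The line carries the parameter 1 and the atoms carry rho, because 1 + gamma^2 may vanish at
   an atom, whereas rho > sigma keeps rho^2 + gamma^2 comparable to 1 + |gamma|^2 on the strip. *)
Require Import Defs.
From HB Require Import structures.
From mathcomp Require Import all_boot all_order all_algebra finmap.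
From mathcomp Require Import all_classical all_reals all_analysis.
From mathcomp Require Import measurable_realfun complex ring lra.

Set Implicit Arguments.
Unset Strict Implicit.
Unset Printing Implicit Defensive.

Import Order.TTheory GRing.Theory Num.Theory.
Import numFieldNormedType.Exports.

Local Open Scope classical_set_scope.
Local Open Scope complex_scope.
Local Open Scope ring_scope.

(** * Complex numbers and the characters *)

Section ComplexBasics.
Variable R : realType.
Implicit Types (x y z w : R[i]) (s t : R).

Lemma cabsE z : cabs z = Num.sqrt (complex.Re z ^+ 2 + complex.Im z ^+ 2).
Proof. by case: z. Qed.

Lemma cabsC z : (cabs z)%:C = `|z|.
Proof. by []. Qed.

Lemma cabs_ge0 z : 0 <= cabs z.
Proof. by rewrite cabsE sqrtr_ge0. Qed.

Lemma cabs0 : cabs (0 : R[i]) = 0.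
Proof. exact: ComplexField.Normc.normc0. Qed.

Lemma cabs1 : cabs (1 : R[i]) = 1.
Proof. exact: ComplexField.Normc.normc1. Qed.

Lemma cabs_eq0 z : (cabs z == 0) = (z == 0).
Proof.
apply/eqP/eqP => [|->]; last exact: cabs0.
exact: ComplexField.Normc.eq0_normc.
Qed.

Lemma cabs_gt0 z : (0 < cabs z) = (z != 0).
Proof. by rewrite lt_def cabs_ge0 andbT cabs_eq0. Qed.

Lemma cabsM x y : cabs (x * y) = cabs x * cabs y.
Proof. exact: ComplexField.Normc.normcM. Qed.

Lemma cabsV x : cabs x^-1 = (cabs x)^-1.
Proof. exact: ComplexField.Normc.normcV. Qed.

Lemma cabs_div x y : cabs (x / y) = cabs x / cabs y.
Proof. by rewrite cabsM cabsV. Qed.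

Lemma cabsX x n : cabs (x ^+ n) = cabs x ^+ n.
Proof.
by elim: n => [|n IH]; rewrite ?expr0 ?cabs1// !exprS cabsM IH.
Qed.

Lemma cabsD x y : cabs (x + y) <= cabs x + cabs y.
Proof. exact: le_normcD. Qed.

Lemma cabsN x : cabs (- x) = cabs x.
Proof. exact: normcN. Qed.

Lemma cabsB x y : cabs (x - y) <= cabs x + cabs y.
Proof. by rewrite -(cabsN y) cabsD. Qed.

Lemma cabs_distC x y : cabs (x - y) = cabs (y - x).
Proof. by rewrite -cabsN opprB. Qed.

Lemma cabs_distl x y : cabs x - cabs y <= cabs (x - y).
Proof. by rewrite lerBlDr (le_trans _ (cabsD _ _))// subrK. Qed.

Lemma cabs_real s : cabs s%:C = `|s|.
Proof. by rewrite cabsE /= expr0n/= addr0 sqrtr_sqr. Qed.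

Lemma cabs_pos s : 0 <= s -> cabs s%:C = s.
Proof. by move=> s0; rewrite cabs_real ger0_norm. Qed.

Lemma cabs_i : cabs ('i%C : R[i]) = 1.
Proof. by rewrite cabsE /= expr0n/= add0r expr1n sqrtr1. Qed.

Lemma cabsJ z : cabs z^*%C = cabs z.
Proof. by case: z => a b; rewrite !cabsE/= sqrrN. Qed.

Lemma Re_le_cabs z : `|complex.Re z| <= cabs z.
Proof. by rewrite cabsE -sqrtr_sqr ler_wsqrtr// lerDl sqr_ge0. Qed.

Lemma Im_le_cabs z : `|complex.Im z| <= cabs z.
Proof. by rewrite cabsE -sqrtr_sqr ler_wsqrtr// lerDr sqr_ge0. Qed.

Lemma cabs_le z : cabs z <= `|complex.Re z| + `|complex.Im z|.
Proof.
rewrite cabsE -(ler_pXn2r (n := 2))// ?nnegrE ?sqrtr_ge0 ?addr_ge0//.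
rewrite sqr_sqrtr ?addr_ge0 ?sqr_ge0// -(real_normK (num_real (complex.Re z))).
rewrite -(real_normK (num_real (complex.Im z))).
have := normr_ge0 (complex.Re z); have := normr_ge0 (complex.Im z); nra.
Qed.

Lemma cReD x y : complex.Re (x + y) = complex.Re x + complex.Re y.
Proof. by case: x y => [a b] [c d]. Qed.
Lemma cImD x y : complex.Im (x + y) = complex.Im x + complex.Im y.
Proof. by case: x y => [a b] [c d]. Qed.
Lemma cReN x : complex.Re (- x) = - complex.Re x.
Proof. by case: x. Qed.
Lemma cImN x : complex.Im (- x) = - complex.Im x.
Proof. by case: x. Qed.
Lemma cReM x y : complex.Re (x * y) =
  complex.Re x * complex.Re y - complex.Im x * complex.Im y.
Proof. by case: x y => [a b] [c d]. Qed.
Lemma cImM x y : complex.Im (x * y) =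
  complex.Re x * complex.Im y + complex.Im x * complex.Re y.
Proof. by case: x y => [a b] [c d]. Qed.
Lemma cReJ x : complex.Re x^*%C = complex.Re x.
Proof. by case: x. Qed.
Lemma cImJ x : complex.Im x^*%C = - complex.Im x.
Proof. by case: x. Qed.

Lemma complex_eqP x y :
  complex.Re x = complex.Re y -> complex.Im x = complex.Im y -> x = y.
Proof. by case: x y => [a b] [c d] /= -> ->. Qed.

Lemma conjcD x y : (x + y)^*%C = x^*%C + y^*%C. Proof. exact: rmorphD. Qed.
Lemma conjcB x y : (x - y)^*%C = x^*%C - y^*%C. Proof. exact: rmorphB. Qed.
Lemma conjcM x y : (x * y)^*%C = x^*%C * y^*%C. Proof. exact: rmorphM. Qed.
Lemma conjcX x n : (x ^+ n)^*%C = x^*%C ^+ n. Proof. exact: rmorphXn. Qed.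
Lemma conjc_i : ('i%C : R[i])^*%C = - 'i%C.
Proof. by apply: complex_eqP => /=; rewrite ?oppr0. Qed.
Lemma conjc_sum n (f : 'I_n -> R[i]) : (\sum_j f j)^*%C = \sum_j (f j)^*%C.
Proof. exact: rmorph_sum. Qed.

Lemma cexpD x y : cexp (x + y) = cexp x * cexp y.
Proof.
apply: complex_eqP; rewrite /cexp cReD cImD !(cReM, cImM)/= cosD sinD expRD.
  by ring.
by ring.
Qed.

Lemma cexp0 : cexp 0 = 1 :> R[i].
Proof. by apply: complex_eqP; rewrite /cexp !(cReM, cImM)/= expR0 cos0 sin0; ring. Qed.

Lemma cabs_cexp x : cabs (cexp x) = expR (complex.Re x).
Proof.
by rewrite /cexp cabsM cabs_real ger0_norm ?expR_ge0// cabsE /= cos2Dsin2 sqrtr1 mulr1.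
Qed.

Lemma cexp_neq0 x : cexp x != 0.
Proof. by rewrite -cabs_gt0 cabs_cexp expR_gt0. Qed.

Definition echar s z : R[i] := cexp ((2 * pi)%:C * 'i%C * s%:C * z).

Lemma echarDl s t z : echar (s + t) z = echar s z * echar t z.
Proof. by rewrite /echar -cexpD rmorphD/=; congr cexp; ring. Qed.

Lemma echarDr s z w : echar s (z + w) = echar s z * echar s w.
Proof. by rewrite /echar -cexpD; congr cexp; ring. Qed.

Lemma echar0l z : echar 0 z = 1.
Proof. by rewrite /echar rmorph0 mulr0 mul0r cexp0. Qed.

Lemma echar0r s : echar s 0 = 1.
Proof. by rewrite /echar mulr0 cexp0. Qed.

Lemma echarNN s z : echar (- s) (- z) = echar s z.
Proof. by rewrite /echar rmorphN/=; congr cexp; ring. Qed.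

Lemma echarN s z : echar (- s) z = echar s (- z).
Proof. by rewrite -echarNN opprK. Qed.

Lemma echar_neq0 s z : echar s z != 0.
Proof. exact: cexp_neq0. Qed.

Lemma echarK s z : echar s z * echar (- s) z = 1.
Proof. by rewrite -echarDl subrr echar0l. Qed.

Lemma echar_fourier s z : cexp (- (2 * pi)%:C * 'i%C * s%:C * z) = echar (- s) z.
Proof. by rewrite /echar rmorphN/=; congr cexp; ring. Qed.

Lemma Re_echarexp s z : complex.Re ((2 * pi)%:C * 'i%C * s%:C * z) =
  - (2 * pi * s * complex.Im z).
Proof. by rewrite !(cReM, cImM)/=; ring. Qed.

Lemma Im_echarexp s z : complex.Im ((2 * pi)%:C * 'i%C * s%:C * z) =
  2 * pi * s * complex.Re z.
Proof. by rewrite !(cReM, cImM)/=; ring. Qed.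

Lemma Re_echar s z : complex.Re (echar s z) =
  expR (- (2 * pi * s * complex.Im z)) * cos (2 * pi * s * complex.Re z).
Proof. by rewrite /echar /cexp Re_echarexp Im_echarexp cReM/=; ring. Qed.

Lemma Im_echar s z : complex.Im (echar s z) =
  expR (- (2 * pi * s * complex.Im z)) * sin (2 * pi * s * complex.Re z).
Proof. by rewrite /echar /cexp Re_echarexp Im_echarexp cImM/=; ring. Qed.

Lemma cabs_echar s z : cabs (echar s z) = expR (- (2 * pi * s * complex.Im z)).
Proof. by rewrite /echar cabs_cexp Re_echarexp. Qed.

Lemma echarJ s z : (echar s z)^*%C = echar (- s) z^*%C.
Proof.
apply: complex_eqP; rewrite ?cReJ ?cImJ !(Re_echar, Im_echar) cReJ cImJ;
  rewrite !mulrN !mulNr !opprK.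
  by rewrite cosN.
by rewrite sinN mulrN.
Qed.

End ComplexBasics.

Arguments echar : simpl never.
Arguments cexp : simpl never.
Arguments cabs : simpl never.

(** * Componentwise derivatives along the real line *)

Section ComplexDerivative.
Variable R : realType.
Implicit Types (f g : R -> R[i]) (x s : R) (z d e : R[i]).

(** Componentwise, so that the mean value theorem and the fundamental theorem of calculus for real
    functions apply. The variable is real; [cderivable] is the complex notion. *)
Definition is_cderive f x d : Prop :=
  is_derive x 1 (fun t => complex.Re (f t)) (complex.Re d) /\
  is_derive x 1 (fun t => complex.Im (f t)) (complex.Im d).

Lemma is_cderive_eq f x d e : is_cderive f x d -> d = e -> is_cderive f x e.
Proof. by move=> h <-. Qed.

Lemma is_cderive_cst z x : is_cderive (fun=> z) x 0.
Proof. by split => /=; apply: is_derive_cst. Qed.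

Lemma is_cderiveD f g x d e : is_cderive f x d -> is_cderive g x e ->
  is_cderive (fun t => f t + g t) x (d + e).
Proof.
move=> [f1 f2] [g1 g2]; rewrite /is_cderive cReD cImD; split.
  rewrite (_ : (fun _ => _) = (fun t => complex.Re (f t)) \+ (fun t => complex.Re (g t))).
    exact: is_deriveD.
  by apply/funext => t /=; rewrite cReD.
rewrite (_ : (fun _ => _) = (fun t => complex.Im (f t)) \+ (fun t => complex.Im (g t))).
  exact: is_deriveD.
by apply/funext => t /=; rewrite cImD.
Qed.

Lemma is_cderiveN f x d : is_cderive f x d -> is_cderive (fun t => - f t) x (- d).
Proof.
move=> [f1 f2]; rewrite /is_cderive cReN cImN; split.
  rewrite (_ : (fun _ => _) = - (fun t => complex.Re (f t))).
    exact: is_deriveN.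
  by apply/funext => t /=; rewrite cReN.
rewrite (_ : (fun _ => _) = - (fun t => complex.Im (f t))).
  exact: is_deriveN.
by apply/funext => t /=; rewrite cImN.
Qed.

Lemma is_cderiveB f g x d e : is_cderive f x d -> is_cderive g x e ->
  is_cderive (fun t => f t - g t) x (d - e).
Proof. by move=> hf hg; apply: is_cderiveD => //; apply: is_cderiveN. Qed.

Lemma is_cderiveM f g x d e : is_cderive f x d -> is_cderive g x e ->
  is_cderive (fun t => f t * g t) x (d * g x + f x * e).
Proof.
move=> [f1 f2] [g1 g2]; split.
  rewrite (_ : (fun _ => _) =
     (fun t => complex.Re (f t)) * (fun t => complex.Re (g t)) -
     (fun t => complex.Im (f t)) * (fun t => complex.Im (g t))); last first.
    by apply/funext => t /=; rewrite cReM.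
  apply: (is_derive_eq (is_deriveB (is_deriveM f1 g1) (is_deriveM f2 g2))).
  by rewrite cReD !cReM /GRing.scale/=; ring.
rewrite (_ : (fun _ => _) =
     (fun t => complex.Re (f t)) * (fun t => complex.Im (g t)) +
     (fun t => complex.Im (f t)) * (fun t => complex.Re (g t))); last first.
  by apply/funext => t /=; rewrite cImM.
apply: (is_derive_eq (is_deriveD (is_deriveM f1 g2) (is_deriveM f2 g1))).
by rewrite cImD !cImM /GRing.scale/=; ring.
Qed.

Lemma is_cderive_shift f x (c : R) d :
  is_cderive f (x - c) d -> is_cderive (fun t => f (t - c)) x d.
Proof.
have h : is_derive x 1 (fun t : R => t - c) 1.
  by apply: is_derive_eq; rewrite subr0.
move=> [f1 f2]; split.
  have := @is_derive1_comp R (fun t => complex.Re (f t)) (fun t => t - c) x _ _ f1 h.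
  by rewrite mulr1.
have := @is_derive1_comp R (fun t => complex.Im (f t)) (fun t => t - c) x _ _ f2 h.
by rewrite mulr1.
Qed.

Lemma is_cderive_echar z x :
  is_cderive (fun t => echar t z) x ((2 * pi)%:C * 'i%C * z * echar x z).
Proof.
have h1 : is_derive x 1 (fun t : R => expR (- (2 * pi * t * complex.Im z)))
    (- (2 * pi * complex.Im z) * expR (- (2 * pi * x * complex.Im z))).
  have h : is_derive x 1 (fun t : R => - (2 * pi * t * complex.Im z))
    (- (2 * pi * complex.Im z)).
    rewrite (_ : (fun _ => _) = (- (2 * pi * complex.Im z)) \*: (@id R)).
      by apply: is_derive_eq; rewrite /GRing.scale/= mulr1.
    by apply/funext => t /=; rewrite /GRing.scale/=; ring.
  apply: is_derive_eq (@is_derive1_comp R expR _ x _ _ (is_derive_expR _) h) _.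
  by rewrite mulrC.
have h : is_derive x 1 (fun t : R => 2 * pi * t * complex.Re z)
    (2 * pi * complex.Re z).
  rewrite (_ : (fun _ => _) = (2 * pi * complex.Re z) \*: (@id R)).
    by apply: is_derive_eq; rewrite /GRing.scale/= mulr1.
  by apply/funext => t /=; rewrite /GRing.scale/=; ring.
have h2 := @is_derive1_comp R cos _ x _ _ (is_derive_cos _) h.
have h3 := @is_derive1_comp R sin _ x _ _ (is_derive_sin _) h.
split.
  rewrite (_ : (fun _ => _) = (fun t : R => expR (- (2 * pi * t * complex.Im z))) *
     (cos \o (fun t : R => 2 * pi * t * complex.Re z))); last first.
    by apply/funext => t; rewrite Re_echar.
  apply: is_derive_eq.
  rewrite !(Re_echar, Im_echar, cReM, cImM) /GRing.scale/=; ring.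
rewrite (_ : (fun _ => _) = (fun t : R => expR (- (2 * pi * t * complex.Im z))) *
     (sin \o (fun t : R => 2 * pi * t * complex.Re z))); last first.
  by apply/funext => t; rewrite Im_echar.
apply: is_derive_eq.
rewrite !(Re_echar, Im_echar, cReM, cImM) /GRing.scale/=; ring.
Qed.

End ComplexDerivative.

(** * Complex integration *)

Section ComplexLimits.
Variable R : realType.
Implicit Types (u v : nat -> R[i]) (l m z : R[i]).

(** The distance is the real number [cabs], so that squeeze arguments stay in [R]. *)
Definition ccvg u l : Prop := (fun n => cabs (u n - l)) @ \oo --> (0 : R).

Lemma ccvg_squeeze u l (r : nat -> R) :
  (\forall n \near \oo, cabs (u n - l) <= r n) -> r @ \oo --> (0 : R) -> ccvg u l.
Proof.
move=> ur r0; apply: (@squeeze_cvgr _ _ _ _ (cst 0) r) => //; last exact: cvg_cst.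
by apply: filterS ur => n -> /=; rewrite cabs_ge0.
Qed.

Lemma ccvgP u l : ccvg u l <->
  ((fun n => complex.Re (u n)) @ \oo --> complex.Re l /\
   (fun n => complex.Im (u n)) @ \oo --> complex.Im l).
Proof.
split=> [h|[h1 h2]].
  split; apply/cvgrPdist_le => e e0; move/cvgrPdist_le : h => /(_ _ e0);
    apply: filterS => n; rewrite sub0r normrN ger0_norm ?cabs_ge0// => h;
    rewrite distrC; apply: le_trans h.
    by rewrite -cReN -cReD Re_le_cabs.
  by rewrite -cImN -cImD Im_le_cabs.
apply: (@ccvg_squeeze _ _ (fun n => `|complex.Re (u n) - complex.Re l| +
   `|complex.Im (u n) - complex.Im l|)).
  by apply: nearW => n; rewrite (le_trans (cabs_le _))// cReD cReN cImD cImN.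
have key (r : nat -> R) (a : R) : r @ \oo --> a -> (fun n => `|r n - a|) @ \oo --> (0 : R).
  move=> ra; rewrite -(normr0 R) -(subrr a); apply: cvg_norm.
  by apply: cvgB => //; exact: cvg_cst.
by rewrite -[X in _ --> X](addr0 0); apply: cvgD; exact: key.
Qed.

Lemma ccvg_unique u l m : ccvg u l -> ccvg u m -> l = m.
Proof.
move=> /ccvgP[a b] /ccvgP[c d]; apply: complex_eqP.
  exact: (cvg_unique _ a c).
exact: (cvg_unique _ b d).
Qed.

Lemma ccvg_cst l : ccvg (fun=> l) l.
Proof. by rewrite /ccvg subrr cabs0; exact: cvg_cst. Qed.

Lemma ccvg_near u v l : (\forall n \near \oo, u n = v n) -> ccvg u l -> ccvg v l.
Proof.
move=> uv; apply: cvg_trans; apply: near_eq_cvg.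
by apply: filterS uv => n ->.
Qed.

Lemma ccvgD u v l m : ccvg u l -> ccvg v m -> ccvg (fun n => u n + v n) (l + m).
Proof.
move=> /ccvgP[a b] /ccvgP[c d]; apply/ccvgP; rewrite cReD cImD; split.
  under eq_fun do rewrite cReD; exact: cvgD.
under eq_fun do rewrite cImD; exact: cvgD.
Qed.

Lemma ccvgN u l : ccvg u l -> ccvg (fun n => - u n) (- l).
Proof.
move=> /ccvgP[a b]; apply/ccvgP; rewrite cReN cImN; split.
  under eq_fun do rewrite cReN; exact: cvgN.
under eq_fun do rewrite cImN; exact: cvgN.
Qed.

Lemma ccvgB u v l m : ccvg u l -> ccvg v m -> ccvg (fun n => u n - v n) (l - m).
Proof. by move=> a b; apply: ccvgD => //; exact: ccvgN. Qed.

Lemma ccvgM u v l m : ccvg u l -> ccvg v m -> ccvg (fun n => u n * v n) (l * m).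
Proof.
move=> /ccvgP[a b] /ccvgP[c d]; apply/ccvgP; rewrite cReM cImM; split.
  under eq_fun do rewrite cReM; apply: cvgB; exact: cvgM.
under eq_fun do rewrite cImM; apply: cvgD; exact: cvgM.
Qed.

Lemma ccvgMl z u l : ccvg u l -> ccvg (fun n => z * u n) (z * l).
Proof. by move=> h; apply: ccvgM h; exact: ccvg_cst. Qed.

Lemma ccvgJ u l : ccvg u l -> ccvg (fun n => (u n)^*%C) l^*%C.
Proof.
move=> /ccvgP[a b]; apply/ccvgP; rewrite cReJ cImJ; split.
  by under eq_fun do rewrite cReJ.
by under eq_fun do rewrite cImJ; exact: cvgN.
Qed.

Lemma ccvg_sum k (u : 'I_k -> nat -> R[i]) (l : 'I_k -> R[i]) :
  (forall j, ccvg (u j) (l j)) ->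
  ccvg (fun n => \sum_(j < k) u j n) (\sum_(j < k) l j).
Proof.
elim: k u l => [|k IH] u l h.
  by under eq_fun do rewrite big_ord0; rewrite big_ord0; exact: ccvg_cst.
under eq_fun do rewrite big_ord_recl; rewrite big_ord_recl.
by apply: ccvgD => //; apply: IH.
Qed.

End ComplexLimits.

Section ComplexMeasurable.
Variables (R : realType) (d : measure_display) (T : measurableType d).
Variable D : set T.
Hypothesis mD : measurable D.
Implicit Types (f g : T -> R[i]).

Definition cmeasurable_fun f : Prop :=
  measurable_fun D (fun t => complex.Re (f t)) /\
  measurable_fun D (fun t => complex.Im (f t)).

Lemma cmeasurable_cst z : cmeasurable_fun (fun=> z).
Proof. by split; exact: measurable_cst. Qed.

Lemma cmeasurableD f g : cmeasurable_fun f -> cmeasurable_fun g ->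
  cmeasurable_fun (fun t => f t + g t).
Proof.
move=> [a b] [c e]; split.
  by under eq_fun do rewrite cReD; exact: measurable_funD.
by under eq_fun do rewrite cImD; exact: measurable_funD.
Qed.

Lemma cmeasurableN f : cmeasurable_fun f -> cmeasurable_fun (fun t => - f t).
Proof.
move=> [a b]; split.
  by under eq_fun do rewrite cReN; exact: measurable_funN.
by under eq_fun do rewrite cImN; exact: measurable_funN.
Qed.

Lemma cmeasurableB f g : cmeasurable_fun f -> cmeasurable_fun g ->
  cmeasurable_fun (fun t => f t - g t).
Proof. by move=> a b; apply: cmeasurableD => //; exact: cmeasurableN. Qed.

Lemma cmeasurableM f g : cmeasurable_fun f -> cmeasurable_fun g ->
  cmeasurable_fun (fun t => f t * g t).
Proof.
move=> [a b] [c e]; split.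
  by under eq_fun do rewrite cReM; apply: measurable_funB; exact: measurable_funM.
by under eq_fun do rewrite cImM; apply: measurable_funD; exact: measurable_funM.
Qed.

Lemma cmeasurableX f n : cmeasurable_fun f -> cmeasurable_fun (fun t => f t ^+ n).
Proof.
move=> h; elim: n => [|n IH].
  by under eq_fun do rewrite expr0; exact: cmeasurable_cst.
by under eq_fun do rewrite exprS; exact: cmeasurableM.
Qed.

Lemma cmeasurableV f : cmeasurable_fun f -> cmeasurable_fun (fun t => (f t)^-1).
Proof.
move=> [a b].
(* The measurable power function with exponent -1 agrees with the inverse on all nonnegative
   numbers, 0 included. *)
pose n2 t := (complex.Re (f t) ^+ 2 + complex.Im (f t) ^+ 2) `^ (-1).
have n2E t : n2 t = (complex.Re (f t) ^+ 2 + complex.Im (f t) ^+ 2)^-1.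
  by rewrite /n2 -powR_inv1// addr_ge0 ?sqr_ge0.
have mn2 : measurable_fun D n2.
  have h : measurable_fun D (fun t => complex.Re (f t) ^+ 2 + complex.Im (f t) ^+ 2).
    by apply: measurable_funD; exact: measurable_funX.
  exact: (measurableT_comp (measurable_powR (-1)) h).
split.
  rewrite (_ : (fun _ => _) = (fun t => complex.Re (f t)) \* n2).
    exact: measurable_funM.
  by apply/funext => t /=; rewrite n2E; case: (f t).
rewrite (_ : (fun _ => _) = (\- (fun t => complex.Im (f t))) \* n2).
  by apply: measurable_funM => //; exact: measurable_funN.
by apply/funext => t /=; rewrite n2E; case: (f t) => x y /=; rewrite mulNr.
Qed.

Lemma cmeasurable_cabs f : cmeasurable_fun f ->
  measurable_fun D (fun t => cabs (f t)).
Proof.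
move=> [a b].
rewrite (_ : (fun _ => _) = (fun t : T =>
  (complex.Re (f t) ^+ 2 + complex.Im (f t) ^+ 2) `^ (2^-1))); last first.
  by apply/funext => t; rewrite cabsE powR12_sqrt// addr_ge0 ?sqr_ge0.
have h : measurable_fun D (fun t => complex.Re (f t) ^+ 2 + complex.Im (f t) ^+ 2).
  by apply: measurable_funD; exact: measurable_funX.
exact: (measurableT_comp (measurable_powR (2^-1)) h).
Qed.

End ComplexMeasurable.

Section ComplexIntegral.
Variables (R : realType) (d : measure_display) (T : measurableType d).
Variables (m : {measure set T -> \bar R}) (D : set T).
Hypothesis mD : measurable D.
Implicit Types (f g : T -> R[i]) (b : T -> R) (z : R[i]).

Definition cintegrableT f : Prop :=
  m.-integrable D (EFin \o (fun t => complex.Re (f t))) /\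
  m.-integrable D (EFin \o (fun t => complex.Im (f t))).

Definition cintT f : R[i] :=
  (\int[m]_(t in D) complex.Re (f t)) +i* (\int[m]_(t in D) complex.Im (f t)).

Lemma cintegrable_dom f b : cmeasurable_fun D f -> m.-integrable D (EFin \o b) ->
  (forall t, D t -> cabs (f t) <= b t) -> cintegrableT f.
Proof.
move=> [mf1 mf2] ib fb.
have b0 t : D t -> `|b t| = b t.
  by move=> Dt; rewrite ger0_norm// (le_trans _ (fb _ Dt)) ?cabs_ge0.
split; apply: (le_integrable mD _ _ ib).
- exact/measurable_EFinP.
- move=> t Dt /=; rewrite lee_fin b0//.
  exact: le_trans (Re_le_cabs _) (fb _ Dt).
- exact/measurable_EFinP.
- move=> t Dt /=; rewrite lee_fin b0//.
  exact: le_trans (Im_le_cabs _) (fb _ Dt).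
Qed.

Lemma cintD f g : cintegrableT f -> cintegrableT g ->
  cintT (fun t => f t + g t) = cintT f + cintT g.
Proof.
move=> [f1 f2] [g1 g2]; rewrite /cintT; apply: complex_eqP.
  rewrite cReD/= -RintegralD//; apply: eq_Rintegral => t _; exact: cReD.
rewrite cImD/= -RintegralD//; apply: eq_Rintegral => t _; exact: cImD.
Qed.

Lemma cintZ z f : cintegrableT f -> cintT (fun t => z * f t) = z * cintT f.
Proof.
move=> [f1 f2]; rewrite /cintT; apply: complex_eqP.
  rewrite cReM/= -!RintegralZl// -RintegralB//; first last.
  - exact: (integrableZl mD _ f2).
  - exact: (integrableZl mD _ f1).
  by apply: eq_Rintegral => t _; exact: cReM.
rewrite cImM/= -!RintegralZl// -RintegralD//; first last.
- exact: (integrableZl mD _ f1).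
- exact: (integrableZl mD _ f2).
by apply: eq_Rintegral => t _; exact: cImM.
Qed.

Lemma eq_cint f g : (forall t, D t -> f t = g t) -> cintT f = cintT g.
Proof.
move=> fg; rewrite /cintT; congr (_ +i* _); apply: eq_Rintegral => t /[!inE] Dt;
  by rewrite fg.
Qed.

Lemma cintegrableT_ext f g : (forall t, D t -> f t = g t) ->
  cintegrableT f -> cintegrableT g.
Proof.
move=> fg [i1 i2]; split; [move: i1|move: i2]; apply: eq_integrable => // t /[!inE] Dt /=;
  by rewrite fg.
Qed.

Lemma cintJ f : cintegrableT f -> cintT (fun t => (f t)^*%C) = (cintT f)^*%C.
Proof.
move=> [i1 i2]; rewrite /cintT; apply: complex_eqP; rewrite ?cReJ ?cImJ /=.
  by apply: eq_Rintegral => t _; rewrite cReJ.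
rewrite -mulN1r -RintegralZl//; apply: eq_Rintegral => t _; rewrite cImJ mulN1r//.
Qed.

Lemma cintegrableT_D f g : cintegrableT f -> cintegrableT g ->
  cintegrableT (fun t => f t + g t).
Proof.
move=> [f1 f2] [g1 g2]; split.
  under eq_fun do rewrite cReD; exact: (integrableD mD f1 g1).
under eq_fun do rewrite cImD; exact: (integrableD mD f2 g2).
Qed.

Lemma cintegrableT_Z z f : cintegrableT f -> cintegrableT (fun t => z * f t).
Proof.
move=> [f1 f2]; split.
  under eq_fun do rewrite cReM.
  exact: (integrableB mD (integrableZl mD _ f1) (integrableZl mD _ f2)).
under eq_fun do rewrite cImM.
exact: (integrableD mD (integrableZl mD _ f2) (integrableZl mD _ f1)).
Qed.

(** The factor 2 comes from estimating the real and the imaginary part separately; it accounts for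
    the factors 2 and 4 in later constants. *)
Lemma cabs_cint_le f b : cintegrableT f -> m.-integrable D (EFin \o b) ->
  (forall t, D t -> cabs (f t) <= b t) -> cabs (cintT f) <= 2 * \int[m]_(t in D) b t.
Proof.
move=> [f1 f2] ib fb; rewrite (le_trans (cabs_le _))// /cintT/= mulr_natl mulr2n.
apply: lerD.
  apply: (le_trans (le_normr_Rintegral mD f1)).
  apply: (le_Rintegral mD (integrable_abse f1) ib) => t Dt.
  exact: le_trans (Re_le_cabs _) (fb _ Dt).
apply: (le_trans (le_normr_Rintegral mD f2)).
apply: (le_Rintegral mD (integrable_abse f2) ib) => t Dt.
exact: le_trans (Im_le_cabs _) (fb _ Dt).
Qed.

Lemma cint_cvg (f_ : nat -> T -> R[i]) f b :
  (forall n, cmeasurable_fun D (f_ n)) -> cmeasurable_fun D f ->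
  (forall t, D t -> ccvg (f_ ^~ t) (f t)) ->
  m.-integrable D (EFin \o b) ->
  (forall n t, D t -> cabs (f_ n t) <= b t) ->
  ccvg (fun n => cintT (f_ n)) (cintT f).
Proof.
move=> mf_ mf ff ib fb; apply/ccvgP.
have key (p : R[i] -> R) : (forall n, measurable_fun D (p \o f_ n)) ->
  measurable_fun D (p \o f) ->
  (forall t, D t -> (fun n => p (f_ n t)) @ \oo --> p (f t)) ->
  (forall z, `|p z| <= cabs z) ->
  (fun n => \int[m]_(t in D) p (f_ n t)) @ \oo --> \int[m]_(t in D) p (f t).
  move=> h1 h2 h3 h4.
  have [|||||ipf _ +] := @dominated_convergence _ T R m D mD (fun n t => (p (f_ n t))%:E)
    (fun t => (p (f t))%:E) (EFin \o b).
  - by move=> n; apply/measurable_EFinP; exact: h1.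
  - by apply/measurable_EFinP; exact: h2.
  - by apply: aeW => t Dt; apply: cvg_EFin; [exact: nearW|exact: h3].
  - exact: ib.
  - by apply: aeW => t n Dt; rewrite lee_fin (le_trans (h4 _))// fb.
  move=> h; rewrite /Rintegral; apply: fine_cvg; rewrite fineK//.
  exact: (integrable_fin_num mD ipf).
split; apply: key.
- by move=> n; case: (mf_ n).
- by case: mf.
- by move=> t Dt; have /ccvgP[] := ff t Dt.
- exact: Re_le_cabs.
- by move=> n; case: (mf_ n).
- by case: mf.
- by move=> t Dt; have /ccvgP[] := ff t Dt.
- exact: Im_le_cabs.
Qed.

End ComplexIntegral.

(** * Unordered sums as integrals *)

Section CountingIntegral.
Variables (R : realType) (T : pointedType).

(* The discrete sigma-algebra turns unordered sums into integrals against the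
   counting measure, so that one integration theory serves both. *)
Definition discrete_space := g_sigma_algebraType [set: set T].

Lemma measurable_discrete (A : set discrete_space) : measurable A.
Proof. by apply: sub_sigma_algebra. Qed.

Lemma measurable_fun_discrete d (U : sigmaRingType d) (D : set discrete_space)
  (f : discrete_space -> U) : measurable_fun D f.
Proof. by move=> _ B _; exact: measurable_discrete. Qed.

Definition count_measure : {measure set discrete_space -> \bar R} :=
  @counting discrete_space R.
Local Notation cnt := count_measure.

Lemma integral_counting_subsingleton (A : set T) (f : T -> R) :
  (forall x, 0 <= f x) -> (forall x y, A x -> A y -> x = y) ->
  (\int[cnt]_(x in A) (f x)%:E = \esum_(x in A) (f x)%:E)%E.
Proof.
move=> f0 A1; have [->|/set0P[x Ax]] := eqVneq A set0.
  by rewrite integral_set0 esum_set0.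
have -> : A = [set x] by apply/seteqP; split=> [y Ay|y ->//]; exact: A1.
rewrite esum_set1 ?lee_fin// (eq_integral (fun=> (f x)%:E)); last first.
  by move=> y; rewrite inE => ->.
rewrite integral_cst; last exact: measurable_discrete.
by rewrite /= /counting asboolT ?finite_set1// fset_set1 finmap.cardfs1 mule1.
Qed.

(** Finiteness of the sum makes the support of [f] countable; both sides then split, by countable
    additivity, over the points of the support, where they agree. *)
Lemma integral_counting (D : set T) (f : T -> R) : (forall x, 0 <= f x) ->
  (\esum_(x in D) (f x)%:E < +oo)%E ->
  (\int[cnt]_(x in D) (f x)%:E = \esum_(x in D) (f x)%:E)%E.
Proof.
move=> f0 fD.
pose S := [set x | D x /\ f x != 0].
have cS : countable S.
  (* Each level set is finite: more than [M * n.+1] of its points would already push the sum above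
     its bound [M]. *)
  pose Fn (n : nat) := [set x | D x /\ n.+1%:R^-1 <= f x].
  have -> : S = \bigcup_n Fn n.
    apply/seteqP; split=> [x [Dx fx0]|x [n _ [Dx fx]]]; last first.
      by split => //; rewrite gt_eqF// (lt_le_trans _ fx)// invr_gt0.
    have fx : 0 < f x by rewrite lt_neqAle eq_sym fx0 f0.
    exists (Num.truncn (f x)^-1) => //; split => //.
    rewrite -[leRHS]invrK lef_pV2 ?posrE ?invr_gt0//.
    by rewrite ltW// truncnS_gt// .
  apply: bigcup_countable => // n _; apply: finite_set_countable.
  apply: contrapT => iF.
  have [M MD] : exists M : R, (\esum_(x in D) (f x)%:E < M%:E)%E.
    move: fD; rewrite -ge0_fin_numE ?esum_ge0// => [/fineK <-|x _]; last by rewrite lee_fin.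
    by exists (fine (\esum_(x in D) (f x)%:E) + 1); rewrite lte_fin ltrDl.
  have [B BF cB] := @infinite_set_fset _ _ (Num.truncn (M * n.+1%:R)).+1 iF.
  move: MD; apply/negP; rewrite -leNgt.
  suff h : (M%:E <= \sum_(x \in [set` B]) (f x)%:E)%E.
    apply: (le_trans h); apply: ereal_sup_ubound; exists [set` B] => //.
    by split => // x /BF [].
  rewrite fsbig_finite// set_fsetK sumEFin lee_fin.
  apply: (@le_trans _ _ (\sum_(x <- B) n.+1%:R^-1)); last first.
    rewrite big_seq [leRHS]big_seq; apply: ler_sum => x xB.
    by have [] := BF x xB.
  rewrite big_const_seq count_predT iter_addr_0 -[leRHS]mulr_natl ler_pdivlMr// .
  apply: (le_trans (ltW (truncnS_gt _))); rewrite ler_nat//.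
have -> : (\int[cnt]_(x in D) (f x)%:E = \int[cnt]_(x in S) (f x)%:E)%E.
  rewrite integral_mkcond [RHS]integral_mkcond; apply: eq_integral => x _.
  rewrite !patchE; have [fx|fx] := eqVneq (f x) 0.
    by rewrite fx; case: ifP; case: ifP.
  congr (if _ then _ else _); apply/idP/idP; rewrite !inE; first by split.
  by case.
have -> : (\esum_(x in D) (f x)%:E = \esum_(x in S) (f x)%:E)%E.
  rewrite esum_mkcond [RHS]esum_mkcond; apply: eq_esum => x _.
  have [fx|fx] := eqVneq (f x) 0.
    by rewrite fx; case: ifP; case: ifP.
  congr (if _ then _ else _); apply/idP/idP; rewrite !inE; first by split.
  by case.
have /countable_injP[e einj] := cS.
(* The fibres of an injection into the natural numbers have at most one point; empty fibres are
   harmless. *)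
pose F (n : nat) : set T := [set x | S x /\ e x = n].
have SF : S = \bigcup_n F n.
  by apply/seteqP; split=> [x Sx|x [n _ []//]]; exists (e x).
have tF : trivIset [set: nat] F.
  by apply/trivIsetP => i j _ _ /eqP ij; apply/seteqP; split => // x [[_ ?] [_ ?]]; apply: ij; congruence.
rewrite SF ge0_integral_bigcup//; first last.
- by move=> x _; rewrite lee_fin.
- exact: measurable_fun_discrete.
- by move=> k; exact: measurable_discrete.
rewrite nneseries_sum_bigcup//.
apply: eq_eseriesr => i _; apply: integral_counting_subsingleton => // x y [Sx ex] [Sy ey].
by apply: einj; rewrite ?inE// ex.
Qed.

Lemma integrable_counting (D : set T) (b : T -> R) :
  (\esum_(x in D) `|b x|%:E < +oo)%E -> count_measure.-integrable D (EFin \o b).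
Proof.
move=> bD; apply/integrableP; split; first exact: measurable_fun_discrete.
have E := @integral_counting D (fun x => `|b x|) (fun x => normr_ge0 _) bD.
by rewrite -E in bD.
Qed.

Lemma Rintegral_counting (D : set T) (b : T -> R) : (forall x, 0 <= b x) ->
  (\esum_(x in D) (b x)%:E < +oo)%E ->
  \int[cnt]_(x in D) b x = fine (\esum_(x in D) (b x)%:E).
Proof. by move=> b0 bD; rewrite /Rintegral integral_counting. Qed.

Lemma csummable_cintegrable (D : set T) (f : T -> R[i]) :
  csummable D f -> cintegrableT cnt D f.
Proof.
move=> fD; split; apply: integrable_counting; apply: le_lt_trans fD;
  apply: le_esum => x _; rewrite lee_fin.
  exact: Re_le_cabs.
exact: Im_le_cabs.
Qed.

(** [csum] and the integral are both built from positive and negative parts, so the nonnegative case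
    [integral_counting] applies to each of the four pieces. *)
Lemma csum_cint (D : set T) (f : T -> R[i]) :
  csummable D f -> csum D f = cintT cnt D f.
Proof.
move=> fD.
have key (p : R[i] -> R) : (forall z, `|p z| <= cabs z) ->
  fine (\esum_(x in D) (Num.max (p (f x)) 0)%:E) -
  fine (\esum_(x in D) (Num.max (- p (f x)) 0)%:E) = \int[cnt]_(x in D) p (f x).
  move=> pz.
  have ip : count_measure.-integrable D (EFin \o (fun x => p (f x))).
    apply: integrable_counting; apply: le_lt_trans fD.
    by apply: le_esum => x _; rewrite lee_fin.
  have h (g : T -> R) : (forall x, g x <= cabs (f x)) ->
    (\esum_(x in D) (Num.max (g x) 0)%:E < +oo)%E.
    move=> gf; apply: le_lt_trans fD; apply: le_esum => x _.
    by rewrite lee_fin ge_max gf cabs_ge0.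
  have h1 : (\esum_(x in D) (Num.max (p (f x)) 0)%:E < +oo)%E.
    by apply: h => x; exact: le_trans (ler_norm _) (pz _).
  have h2 : (\esum_(x in D) (Num.max (- p (f x)) 0)%:E < +oo)%E.
    by apply: h => x; rewrite (le_trans _ (pz _))// -normrN ler_norm.
  have pos (g : T -> R) x : 0 <= Num.max (g x) 0 by rewrite le_max lexx orbT.
  have E : (\int[count_measure]_(x in D) (p (f x))%:E =
     \int[count_measure]_(x in D) (Num.max (p (f x)) 0)%:E -
     \int[count_measure]_(x in D) (Num.max (- p (f x)) 0)%:E)%E.
    rewrite integralE; congr (_ - _)%E; apply: eq_integral => x _.
      by rewrite funeposE EFin_max.
    by rewrite funenegE EFin_max EFinN.
  rewrite /Rintegral E (integral_counting (pos _) h1) (integral_counting (pos _) h2) fineB//.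
    by rewrite ge0_fin_numE// esum_ge0// => x _; rewrite lee_fin le_max lexx orbT.
  by rewrite ge0_fin_numE// esum_ge0// => x _; rewrite lee_fin le_max lexx orbT.
rewrite /csum /cintT; congr (_ +i* _); apply: key.
  exact: Re_le_cabs.
exact: Im_le_cabs.
Qed.

Lemma csummable_dom (D : set T) (f : T -> R[i]) (b : T -> R) :
  (\esum_(x in D) (b x)%:E < +oo)%E -> (forall x, D x -> cabs (f x) <= b x) ->
  csummable D f.
Proof.
by move=> bD fb; apply: le_lt_trans bD; apply: le_esum => x Dx; rewrite lee_fin fb.
Qed.

End CountingIntegral.

(** * Pairing with a tempered strip measure *)

Section CountingIntegral2.
Variable R : realType.

(** Singles out the frequency 0 of the Dirichlet series, and later the atom that sits at a
    prospective pole. *)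
Lemma cint_setD1 (T : pointedType) (A : set T) (p : T) (f : T -> R[i]) :
  cintegrableT (count_measure R T) A f -> A p ->
  cintT (count_measure R T) A f =
  f p + cintT (count_measure R T) (A `\ p) f.
Proof.
move=> [i1 i2] Ap.
have key (g : T -> R) : (count_measure R T).-integrable A (EFin \o g) ->
    \int[count_measure R T]_(x in A) g x =
    g p + \int[count_measure R T]_(x in A `\ p) g x.
  move=> ig; rewrite -{1}(setD1K Ap) Rintegral_setU ?setD1K//; first last.
  - by rewrite disj_set2E; apply/eqP/seteqP; split => // x [/= ->] [].
  - exact: measurable_discrete.
  - exact: measurable_discrete.
  congr (_ + _).
  have -> : \int[count_measure R T]_(x in [set p]) g x =
            \int[count_measure R T]_(x in [set p]) g p.
    by apply: eq_Rintegral => x; rewrite inE => ->.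
  rewrite Rintegral_cst; last exact: measurable_discrete.
  by rewrite /= /counting asboolT ?finite_set1// fset_set1 finmap.cardfs1 mulr1.
by rewrite /cintT; apply: complex_eqP; rewrite ?(cReD, cImD)/= key.
Qed.

Lemma csum_reindex (T : pointedType) (A : set T) (s : T -> T) (f : T -> R[i]) :
  set_bij A A s -> csum A (fun x => f (s x)) = csum A f.
Proof.
move=> sA.
have key (g : T -> \bar R) : (forall x, 0 <= g x)%E ->
    (\esum_(x in A) g (s x) = \esum_(x in A) g x)%E.
  by move=> g0; apply/esym/(reindex_esum A A s).
rewrite /csum; congr ((_ - _) +i* (_ - _)); congr fine.
- by apply: (key (fun x => (Num.max (complex.Re (f x)) 0)%:E)) => x; rewrite lee_fin le_max lexx orbT.
- by apply: (key (fun x => (Num.max (- complex.Re (f x)) 0)%:E)) => x; rewrite lee_fin le_max lexx orbT.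
- by apply: (key (fun x => (Num.max (complex.Im (f x)) 0)%:E)) => x; rewrite lee_fin le_max lexx orbT.
- by apply: (key (fun x => (Num.max (- complex.Im (f x)) 0)%:E)) => x; rewrite lee_fin le_max lexx orbT.
Qed.

Lemma esum_scale_le (T : choiceType) (A : set T) (f : T -> R) (C : R) : 0 <= C ->
  (forall x, 0 <= f x) ->
  (\esum_(x in A) (C * f x)%:E <= C%:E * \esum_(x in A) (f x)%:E)%E.
Proof.
move=> C0 f0; apply: ge_ereal_sup => _ [X [finX XA] <-].
under eq_fsbigr do rewrite EFinM.
rewrite -ge0_mule_fsumr; last by move=> x; rewrite lee_fin.
by apply: lee_wpmul2l; rewrite ?lee_fin//; apply: ereal_sup_ubound; exists X.
Qed.

Lemma esum_scale_lty (T : choiceType) (A : set T) (f : T -> R) (C : R) : 0 <= C ->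
  (forall x, 0 <= f x) -> (\esum_(x in A) (f x)%:E < +oo)%E ->
  (\esum_(x in A) (C * f x)%:E < +oo)%E.
Proof.
move=> C0 f0 fA; apply: le_lt_trans (esum_scale_le A C0 f0) _.
move: fA; rewrite -ge0_fin_numE ?esum_ge0// => [/fineK <-|x _]; last by rewrite lee_fin.
by rewrite -EFinM ltry.
Qed.

End CountingIntegral2.

Section Temper.
Variables (R : realType) (k : nat).
Implicit Types z : R[i].

Lemma temperE z : temper (2 * k) z = ((1 + cabs z ^+ 2) ^+ k)^-1.
Proof.
by rewrite /temper exprM sqr_sqrtr// addr_ge0// sqr_ge0.
Qed.

Lemma sqrt_1cabs_ge1 z : 1 <= Num.sqrt (1 + cabs z ^+ 2).
Proof. by rewrite -[leLHS]sqrtr1 ler_wsqrtr// lerDl sqr_ge0. Qed.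

Lemma temper_ge0 j z : 0 <= temper j z.
Proof. by rewrite /temper invr_ge0 exprn_ge0// sqrtr_ge0. Qed.

Lemma temper_gt0 j z : 0 < temper j z.
Proof. by rewrite /temper invr_gt0 exprn_gt0// (lt_le_trans _ (sqrt_1cabs_ge1 z)). Qed.

Lemma temper_le i j z : (i <= j)%N -> temper j z <= temper i z.
Proof.
move=> ij; rewrite /temper lef_pV2 ?posrE ?exprn_gt0 ?(lt_le_trans _ (sqrt_1cabs_ge1 z))//.
by rewrite ler_weXn2l// sqrt_1cabs_ge1.
Qed.

Lemma measurable_temper j :
  measurable_fun [set: measurableTypeR R] (fun t : measurableTypeR R => temper j t%:C).
Proof.
rewrite (_ : (fun _ => _) = (fun t => (((1 + `|t| ^+ 2) `^ 2^-1) ^+ j) `^ (- 1))); last first.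
  apply/funext => t; rewrite /temper cabs_real powR12_sqrt ?addr_ge0 ?sqr_ge0//.
  by rewrite powR_inv1// exprn_ge0// sqrtr_ge0.
have h : measurable_fun [set: measurableTypeR R] (fun t => 1 + `|t| ^+ 2).
  apply: measurable_funD => //; apply: measurable_funX; exact: normr_measurable.
have h2 := measurable_funX j (measurableT_comp (measurable_powR (2^-1)) h).
exact: (measurableT_comp (measurable_powR (-1)) h2).
Qed.

(** The weights [temper j] decrease in [j], so finiteness at [ord mu] carries over to larger
    exponents; strong temperedness excludes the branch of [ord] with its default value. *)
Lemma tempered_ord (mu : strip_measure R) :
  strongly_tempered mu -> (ord mu <= 2 * k.+1)%N -> tempered_at mu (2 * k.+1).
Proof.
move=> st ok; have tm : tempered_at mu (ord mu).
  rewrite /ord; case: pselect => [ex|]; first by case: ex_minnP => m /asboolP.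
  by move=> []; case: st => j tj; exists j; apply/asboolP.
apply: le_lt_trans tm; apply: leeD.
  apply: ge0_le_integral => //=.
  - by move=> x _; rewrite lee_fin temper_ge0.
  - by apply/measurable_EFinP; exact: measurable_temper.
  - by apply/measurable_EFinP; exact: measurable_temper.
  - by move=> x _; rewrite lee_fin temper_le.
by apply: le_esum => x _; rewrite lee_fin ler_wpM2l ?cabs_ge0// temper_le.
Qed.

End Temper.

Section Functional.
Variables (R : realType) (k : nat) (mu : strip_measure R).
Hypothesis tmu : tempered_at mu (2 * k.+1).
Local Notation BR := (measurableTypeR R).
Local Notation nu := (cvariation (line_part mu)).
Local Notation h := (cphase (line_part mu)).
Local Notation A := (atoms mu).
Local Notation b := (weight mu).
Implicit Types (f : R[i] -> R[i]) (z : R[i]).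

Definition tau z : R := temper (2 * k.+1) z.

Definition in_support z : Prop := complex.Im z = 0 \/ A z.

(* Every function integrated against [mu] below is dominated by a multiple of
   [tau], which is |mu|-integrable. *)
Definition tame f : Prop :=
  cmeasurable_fun [set: BR] (fun t : BR => f t%:C) /\
  exists2 C : R, 0 <= C & forall z, in_support z -> cabs (f z) <= C * tau z.

Definition pairing f : R[i] :=
  cintegral (line_part mu) (fun t => f t%:C) + csum A (fun g => b g * f g).

Lemma tau_line_lt : (\int[nu]_t (tau t%:C)%:E < +oo)%E.
Proof.
apply: le_lt_trans tmu; rewrite leeDl// esum_ge0// => x _.
by rewrite lee_fin mulr_ge0 ?cabs_ge0 ?temper_ge0.
Qed.

Lemma tau_atoms_lt : (\esum_(g in A) (cabs (b g) * tau g)%:E < +oo)%E.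
Proof.
apply: le_lt_trans tmu; rewrite leeDr// integral_ge0// => x _.
by rewrite lee_fin temper_ge0.
Qed.

Lemma tau_line_integrable : nu.-integrable setT (EFin \o (fun t : BR => tau t%:C)).
Proof.
apply/integrableP; split; first by apply/measurable_EFinP; exact: measurable_temper.
rewrite (eq_integral (fun t : BR => (tau t%:C)%:E)); first exact: tau_line_lt.
by move=> x _ /=; rewrite ger0_norm ?temper_ge0.
Qed.

Lemma tau_atoms_integrable :
  (count_measure R R[i]^o).-integrable A (EFin \o (fun g => cabs (b g) * tau g)).
Proof.
apply: integrable_counting; apply: le_lt_trans tau_atoms_lt.
apply: le_esum => x _; rewrite lee_fin ger0_norm// mulr_ge0 ?cabs_ge0 ?temper_ge0//.
Qed.

Lemma measurable_phase : cmeasurable_fun [set: BR] h.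
Proof. by split; [exact: measurable_Re_cphase|exact: measurable_Im_cphase]. Qed.

Lemma tame_line_integrable f : tame f ->
  cintegrableT nu setT (fun t : BR => f t%:C * h t).
Proof.
move=> [mf [C C0 fC]].
apply: (@cintegrable_dom _ _ _ _ _ _ _ (fun t : BR => C * tau t%:C)) => //.
- by apply: cmeasurableM => //; exact: measurable_phase.
- exact: (integrableZl measurableT C tau_line_integrable).
- by move=> t _; rewrite cabsM cabs_cphase mulr1; apply: fC; left.
Qed.

Lemma tame_atoms_summable f : tame f -> csummable A (fun g => b g * f g).
Proof.
move=> [_ [C C0 fC]].
apply: (@csummable_dom _ R[i]^o _ _ (fun g => C * (cabs (b g) * tau g))); last first.
  move=> g Ag; rewrite cabsM mulrCA ler_wpM2l ?cabs_ge0//; apply: fC; by right.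
apply: (@esum_scale_lty _ _ _ (fun g => cabs (b g) * tau g)) => //; last exact: tau_atoms_lt.
by move=> x; rewrite mulr_ge0 ?cabs_ge0 ?temper_ge0.
Qed.

Lemma pairingE f : tame f -> pairing f =
  cintT nu setT (fun t : BR => f t%:C * h t) +
  cintT (count_measure R R[i]^o) A (fun g => b g * f g).
Proof.
move=> tf; rewrite /pairing; congr (_ + _).
exact: (@csum_cint _ R[i]^o _ _ (tame_atoms_summable tf)).
Qed.

Lemma tame_atoms_integrable f : tame f ->
  cintegrableT (count_measure R R[i]^o) A (fun g => b g * f g).
Proof.
by move=> tf; apply: csummable_cintegrable; exact: tame_atoms_summable.
Qed.

Lemma tameD (f g : R[i] -> R[i]) : tame f -> tame g -> tame (fun z => f z + g z).
Proof.
move=> [mf [C C0 fC]] [mg [C' C'0 gC]]; split; first exact: cmeasurableD.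
exists (C + C'); first exact: addr_ge0.
by move=> z sz; rewrite (le_trans (cabsD _ _))// mulrDl lerD ?fC ?gC.
Qed.

Lemma tameZ z f : tame f -> tame (fun w => z * f w).
Proof.
move=> [mf [C C0 fC]]; split.
  by apply: cmeasurableM => //; exact: cmeasurable_cst.
exists (cabs z * C); first by rewrite mulr_ge0 ?cabs_ge0.
by move=> w sw; rewrite cabsM -mulrA ler_wpM2l ?cabs_ge0 ?fC.
Qed.

Lemma tameN f : tame f -> tame (fun w => - f w).
Proof.
by move=> /(tameZ (- 1)); under eq_fun do rewrite mulN1r.
Qed.

Lemma tameB (f g : R[i] -> R[i]) : tame f -> tame g -> tame (fun z => f z - g z).
Proof. by move=> tf tg; apply: tameD => //; exact: tameN. Qed.

Lemma tame0 : tame (fun=> 0).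
Proof.
split; first exact: cmeasurable_cst.
by exists 0 => // z _; rewrite cabs0 mul0r.
Qed.

Lemma tame_sum n (f : 'I_n -> R[i] -> R[i]) : (forall j, tame (f j)) ->
  tame (fun z => \sum_(j < n) f j z).
Proof.
elim: n f => [|n IH] f tf.
  by under eq_fun do rewrite big_ord0; exact: tame0.
by under eq_fun do rewrite big_ord_recl; apply: tameD => //; exact: IH.
Qed.

Lemma pairingD (f g : R[i] -> R[i]) : tame f -> tame g ->
  pairing (fun z => f z + g z) = pairing f + pairing g.
Proof.
move=> tf tg; rewrite !pairingE//; last exact: tameD.
rewrite addrACA; congr (_ + _).
  rewrite -cintD//; last 2 first.
  - exact: tame_line_integrable.
  - exact: tame_line_integrable.
  by apply: eq_cint => t _; rewrite mulrDl.
rewrite -cintD//; last 3 first.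
- exact: measurable_discrete.
- exact: tame_atoms_integrable.
- exact: tame_atoms_integrable.
by apply: eq_cint => t _; rewrite mulrDr.
Qed.

Lemma pairingZ z f : tame f -> pairing (fun w => z * f w) = z * pairing f.
Proof.
move=> tf; rewrite !pairingE//; last exact: tameZ.
rewrite mulrDr; congr (_ + _).
  rewrite -cintZ//; last exact: tame_line_integrable.
  by apply: eq_cint => t _; rewrite mulrA.
rewrite -cintZ//; last 2 first.
- exact: measurable_discrete.
- exact: tame_atoms_integrable.
by apply: eq_cint => t _; rewrite mulrCA.
Qed.

Lemma pairingB (f g : R[i] -> R[i]) : tame f -> tame g ->
  pairing (fun z => f z - g z) = pairing f - pairing g.
Proof.
move=> tf tg; rewrite pairingD//; last exact: tameN.
by rewrite -mulN1r -pairingZ//; congr (_ + pairing _); apply/funext => z; rewrite mulN1r.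
Qed.

Lemma pairing_sum n (c : 'I_n -> R[i]) (f : 'I_n -> R[i] -> R[i]) :
  (forall j, tame (f j)) ->
  pairing (fun z => \sum_(j < n) c j * f j z) = \sum_(j < n) c j * pairing (f j).
Proof.
elim: n c f => [|n IH] c f tf.
  rewrite big_ord0 -[RHS](mul0r (pairing (fun=> 0))) -pairingZ; last exact: tame0.
  by congr pairing; apply/funext => z; rewrite big_ord0 mul0r.
rewrite big_ord_recl -pairingZ// -IH// -pairingD; last 2 first.
- exact: tameZ.
- by apply: tame_sum => j; exact: tameZ.
by congr pairing; apply/funext => z; rewrite big_ord_recl.
Qed.

Lemma eq_pairing (f g : R[i] -> R[i]) : (forall z, in_support z -> f z = g z) -> pairing f = pairing g.
Proof.
move=> fg; rewrite /pairing; congr (_ + _).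
  rewrite /cintegral /cintegral_wrt; congr (_ +i* _);
    by apply: eq_Rintegral => t _; rewrite fg//; left.
rewrite /csum; congr ((fine _ - fine _) +i* (fine _ - fine _));
  by apply: eq_esum => x Ax; rewrite fg//; right.
Qed.

(** Dominated convergence with the majorant [C * tau], once on the line and once against counting
    measure on the atoms, where the weights enter the majorant. *)
Lemma pairing_cvg (f_ : nat -> R[i] -> R[i]) f C : 0 <= C ->
  (forall n, cmeasurable_fun [set: BR] (fun t : BR => f_ n t%:C)) -> tame f ->
  (forall z, in_support z -> ccvg (f_ ^~ z) (f z)) ->
  (forall n z, in_support z -> cabs (f_ n z) <= C * tau z) ->
  ccvg (fun n => pairing (f_ n)) (pairing f).
Proof.
move=> C0 mf_ tf ff fC.
have tf_ n : tame (f_ n) by split => //; exists C => // z; exact: fC.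
under eq_fun do rewrite pairingE//; rewrite pairingE//; apply: ccvgD.
  apply: (@cint_cvg _ _ _ _ _ measurableT _ _ (fun t : BR => C * tau t%:C)).
  - by move=> n; apply: cmeasurableM => //; exact: measurable_phase.
  - by apply: cmeasurableM => //; [case: tf|exact: measurable_phase].
  - by move=> t _; apply: ccvgM; [apply: ff; left|exact: ccvg_cst].
  - exact: (integrableZl measurableT C tau_line_integrable).
  - by move=> n t _; rewrite cabsM cabs_cphase mulr1 fC//; left.
apply: (@cint_cvg _ _ _ _ _ (measurable_discrete _) _ _
  (fun g : R[i]^o => C * (cabs (b g) * tau g))).
- by move=> n; split; exact: measurable_fun_discrete.
- by split; exact: measurable_fun_discrete.
- by move=> g Ag; apply: ccvgMl; apply: ff; right.
- exact: (integrableZl (measurable_discrete _) C tau_atoms_integrable).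
- by move=> n g Ag; rewrite cabsM mulrCA ler_wpM2l ?cabs_ge0 ?fC//; right.
Qed.

End Functional.

Arguments csum : simpl never.
Arguments cintT : simpl never.

(** * Real-valued measures and conjugation *)

Section RealPhase.
Variables (R : realType) (k : nat) (mu : strip_measure R).
Hypothesis tmu : tempered_at mu (2 * k.+1).
Local Notation BR := (measurableTypeR R).
Local Notation nu := (cvariation (line_part mu)).
Local Notation h := (cphase (line_part mu)).
Local Notation A := (atoms mu).
Local Notation b := (weight mu).

(* The phase is bounded by 1 and nu is finite on bounded sets, so that the
   integrals defining nu(B) are genuine. *)
Lemma phase_integrable (n : nat) (B : set BR) : measurable B ->
  B `<=` [set t | `|t| <= n%:R] ->
  nu.-integrable B (EFin \o (fun t => complex.Im (h t))).
Proof.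
move=> mB Bn.
pose c := temper (2 * k.+1) (n%:R%:C : R[i]).
have c0 : 0 < c by exact: temper_gt0.
have ci : `|c^-1| = c^-1 by rewrite ger0_norm// ltW// invr_gt0.
have itau := integrableS measurableT mB (@subsetT _ _) (tau_line_integrable tmu).
apply: (le_integrable mB _ _ (integrableZl mB c^-1 itau)).
  by apply/measurable_EFinP; apply: measurable_funTS; exact: measurable_Im_cphase.
move=> t Bt; rewrite /= lee_fin normrM (ger0_norm (temper_ge0 _ _)) ci.
apply: (le_trans (Im_le_cabs _)); rewrite cabs_cphase mulrC ler_pdivlMr// mul1r.
have p (z : R[i]) : 0 < 1 + cabs z ^+ 2 by rewrite ltr_wpDr// sqr_ge0.
rewrite /c /tau !temperE lef_pV2 ?posrE ?exprn_gt0//.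
rewrite lerXn2r ?nnegrE ?(ltW (p _))// lerD2l !cabs_real.
by rewrite ler_pXn2r ?nnegrE// (ger0_norm (ler0n _ _)); exact: Bn.
Qed.

(** Real-valuedness is known only for integrals of the phase over bounded Borel sets. Over a bounded
    set where [Im h] has a fixed sign, a vanishing integral forces [Im h] to vanish almost
    everywhere. *)
Lemma phase_real : real_valued mu ->
  {ae nu, forall t, complex.Im (h t) = 0}.
Proof.
move=> [hr _].
have mI : measurable_fun [set: BR] (fun t => complex.Im (h t)) by exact: measurable_Im_cphase.
have mball n : measurable ([set t | `|t| <= n%:R] : set BR).
  have := @normr_measurable R setT measurableT _ (@measurable_itv R `]-oo, n%:R]).
  rewrite setTI; congr measurable; apply/seteqP; split => t /=; by rewrite in_itv.
(* Applied with [s] equal to 1 and to -1, so that both signs are treated at once; the balls of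
   radius [n] exhaust the line. *)
have key (s : R) (n : nat) :
    {ae nu, forall t, `|t| <= n%:R /\ 0 <= s * complex.Im (h t) -> s * complex.Im (h t) = 0}.
  pose B : set BR := [set t | `|t| <= n%:R] `&` [set t | 0 <= s * complex.Im (h t)].
  have ms : measurable_fun [set: BR] (fun t => s * complex.Im (h t)).
    by apply: measurable_funM => //; exact: measurable_cst.
  have mB : measurable B.
    apply: measurableI; first exact: mball.
    have := ms measurableT _ (@measurable_itv R `[0, +oo[).
    by rewrite setTI; congr measurable; apply/seteqP; split => t /=; rewrite in_itv/= andbT.
  have BT : B `<=` [set t | `|t| <= n%:R] by move=> t [].
  have iB := phase_integrable mB BT.
  have := hr n%:R B mB BT; rewrite /cmeasure_val/= => B0.
  have : (\int[nu]_(t in B) `|(s * complex.Im (h t))%:E| = 0)%E.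
    rewrite (eq_integral (fun t => (s * complex.Im (h t))%:E)); last first.
      by move=> t; rewrite inE => -[_ /= ?]; rewrite ger0_norm.
    have := RintegralZl s mB iB; rewrite B0 mulr0.
    have is_ := integrableZl mB s iB.
    rewrite /Rintegral => E0; rewrite -[LHS]fineK ?E0//.
    exact: (integrable_fin_num mB is_).
  move/(ae_eq_integral_abs nu mB) => H.
  have : ae_eq nu B (fun t => (s * complex.Im (h t))%:E) (cst 0%E).
    by apply: H; apply/measurable_EFinP; exact: measurable_funTS.
  apply: (@filterS _ _ (ae_filter_ringOfSetsType nu)) => t Ht Bt.
  by have /(_ Bt)[] := Ht.
have : {ae nu, forall t n, (`|t| <= n%:R -> complex.Im (h t) = 0)}.
  apply: ae_foralln => n; have := key 1 n; have := key (-1) n.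
  apply: (@filterS2 _ _ (ae_filter_ringOfSetsType nu)) => t h1 h2 tn; have [p|p] := leP 0 (complex.Im (h t)).
    by rewrite -[LHS]mul1r h2// mul1r.
  by apply: oppr_inj; rewrite oppr0 -mulN1r h1// mulN1r oppr_ge0; split => //; exact: ltW.
apply: (@filterS _ _ (ae_filter_ringOfSetsType nu)) => t /(_ (Num.truncn `|t|).+1); apply.
exact/ltW/truncnS_gt.
Qed.

Lemma cint_phase_Re (f : R -> R[i]) : real_valued mu ->
  cmeasurable_fun [set: BR] (f : BR -> R[i]) ->
  cintT nu setT (fun t : BR => f t * h t) =
  cintT nu setT (fun t : BR => f t * (complex.Re (h t))%:C).
Proof.
move=> /phase_real h0 mf.
have mh := measurable_phase mu.
have mRe : cmeasurable_fun [set: BR] (fun t => (complex.Re (h t))%:C).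
  by split; [exact: measurable_Re_cphase|exact: measurable_cst].
have [a1 a2] := cmeasurableM mf mh.
have [b1 b2] := cmeasurableM mf mRe.
rewrite /cintT; congr (_ +i* _); congr fine; apply: ae_eq_integral => //;
  try (by apply/measurable_EFinP);
  apply: (@filterS _ _ (ae_filter_ringOfSetsType nu) _ _ _ h0) => t ht _;
  have E : h t = (complex.Re (h t))%:C by exact: complex_eqP.
  by rewrite [in LHS]E.
by rewrite [in LHS]E.
Qed.

Lemma cint_phase_conj (f : R -> R[i]) : real_valued mu ->
  cintegrableT nu setT (fun t : BR => f t * h t) ->
  cmeasurable_fun [set: BR] (f : BR -> R[i]) ->
  cintT nu setT (fun t : BR => (f t)^*%C * h t) =
  (cintT nu setT (fun t : BR => f t * h t))^*%C.
Proof.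
move=> hr fi mf; rewrite -cintJ//.
have mfJ : cmeasurable_fun [set: BR] (fun t => (f t)^*%C : R[i]).
  case: mf => m1 m2; split; first by under eq_fun do rewrite cReJ.
  by under eq_fun do rewrite cImJ; exact: measurable_funN.
rewrite cint_phase_Re//.
have mhJ : cmeasurable_fun [set: BR] (fun t => (h t)^*%C : R[i]).
  have [m1 m2] := measurable_phase mu; split; first by under eq_fun do rewrite cReJ.
  by under eq_fun do rewrite cImJ; exact: measurable_funN.
have h0 := phase_real hr.
have mRe : cmeasurable_fun [set: BR] (fun t => (complex.Re (h t))%:C).
  by split; [exact: measurable_Re_cphase|exact: measurable_cst].
have [a1 a2] := cmeasurableM mfJ mhJ.
have [b1 b2] := cmeasurableM mfJ mRe.
transitivity (cintT nu setT (fun t : BR => (f t)^*%C * (h t)^*%C)); last first.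
  by apply: eq_cint => t _; rewrite rmorphM.
rewrite /cintT; congr (_ +i* _); congr fine; apply: ae_eq_integral => //;
  try (by apply/measurable_EFinP);
  apply: (@filterS _ _ (ae_filter_ringOfSetsType nu) _ _ _ h0) => t ht _;
  have E : (h t)^*%C = (complex.Re (h t))%:C
    by apply: complex_eqP; rewrite ?cReJ// cImJ ht oppr0.
  by rewrite E.
by rewrite E.
Qed.

(** On the line the phase is real almost everywhere; on the atoms conjugation is a bijection that
    preserves the weights, which are real. This is the source of the reality of Q. *)
Lemma pairing_conj (f : R[i] -> R[i]) :
  real_valued mu -> R_symmetric mu -> tame k mu f ->
  pairing mu (fun z => (f z^*%C)^*%C) = (pairing mu f)^*%C.
Proof.
move=> hr [sA sb] tf; rewrite /pairing rmorphD/=; congr (_ + _).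
  have tfi := tame_line_integrable tmu tf; case: (tf) => mf _.
  rewrite -[RHS]cint_phase_conj//; apply: eq_cint => t _.
  by congr (conjc (f _) * _); exact: conjc_real.
have bij : set_bij A A (@conjc R).
  split; [by move=> g /sA|by move=> x y _ _ /(can_inj (@conjcK R))|].
  by move=> g /sA Ag; exists g^*%C => //; rewrite conjcK.
have := @csum_reindex R R[i]^o A (@conjc R) (fun g => b g * (f g^*%C)^*%C) bij.
move=> <-.
have E : csum A (fun g => b g * f g) = cintT (count_measure R R[i]^o) A (fun g => b g * f g).
  exact: (@csum_cint _ R[i]^o _ _ (tame_atoms_summable tmu tf)).
apply: (etrans _ (congr1 (@conjc R) (esym E))).
rewrite -cintJ; last 2 first.
- exact: measurable_discrete.
- exact: (tame_atoms_integrable tmu tf).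
have sJ : csummable A (fun g => (b g * f g)^*%C).
  apply: le_lt_trans (tame_atoms_summable tmu tf); apply: le_esum => g _.
  by rewrite lee_fin cabsJ.
have bfJ g : A g -> (b g * f g)^*%C = b g * (f g)^*%C.
  move=> Ag; have bJ : (b g)^*%C = b g.
    by apply: complex_eqP; rewrite ?cReJ// cImJ hr.2// oppr0.
  by rewrite -[in RHS]bJ; exact: rmorphM.
rewrite -(@csum_cint _ R[i]^o _ _ sJ) /csum; congr ((fine _ - fine _) +i* (fine _ - fine _));
  apply: eq_esum => g Ag; rewrite conjcK (sb _ Ag) (bfJ _ Ag) //.
Qed.

End RealPhase.

(** * Analyticity *)

Section ComplexNeighborhoods.
Variable R : realType.
Implicit Types (p z h : R[i]) (P : set R[i]).

Lemma nbhs_cabsP p P : nbhs (p : R[i]^o) P <->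
  exists2 d : R, 0 < d & forall z, cabs (z - p) < d -> P z.
Proof.
split=> [/nbhs_ballP[e /= e0 eP]|[d d0 dP]].
  have /andP[/eqP eI eR] : (0 == complex.Im e) && (0 < complex.Re e).
    by move: e0; rewrite ltcE/= eq_sym.
  exists (complex.Re e) => // z zp; apply: eP; rewrite /ball/= distrC.
  by rewrite -cabsC ltcE/= -eI eqxx.
apply/nbhs_ballP; exists d%:C; first by rewrite /= ltcR.
by move=> z; rewrite /ball/= distrC -cabsC ltcR => /dP.
Qed.

Lemma dnbhs_cabsP p P : nbhs ((p : R[i]^o)^') P <->
  exists2 d : R, 0 < d & forall z, z != p -> cabs (z - p) < d -> P z.
Proof.
rewrite /dnbhs -[nbhs _ P]/(nbhs (p : R[i]^o) [set z | z != p -> P z]).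
split=> [/nbhs_cabsP[d d0 dP]|[d d0 dP]].
  by exists d => // z zp zd; exact: dP.
by apply/nbhs_cabsP; exists d => // z zd zp; exact: dP.
Qed.

End ComplexNeighborhoods.

Section Analytic.
Variable R : realType.
Implicit Types (f g : R[i] -> R[i]) (p z h : R[i]).

Lemma ler_ratioX (a r r' : R) n : 0 <= a -> 0 < r' -> r' <= r ->
  (a / r) ^+ n <= (a / r') ^+ n.
Proof.
move=> a0 r'0 rr'; have r0 := lt_le_trans r'0 rr'.
have q0 : 0 <= a / r by rewrite divr_ge0// ltW.
have q'0 : 0 <= a / r' by rewrite divr_ge0// ltW.
by rewrite lerXn2r// ler_wpM2l// lef_pV2.
Qed.

(* Quantitative Taylor expansion: the power series of [f] at [p] converges
   geometrically on the disc of radius [r]. *)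
Definition canalytic f p : Prop :=
  exists (r C : R) (c : nat -> R[i]), 0 < r /\
    forall N h, cabs h <= r ->
      cabs (f (p + h) - \sum_(n < N) c n * h ^+ n) <= C * (cabs h / r) ^+ N.

Lemma canalytic_near f g p (d : R) : 0 < d ->
  (forall z, cabs (z - p) < d -> f z = g z) -> canalytic f p -> canalytic g p.
Proof.
move=> d0 fg [r [C [c [r0 H]]]].
have C0 : 0 <= C.
  have := H 0%N 0; rewrite cabs0 ltW// expr0 mulr1 => /(_ isT).
  exact: le_trans (cabs_ge0 _).
pose r' := Num.min r (d / 2).
have r'0 : 0 < r' by rewrite lt_min r0 divr_gt0.
exists r', C, c; split => // N h hr; rewrite -fg; last first.
  rewrite addrAC subrr add0r (le_lt_trans hr)// (@le_lt_trans _ _ (d / 2))//.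
    by rewrite ge_min lexx orbT.
  by rewrite ltr_pdivrMr// ltr_pMr// ltr1n.
have hr' : cabs h <= r by rewrite (le_trans hr)// ge_min lexx.
apply: (le_trans (H N h hr')); rewrite ler_wpM2l//.
by rewrite ler_ratioX ?cabs_ge0// ge_min lexx.
Qed.

Lemma canalytic_shrink f p (d : R) : 0 < d -> canalytic f p ->
  exists (r C : R) (c : nat -> R[i]), [/\ 0 < r, r <= d, 0 <= C &
    forall N h, cabs h <= r ->
      cabs (f (p + h) - \sum_(n < N) c n * h ^+ n) <= C * (cabs h / r) ^+ N].
Proof.
move=> d0 [r [C [c [r0 H]]]].
have C0 : 0 <= C.
  have := H 0%N 0; rewrite cabs0 ltW// expr0 mulr1 => /(_ isT).
  exact: le_trans (cabs_ge0 _).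
exists (Num.min r d), C, c; split; rewrite ?lt_min ?r0 ?ge_min ?lexx ?orbT//.
move=> N h hr; have hr' : cabs h <= r by rewrite (le_trans hr)// ge_min lexx.
apply: (le_trans (H N h hr')); rewrite ler_wpM2l//.
by rewrite ler_ratioX ?cabs_ge0 ?lt_min ?r0// ge_min lexx.
Qed.

Lemma canalyticD f g p : canalytic f p -> canalytic g p ->
  canalytic (fun z => f z + g z) p.
Proof.
move=> [r [C [c [r0 H]]]] /(canalytic_shrink r0)[r' [C' [c' [r'0 rr' C'0 H']]]].
have /(canalytic_shrink r'0)[s [B [e [s0 sr B0 G]]]] : canalytic f p by exists r, C, c.
have [C2 H2] : exists C2, forall N h, cabs h <= s ->
    cabs (g (p + h) - \sum_(n < N) c' n * h ^+ n) <= C2 * (cabs h / s) ^+ N.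
  exists C' => N h hs; apply: (le_trans (H' N h (le_trans hs sr))).
  by rewrite ler_wpM2l// ler_ratioX ?cabs_ge0.
exists s, (B + C2), (fun n => e n + c' n); split => // N h hs.
under eq_bigr do rewrite mulrDl.
rewrite big_split/= opprD addrACA (le_trans (cabsD _ _))// mulrDl.
exact: lerD (G N h hs) (H2 N h hs).
Qed.

Lemma canalyticZ z f p : canalytic f p -> canalytic (fun w => z * f w) p.
Proof.
move=> [r [C [c [r0 H]]]].
exists r, (cabs z * C), (fun n => z * c n); split => // N h hr.
under eq_bigr do rewrite -mulrA.
by rewrite -mulr_sumr -mulrBr cabsM -mulrA ler_wpM2l ?cabs_ge0 ?H.
Qed.

Lemma canalytic_cst z p : canalytic (fun=> z) p.
Proof.
exists 1, (cabs z), (fun n => if n == 0%N then z else 0); split => // -[|N] h hr.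
  by rewrite big_ord0 subr0 expr0 mulr1.
rewrite big_ord_recl/= expr0 mulr1 big1 ?addr0 ?subrr ?cabs0; last first.
  by move=> i _; rewrite mul0r.
by rewrite mulr_ge0 ?cabs_ge0// exprn_ge0// divr_ge0 ?cabs_ge0.
Qed.

(** The Taylor coefficients move up by one index, and the extra factor [h] turns the constant [C]
    into [r * C]. *)
Lemma canalytic_mulXsub f p : canalytic f p -> canalytic (fun z => (z - p) * f z) p.
Proof.
move=> [r [C [c [r0 H]]]].
exists r, (r * C), (fun n => if n is m.+1 then c m else 0); split => // -[|N] h hr.
  rewrite big_ord0 subr0 expr0 mulr1 addrAC subrr add0r cabsM.
  apply: ler_pM; rewrite ?cabs_ge0//.
  by have := H 0%N h hr; rewrite big_ord0 subr0 expr0 mulr1.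
rewrite big_ord_recl/= mul0r add0r addrAC subrr add0r.
under eq_bigr do rewrite exprS mulrCA.
rewrite -mulr_sumr -mulrBr cabsM exprS [leRHS](_ : _ = cabs h * (C * (cabs h / r) ^+ N)).
  by rewrite ler_wpM2l ?cabs_ge0 ?H.
by field; rewrite gt_eqF.
Qed.

(** Horner's scheme with [z = (z - p) + p] reduces this to multiplication by scalars and by
    [z - p]. *)
Lemma canalyticM_poly (q : {poly R[i]}) f p :
  canalytic f p -> canalytic (fun z => q.[z] * f z) p.
Proof.
move=> af; elim/poly_ind: q => [|q c IH].
  apply: (canalytic_near ltr01 _ (canalytic_cst 0 p)) => z _.
  by rewrite horner0 mul0r.
have h := canalyticD (canalyticD (canalytic_mulXsub IH) (canalyticZ p IH)) (canalyticZ c af).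
apply: (canalytic_near ltr01 _ h) => z _.
by rewrite hornerD hornerM hornerX hornerC; ring.
Qed.

Lemma canalytic_poly (q : {poly R[i]}) p : canalytic (fun z => q.[z]) p.
Proof.
apply: (canalytic_near ltr01 _ (canalyticM_poly q (canalytic_cst 1 p))) => z _.
by rewrite mulr1.
Qed.

Lemma canalyticB f g p : canalytic f p -> canalytic g p ->
  canalytic (fun z => f z - g z) p.
Proof.
move=> af ag; apply: (canalytic_near ltr01 _ (canalyticD af (canalyticZ (-1) ag))).
by move=> z _; rewrite mulN1r.
Qed.

Lemma canalytic_lipschitz f p : canalytic f p -> exists (r C : R), [/\ 0 < r, 0 <= C &
  forall z, cabs (z - p) <= r -> cabs (f z - f p) <= C * cabs (z - p)].
Proof.
move=> /(canalytic_shrink ltr01)[r [C [c [r0 _ C0 H]]]].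
have c0 : f p = c 0%N.
  have := H 1%N 0; rewrite cabs0 ltW// addr0 big_ord1 expr0 mulr1 mul0r expr1 mulr0.
  by move=> /(_ isT); rewrite le_eqVlt ltNge cabs_ge0 orbF cabs_eq0 subr_eq0 => /eqP.
exists r, (C / r); split => //; first by rewrite divr_ge0// ltW.
move=> z zp; have := H 1%N (z - p) zp.
by rewrite big_ord1 expr0 mulr1 expr1 addrCA subrr addr0 -c0 mulrCA mulrC.
Qed.

Lemma canalytic_cderivable f p : canalytic f p -> cderivable f p.
Proof.
move=> /(canalytic_shrink ltr01)[r [C [c [r0 _ C0 H]]]].
have c0 : f p = c 0%N.
  have := H 1%N 0; rewrite cabs0 ltW// addr0 big_ord1 expr0 mulr1 mul0r expr1 mulr0.
  by move=> /(_ isT); rewrite le_eqVlt ltNge cabs_ge0 orbF cabs_eq0 subr_eq0 => /eqP.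
rewrite /cderivable /derivable; apply/cvg_ex; exists (c 1%N : R[i]^o).
apply/cvgrPdist_le => e e0.
(* A positive element of [R[i]] is a positive real, so the tolerance is its real part. *)
have /andP[/eqP eI eR] : (0 == complex.Im e) && (0 < complex.Re e).
  by move: e0; rewrite ltcE/= eq_sym.
(* The expansion of order 2 leaves the error [C |h| / r^2] in the difference quotient; adding 1 to
   [C] avoids a zero denominator. *)
apply/dnbhs_cabsP; exists (Num.min r (complex.Re e * r ^+ 2 / (C + 1))).
  by rewrite lt_min r0 divr_gt0// ?mulr_gt0 ?exprn_gt0// ltr_wpDl.
move=> h h0; rewrite subr0 lt_min => /andP[hr he].
rewrite -cabsC lecE/= -eI eqxx/= cabs_distC.
have := H 2%N h (ltW hr); rewrite !big_ord_recl big_ord0 addr0 expr0 mulr1 expr1 /= -c0 => H2.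
have -> : h^-1 *: (f (h *: (1 : R[i]^o) + p) - f p : R[i]^o) - c 1%N =
   h^-1 * (f (p + h) - (f p + c 1%N * h)).
  have -> : h *: (1 : R[i]^o) = h by rewrite /GRing.scale/= mulr1.
  by rewrite /GRing.scale/= [h + p]addrC; field.
rewrite cabsM cabsV.
apply: (@le_trans _ _ ((cabs h)^-1 * (C * (cabs h / r) ^+ 2))).
  by rewrite ler_wpM2l ?invr_ge0 ?cabs_ge0.
have hp : 0 < cabs h by rewrite cabs_gt0.
rewrite [leLHS](_ : _ = C * cabs h / r ^+ 2); last by field; rewrite ?gt_eqF.
rewrite ler_pdivrMr ?exprn_gt0//.
move: he; rewrite ltr_pdivlMr; last by rewrite ltr_wpDl.
by move=> he; apply: ltW; apply: le_lt_trans he; nra.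
Qed.

(** Identity theorem along a vertical segment. If the coefficients below [n] vanish, then
    [|c n| s^n <= C (s/r)^(n+1)] for small [s], hence [c n = 0]. Once all coefficients vanish,
    [|f z| <= C q^N] for every [N], with some [q < 1]. *)
Lemma canalytic_eq0 f p (s0 : R) : canalytic f p -> 0 < s0 ->
  (forall s, 0 < s < s0 -> f (p + 'i%C * s%:C) = 0) ->
  exists2 d : R, 0 < d & forall z, cabs (z - p) < d -> f z = 0.
Proof.
move=> /(canalytic_shrink ltr01)[r [C [c [r0 _ C0 H]]]] s00 f0.
have cn n : c n = 0.
  elim/ltn_ind: n => n IH; apply/eqP; rewrite -cabs_eq0 eq_le cabs_ge0 andbT.
  apply/ler_addgt0Pr => e e0; rewrite add0r.
  pose s := Num.min (Num.min (s0 / 2) r) (e * r ^+ n.+1 / (C + 1)).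
  have sp : 0 < s.
    by rewrite !lt_min divr_gt0// r0 divr_gt0 ?mulr_gt0 ?exprn_gt0// ltr_wpDl.
  have ss0 : s < s0.
    rewrite (@le_lt_trans _ _ (s0 / 2))// ?ge_min ?lexx//.
    by rewrite ltr_pdivrMr// ltr_pMr// ltr1n.
  have sr : s <= r by rewrite !ge_min lexx orbT.
  have ha : cabs ('i%C * s%:C) = s by rewrite cabsM cabs_i mul1r cabs_pos// ltW.
  have := H n.+1 ('i%C * s%:C); rewrite ha => /(_ sr).
  rewrite f0; last by rewrite sp ss0.
  rewrite big_ord_recr/= big1 ?add0r; last by move=> i _; rewrite IH ?mul0r.
  rewrite cabsN cabsM cabsX ha expr_div_n exprS.
  have -> : C * (s * s ^+ n / r ^+ n.+1) = (C * s / r ^+ n.+1) * s ^+ n by ring.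
  rewrite ler_pM2r ?exprn_gt0// => h; apply: (le_trans h).
  rewrite ler_pdivrMr ?exprn_gt0//.
  have : s <= e * r ^+ n.+1 / (C + 1) by rewrite ge_min lexx orbT.
  rewrite ler_pdivlMr; last by rewrite ltr_wpDl.
  by apply: le_trans; rewrite mulrDr mulr1 mulrC lerDl ltW.
exists r => // z zr; apply/eqP; rewrite -cabs_eq0 eq_le cabs_ge0 andbT.
have x1 : 0 <= cabs (z - p) / r < 1.
  by rewrite divr_ge0 ?cabs_ge0 ?(ltW r0)//= ltr_pdivrMr ?mul1r.
have key N : cabs (f z) <= C * (cabs (z - p) / r) ^+ N.
  have := H N (z - p) (ltW zr); rewrite big1; last by move=> i _; rewrite cn mul0r.
  by rewrite subr0 addrCA subrr addr0.
have lim : (fun N => C * (cabs (z - p) / r) ^+ N) @ \oo --> C * 0.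
  apply: cvgMr; apply: cvg_expr; case/andP: x1 => x0 x1; rewrite ger0_norm//.
rewrite -(mulr0 C); apply: (ler_cvg_to (@cvg_cst _ _ _ _ _) lim).
by apply: nearW => N; exact: key.
Qed.

End Analytic.

(** * Cauchy integrals and the regularized Cauchy kernel *)

Section CauchyIntegral.
Variables (R : realType) (d : measure_display) (T : measurableType d).
Variables (m : {measure set T -> \bar R}) (D : set T).
Hypothesis mD : measurable D.
Variables (ga V : T -> R[i]) (b : T -> R) (p : R[i]) (e : R).
Hypothesis e0 : 0 < e.
Hypothesis ge : forall t, D t -> e <= cabs (ga t - p).
Hypotheses (mga : cmeasurable_fun D ga) (mV : cmeasurable_fun D V).
Hypothesis ib : m.-integrable D (EFin \o b).
Hypothesis Vb : forall t, D t -> cabs (V t) <= b t * cabs (ga t - p).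

(** The remainder after [n] terms of the geometric series of [V / (ga - p - h)] in powers of [h],
    divided by [h^n]; at [h = 0] it is the coefficient of [h^n]. *)
Let U (h : R[i]) (n : nat) (t : T) := V t / ((ga t - p) ^+ n * (ga t - p - h)).

Let U_le h n t : cabs h <= e / 2 -> D t -> cabs (U h n t) <= 2 * e ^- n * b t.
Proof.
move=> he Dt; rewrite /U cabs_div cabsM cabsX.
have gp : 0 < cabs (ga t - p) by exact: lt_le_trans e0 (ge Dt).
have b0 : 0 <= b t.
  by rewrite -(pmulr_lge0 _ gp) (le_trans (cabs_ge0 _) (Vb Dt)).
have gh : cabs (ga t - p) / 2 <= cabs (ga t - p - h).
  apply: le_trans (cabs_distl _ _); have := ge Dt; lra.
have gh0 : 0 < cabs (ga t - p - h) by apply: lt_le_trans gh; rewrite divr_gt0.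
rewrite ler_pdivrMr ?mulr_gt0 ?exprn_gt0//.
apply: (le_trans (Vb Dt)).
have en : e ^+ n <= cabs (ga t - p) ^+ n by rewrite lerXn2r ?nnegrE ?ge ?cabs_ge0 ?ltW.
rewrite [leRHS](_ : _ = b t * (2 * cabs (ga t - p - h) * (e ^- n * cabs (ga t - p) ^+ n))); last by ring.
rewrite ler_wpM2l//.
have : 1 <= e ^- n * cabs (ga t - p) ^+ n.
  by rewrite mulrC ler_pdivlMr ?exprn_gt0// mul1r.
by move: (e ^- n * _) => q q1; nra.
Qed.

Let U_int h n : cabs h <= e / 2 -> cintegrableT m D (U h n).
Proof.
move=> he; apply: (@cintegrable_dom _ _ _ _ _ mD _ (fun t => 2 * e ^- n * b t)).
- apply: cmeasurableM => //; apply: cmeasurableV; apply: cmeasurableM.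
    by apply: cmeasurableX; apply: cmeasurableB => //; exact: cmeasurable_cst.
  by apply: cmeasurableB; [apply: cmeasurableB => //|]; exact: cmeasurable_cst.
- exact: (integrableZl mD _ ib).
- by move=> t Dt; exact: U_le.
Qed.

(** For [|h| <= e/2] the distance to [p + h] is at least half the distance to [p], so the bound on
    [V] makes [2 b / e^n] an integrable majorant of the remainder of order [n]. The constant 4 is
    this 2 times that of [cabs_cint_le]. *)
Lemma cauchy_canalytic : canalytic (fun z => cintT m D (fun t => V t / (ga t - z))) p.
Proof.
exists (e / 2), (4 * \int[m]_(t in D) b t), (fun n => cintT m D (U 0 n)).
split; first by rewrite divr_gt0.
move=> N h he.
have h0 : cabs (0 : R[i]) <= e / 2 by rewrite cabs0 ltW// divr_gt0.
have -> : cintT m D (fun t => V t / (ga t - (p + h))) -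
    \sum_(n < N) cintT m D (U 0 n) * h ^+ n = h ^+ N * cintT m D (U h N).
  elim: N => [|N IH].
    rewrite big_ord0 subr0 expr0 mul1r; apply: eq_cint => t Dt.
    by rewrite /U; congr (_ / _); ring.
  rewrite big_ord_recr/= (opprD (\sum_(i < N) _)) (addrA _ (- \sum_(i < N) _)) IH [_ * h ^+ N]mulrC -mulrBr exprSr -mulrA.
  congr (_ * _); rewrite -cintZ//; last exact: U_int.
  rewrite -[X in _ - X]mul1r -[- _]mulN1r mulrA mulr1 -cintZ//; last exact: U_int.
  rewrite -cintD//; [|exact: U_int|by apply: cintegrableT_Z => //; exact: U_int].
  apply: eq_cint => t Dt; rewrite /U subr0 exprS.
  have gp : ga t - p != 0 by rewrite -cabs_gt0 (lt_le_trans e0 (ge Dt)).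
  have gh : ga t - p - h != 0.
    rewrite -cabs_gt0; apply: lt_le_trans (cabs_distl _ _); have := ge Dt.
    by have := he; have := e0; lra.
  by field; rewrite expf_neq0 ?gp ?gh.
rewrite cabsM cabsX.
apply: (@le_trans _ _ (cabs h ^+ N * (2 * \int[m]_(t in D) (2 * e ^- N * b t)))).
  rewrite ler_wpM2l ?exprn_ge0 ?cabs_ge0//; apply: (cabs_cint_le mD).
  - exact: U_int.
  - exact: (integrableZl mD _ ib).
  - by move=> t Dt; exact: U_le.
rewrite RintegralZl//.
have I0 : 0 <= \int[m]_(t in D) b t.
  apply: Rintegral_ge0 => t Dt; have gp : 0 < cabs (ga t - p) by exact: lt_le_trans e0 (ge Dt).
  by rewrite -(pmulr_lge0 _ gp) (le_trans (cabs_ge0 _) (Vb Dt)).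
rewrite [leLHS](_ : _ = 4 * \int[m]_(t in D) b t * (cabs h / e) ^+ N); last first.
  by rewrite expr_div_n; ring.
rewrite ler_wpM2l ?mulr_ge0// ler_ratioX ?cabs_ge0 ?divr_gt0//.
by rewrite ler_pdivrMr// ler_peMr ?ltW// ltr1n.
Qed.

End CauchyIntegral.

Section Kernel.
Variables (R : realType) (k : nat).
Implicit Types (g z p : R[i]) (r s : R).

Definition strip_kernel r g z : R[i] :=
  ((r ^+ 2)%:C + g * z) / (g - z) / ((r ^+ 2)%:C + g ^+ 2) ^+ k.+1.

(** [r^2 + g^2] factors as [(g + ir)(g - ir)], and each factor dominates [1 + |g|] because [g] stays
    at distance at least [r - s] from [ir] and [-ir]. *)
Lemma strip_denominator s r : s < r -> 0 < r ->
  exists2 c : R, 0 < c & forall g, `|complex.Im g| <= s ->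
    1 + cabs g ^+ 2 <= c * cabs ((r ^+ 2)%:C + g ^+ 2).
Proof.
move=> sr r0; have e0 : 0 < r - s by rewrite subr_gt0.
(* For [w = g + iq] with [|q| = r], one has [|w| >= r - s] and [|g| <= |w| + r], so
   [1 + |g| <= |w| + (1 + r) <= c |w|]. *)
pose c := 1 + (1 + r) / (r - s).
have c0 : 0 < c by rewrite addr_gt0// divr_gt0// addr_gt0.
exists (c ^+ 2); first exact: exprn_gt0.
move=> g gs.
have key (q : R) : `|q| = r -> 1 + cabs g <= c * cabs (g + 'i%C * q%:C).
  move=> qr; set w := g + _.
  have wI : r - s <= cabs w.
    apply: le_trans (Im_le_cabs _); rewrite cImD cImM/= mul0r mul1r add0r.
    have := ler_normB (complex.Im g + q) (complex.Im g).
    rewrite (_ : complex.Im g + q - complex.Im g = q); last by ring.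
    by rewrite qr; lra.
  have gw : cabs g <= cabs w + r.
    have -> : g = w - 'i%C * q%:C by rewrite /w addrK.
    by rewrite (le_trans (cabsB _ _))// cabsM cabs_i mul1r cabs_real qr.
  rewrite /c mulrDl mul1r -mulrA.
  have : 1 <= (r - s)^-1 * cabs w by rewrite mulrC ler_pdivlMr// mul1r.
  by move: (_ * cabs w) => x x1; nra.
have -> : (r ^+ 2)%:C + g ^+ 2 = (g + 'i%C * r%:C) * (g + 'i%C * (- r)%:C).
  rewrite rmorphXn rmorphN/=.
  rewrite [RHS](_ : _ = g ^+ 2 - 'i%C ^+ 2 * r%:C ^+ 2); last by ring.
  by rewrite sqr_i; ring.
rewrite cabsM; have k1 := key r (gtr0_norm r0).
have k2 : 1 + cabs g <= c * cabs (g + 'i%C * (- r)%:C) by apply: key; rewrite normrN gtr0_norm.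
have g0 := cabs_ge0 g.
apply: (@le_trans _ _ ((1 + cabs g) * (1 + cabs g))); first by nra.
rewrite (_ : c ^+ 2 * _ = c * cabs (g + 'i%C * r%:C) * (c * cabs (g + 'i%C * (- r)%:C))); last by ring.
by apply: ler_pM => //; rewrite addr_ge0.
Qed.

Lemma denominator_neq0 s r g : s < r -> 0 < r -> `|complex.Im g| <= s ->
  (r ^+ 2)%:C + g ^+ 2 != 0.
Proof.
move=> sr r0 gs; have [c c0 /(_ g gs)] := strip_denominator sr r0.
rewrite -cabs_gt0 => h; rewrite -(pmulr_rgt0 _ c0); apply: lt_le_trans h.
by rewrite ltr_wpDr// sqr_ge0.
Qed.

Lemma denominator_temper s r : s < r -> 0 < r ->
  exists2 B : R, 0 < B & forall g, `|complex.Im g| <= s ->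
    (cabs ((r ^+ 2)%:C + g ^+ 2) ^+ k.+1)^-1 <= B * temper (2 * k.+1) g.
Proof.
move=> sr r0; have [c c0 H] := strip_denominator sr r0.
exists (c ^+ k.+1); first exact: exprn_gt0.
move=> g gs; rewrite temperE.
have p1 : 0 < 1 + cabs g ^+ 2 by rewrite ltr_wpDr// sqr_ge0.
have q0 : 0 < cabs ((r ^+ 2)%:C + g ^+ 2) by rewrite cabs_gt0 (denominator_neq0 sr).
rewrite ler_pdivlMr ?exprn_gt0// mulrC ler_pdivrMr ?exprn_gt0// -exprMn.
by rewrite lerXn2r ?nnegrE ?(ltW p1) ?mulr_ge0 ?(ltW c0) ?cabs_ge0 ?H.
Qed.

(* The second bound serves the expansion around [z]: the kernels at [z'] and [z]
   differ by [z' - z] times this factor divided by [(g - z') (g - z)]. *)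
Lemma kernel_bounds s r z (e : R) : s < r -> 0 < r -> 0 < e ->
  exists2 B : R, 0 <= B & forall g, `|complex.Im g| <= s -> e <= cabs (g - z) ->
    cabs (strip_kernel r g z) <= B * temper (2 * k.+1) g /\
    cabs (((r ^+ 2)%:C + g ^+ 2) / ((r ^+ 2)%:C + g ^+ 2) ^+ k.+1) <=
      B * temper (2 * k.+1) g * cabs (g - z) ^+ 2.
Proof.
move=> sr r0 e0; have [B B0 HB] := denominator_temper sr r0.
pose x := cabs z.
have x0 : 0 <= x by exact: cabs_ge0.
(* With [y = |g - z| >= e] and [|g| <= x + y], the numerators satisfy
   [r^2 + |g| x <= (r^2 + x^2) + x y <= B1 y] and [r^2 + |g|^2 <= B2 y^2]. *)
pose B1 := (r ^+ 2 + x ^+ 2) / e + x.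
pose B2 := r ^+ 2 / e ^+ 2 + (1 + x / e) ^+ 2.
have B10 : 0 <= B1 by rewrite addr_ge0// divr_ge0 ?addr_ge0 ?sqr_ge0// ltW.
have B20 : 0 <= B2 by rewrite addr_ge0 ?divr_ge0 ?sqr_ge0.
exists ((B1 + B2) * B); first exact: mulr_ge0 (addr_ge0 B10 B20) (ltW B0).
move=> g gs ge; pose y := cabs (g - z).
have y0 : 0 < y by exact: lt_le_trans e0 ge.
have gxy : cabs g <= y + x by rewrite -{1}(subrK z g) cabsD.
have g0 := cabs_ge0 g.
have r2 : cabs (r ^+ 2)%:C = r ^+ 2 by rewrite cabs_pos// sqr_ge0.
have t0 := temper_ge0 (2 * k.+1) g.
have ey : 1 <= y / e by rewrite ler_pdivlMr// mul1r.
split.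
  rewrite /strip_kernel cabs_div cabsX -mulrA; apply: ler_pM; rewrite ?cabs_ge0 ?invr_ge0 ?exprn_ge0 ?cabs_ge0//.
    rewrite cabs_div ler_pdivrMr// (@le_trans _ _ (B1 * y))//; last first.
      by rewrite ler_wpM2r ?cabs_ge0// lerDl.
    apply: (le_trans (cabsD _ _)); rewrite cabsM r2 -/x.
    rewrite /B1 mulrDl -mulrA [e^-1 * y]mulrC.
    have : (r ^+ 2 + x ^+ 2) * 1 <= (r ^+ 2 + x ^+ 2) * (y / e).
      by rewrite ler_wpM2l// addr_ge0 ?sqr_ge0.
    nra.
  exact: HB.
rewrite cabs_div cabsX -!mulrA [temper _ _ * _]mulrC (mulrA B) mulrCA mulrA.
rewrite [B * _ ^+ 2 * _]mulrAC mulrA [X in _ <= X](_ : _ = (B1 + B2) * y ^+ 2 * (B * temper (2 * k.+1) g)); last first.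
  by rewrite /y; ring.
apply: ler_pM; rewrite ?cabs_ge0 ?invr_ge0 ?exprn_ge0 ?cabs_ge0 ?HB//.
apply: (@le_trans _ _ (B2 * y ^+ 2)); last by rewrite ler_wpM2r ?sqr_ge0// lerDr.
apply: (le_trans (cabsD _ _)); rewrite cabsX r2.
rewrite /B2 mulrDl [r ^+ 2 / _ * _](_ : _ = r ^+ 2 * (y / e) ^+ 2); last by rewrite expr_div_n; ring.
apply: lerD; first by rewrite ler_peMr ?sqr_ge0// exprn_ege1.
rewrite -exprMn lerXn2r ?nnegrE//.
  by rewrite mulr_ge0 ?(ltW y0)// addr_ge0// divr_ge0// ltW.
rewrite mulrDl mul1r (le_trans gxy)// lerD2l -mulrA [e^-1 * y]mulrC.
by rewrite ler_peMr.
Qed.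

(** At [z = g] the numerator [(z^2 + r^2)^k (r^2 + g z)], of degree at most [2k + 1] in [z], takes
    the value [(r^2 + g^2)^(k+1)] of the denominator; their difference is divisible by [z - g], with
    a quotient of degree at most [2k]. *)
Lemma kernel_difference r g : (r ^+ 2)%:C + g ^+ 2 != 0 ->
  exists2 q : {poly R[i]}, (size q <= (2 * k).+1)%N & forall z, g != z ->
    (z ^+ 2 + (r ^+ 2)%:C) ^+ k * strip_kernel r g z = (g - z)^-1 + q.[z].
Proof.
move=> d0; pose P : {poly R[i]} := ('X ^+ 2 + ((r ^+ 2)%:C)%:P) ^+ k *
   (((r ^+ 2)%:C)%:P + g *: 'X).
pose dd := ((r ^+ 2)%:C + g ^+ 2) ^+ k.+1.
have Pg : P.[g] = dd.
  rewrite /P /dd hornerM horner_exp !hornerD hornerZ horner_exp hornerX !hornerC.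
  by rewrite [g ^+ 2 + _]addrC -expr2 -exprSr.
have dd0 : dd != 0 by rewrite expf_neq0.
have sP : (size P <= (2 * k).+2)%N.
  apply: (leq_trans (size_polyMleq _ _)).
  have s1 : (size (('X ^+ 2 + ((r ^+ 2)%:C)%:P : {poly R[i]}) ^+ k) <= (2 * k).+1)%N.
    apply: (leq_trans (size_poly_exp_leq _ _)); rewrite ltnS leq_mul2r; apply/orP; right.
    rewrite -ltnS prednK; last by rewrite size_polyDl size_polyXn// size_polyC; case: (_ == 0).
    by rewrite size_polyDl size_polyXn// size_polyC; case: (_ == 0).
  have s2 : (size (((r ^+ 2)%:C)%:P + g *: 'X : {poly R[i]})%R <= 2)%N.
    rewrite (leq_trans (size_polyD _ _))// geq_max size_polyC (leq_trans (size_scale_leq _ _)) ?size_polyX// andbT.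
    by case: (_ == 0).
  by rewrite -subn1 leq_subLR add1n (leq_trans (leq_add s1 s2))// addn2 leqnn.
have /factor_theorem [Q PQ] : root (P - dd%:P) g.
  by rewrite /root hornerD hornerN hornerC Pg subrr.
exists (- dd^-1 *: Q).
  rewrite (leq_trans (size_scale_leq _ _))//.
  have [->|Q0] := eqVneq Q 0; first by rewrite size_poly0.
  have : (size (P - dd%:P)%R <= (2 * k).+2)%N.
    rewrite (leq_trans (size_polyD _ _))// geq_max sP size_polyN size_polyC.
    by case: (_ == 0).
  by rewrite PQ size_Mmonic ?monicXsubC// size_XsubC addn2.
move=> z gz; have zg : g - z != 0 by rewrite subr_eq0.
have : (P - dd%:P).[z] = Q.[z] * (z - g) by rewrite PQ hornerM hornerXsubC.
rewrite hornerD hornerN hornerC => Pz.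
have Pz2 : P.[z] = dd + Q.[z] * (z - g) by rewrite -Pz addrCA subrr addr0.
have -> : (z ^+ 2 + (r ^+ 2)%:C) ^+ k * strip_kernel r g z = P.[z] / (g - z) / dd.
  rewrite /strip_kernel /P hornerM horner_exp !hornerD hornerZ horner_exp hornerX !hornerC.
  by rewrite !mulrA.
by rewrite Pz2 hornerZ; move: dd0; generalize dd => D0 D00; field; rewrite D00 zg.
Qed.

End Kernel.

(** * Dirichlet series *)

Section CharacterTaylor.
Variable R : realType.
Implicit Types (h z : R[i]) (l r s : R).

Lemma is_cderive_real (x : R) : is_cderive (fun s : R => s%:C : R[i]) x 1.
Proof. by split => /=; [exact: is_derive_id|exact: is_derive_cst]. Qed.

Lemma is_cderive_realX n (x : R) :
  is_cderive (fun s : R => s%:C ^+ n.+1 : R[i]) x (n.+1%:R * x%:C ^+ n).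
Proof.
elim: n => [|n IH].
  under eq_fun do rewrite expr1.
  by apply: is_cderive_eq (is_cderive_real x) _; rewrite expr0 mulr1.
under eq_fun do rewrite exprS.
apply: is_cderive_eq (is_cderiveM (is_cderive_real x) IH) _.
by rewrite [in RHS]mulrSr !exprS; ring.
Qed.

Lemma is_cderive_sum n (f : 'I_n -> R -> R[i]) (e : 'I_n -> R[i]) (x : R) :
  (forall j, is_cderive (f j) x (e j)) ->
  is_cderive (fun s => \sum_(j < n) f j s) x (\sum_(j < n) e j).
Proof.
elim: n f e => [|n IH] f e H.
  under eq_fun do rewrite big_ord0; rewrite big_ord0; exact: is_cderive_cst.
under eq_fun do rewrite big_ord_recl; rewrite big_ord_recl.
by apply: is_cderiveD => //; exact: IH.
Qed.

Definition echar_coef l n : R[i] := ((2 * pi)%:C * 'i%C * l%:C) ^+ n / (n`!)%:R.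

(* The remainder of order n+1 is the primitive of that of order n, and so is the
   bound [(|h|/r)^n exp(2 pi r s)] up to the factor [2 pi |h|]. *)
Lemma echar_taylor N h l r : 0 <= l -> 0 < r -> cabs h <= r ->
  cabs (echar l h - \sum_(n < N) echar_coef l n * h ^+ n) <=
    (cabs h / r) ^+ N * expR (2 * pi * r * l).
Proof.
move=> l0 r0 hr; elim: N l l0 => [|N IH] l l0.
  rewrite big_ord0 subr0 expr0 mul1r cabs_echar ler_expR.
  have := Im_le_cabs h; rewrite ler_norml => /andP[hI _].
  have p0 : 0 <= 2 * pi * l :> R by rewrite !mulr_ge0// pi_ge0.
  rewrite -mulrN [leRHS]mulrAC ler_wpM2l//.
  by rewrite (le_trans _ hr)// lerNl.
pose E (M : nat) (s : R) := echar s h - \sum_(n < M) echar_coef s n * h ^+ n.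
have dE s : is_cderive (E N.+1) s ((2 * pi)%:C * 'i%C * h * E N s).
  have := is_cderiveB (is_cderive_echar h s)
    (@is_cderive_sum N (fun n s => echar_coef s n.+1 * h ^+ n.+1)
       (fun n => (2 * pi)%:C * 'i%C * h * (echar_coef s n * h ^+ n)) s _).
  have H : forall j : 'I_N, is_cderive (fun s => echar_coef s j.+1 * h ^+ j.+1) s
     ((2 * pi)%:C * 'i%C * h * (echar_coef s j * h ^+ j)).
    move=> j.
    have /(is_cderiveM (is_cderive_cst (((2 * pi)%:C * 'i%C) ^+ j.+1 / (j.+1`!)%:R * h ^+ j.+1) s)) :=
      is_cderive_realX j s.
    rewrite mul0r add0r => hh.
    rewrite (_ : (fun s => _) = (fun t : R => ((2 * pi)%:C * 'i%C) ^+ j.+1 / (j.+1`!)%:R * h ^+ j.+1 * t%:C ^+ j.+1)); last first.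
      by apply/funext => t; rewrite /echar_coef exprMn; ring.
    apply: is_cderive_eq hh _; rewrite /echar_coef !exprMn factS natrM !exprS.
    by field; rewrite pnatr_eq0 -lt0n fact_gt0 /= addrC natr1 pnatr_eq0.
  move=> /(_ H) {H} K.
  have K2 := is_cderiveB K (is_cderive_cst 1 s).
  rewrite (_ : E N.+1 = fun t => echar t h - \sum_(n < N) echar_coef t n.+1 * h ^+ n.+1 - 1); last first.
    apply/funext => t; rewrite /E big_ord_recl /= /echar_coef !expr0 fact0 invr1 !mulr1.
    by rewrite opprD addrAC addrA.
  by apply: is_cderive_eq K2 _; rewrite subr0 /E mulrBr mulr_sumr.
have E0 : E N.+1 0 = 0.
  rewrite /E echar0l big_ord_recl /= /echar_coef !expr0 fact0 invr1 !mulr1 big1 ?addr0 ?subrr//.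
  by move=> i _; rewrite rmorph0 mulr0 exprS !mul0r.
have [El0|El0] := eqVneq (E N.+1 l) 0.
  rewrite -/(E N.+1 l) El0 cabs0 mulr_ge0 ?expR_ge0// exprn_ge0// divr_ge0 ?cabs_ge0//.
  exact: ltW.
(* A unimodular factor turning the remainder at [l] into its modulus, so that the real mean value
   theorem applies to [B - Re (u E)]. *)
pose u : R[i] := (E N.+1 l)^*%C / (cabs (E N.+1 l))%:C.
have cE0 : cabs (E N.+1 l) != 0 by rewrite cabs_eq0.
have u1 : cabs u = 1 by rewrite /u cabs_div cabsJ cabs_real ger0_norm ?cabs_ge0// divff.
have uE : complex.Re (u * E N.+1 l) = cabs (E N.+1 l).
  have -> : u * E N.+1 l = (cabs (E N.+1 l))%:C.
    rewrite /u mulrAC [_^*%C * _]mulrC -sqr_normc -cabsC expr2 mulfK//.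
    by rewrite -(rmorph0 (real_complex R)) (inj_eq (@complexI _)).
  by [].
pose B (s : R) := (cabs h / r) ^+ N.+1 * expR (2 * pi * r * s).
have dB s : is_derive s 1 B (2 * pi * cabs h * ((cabs h / r) ^+ N * expR (2 * pi * r * s))).
  have h1 : is_derive s 1 (fun t : R => 2 * pi * r * t) (2 * pi * r).
    rewrite (_ : (fun _ => _) = (2 * pi * r) \*: (@id R)).
      by apply: is_derive_eq; rewrite /GRing.scale/= mulr1.
    by apply/funext => t /=.
  have h2 := @is_derive1_comp R expR _ s _ _ (is_derive_expR _) h1.
  rewrite (_ : B = ((cabs h / r) ^+ N.+1) \*: (expR \o (fun t => 2 * pi * r * t))).
    apply: is_derive_eq; rewrite /GRing.scale/= exprS.
    by field; rewrite gt_eqF.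
  by apply/funext => t.
have dg (s : R) : is_derive s 1 (fun t => B t - complex.Re (u * E N.+1 t))
  (2 * pi * cabs h * ((cabs h / r) ^+ N * expR (2 * pi * r * s)) -
   complex.Re (u * ((2 * pi)%:C * 'i%C * h * E N s))).
  have [hd _] := is_cderiveM (is_cderive_cst u s) (dE s).
  move: hd; rewrite mul0r add0r => hd.
  exact: (is_deriveB (dB s) hd).
have [|c cl] := @MVT_segment R _ _ 0 l l0 (fun x _ => dg x).
  by apply: derivable_within_continuous => x _; apply: ex_derive.
rewrite E0 mulr0 /= subr0 uE => Ec.
have B0 : 0 <= B 0 by rewrite mulr_ge0 ?expR_ge0// exprn_ge0// divr_ge0 ?cabs_ge0// ltW.
have c0 : 0 <= c by move: cl; rewrite in_itv/= => /andP[].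
suff : 0 <= B l - cabs (E N.+1 l) - B 0.
  by rewrite subr_ge0 => /(le_trans B0); rewrite subr_ge0.
rewrite Ec mulr_ge0 ?subr_ge0//.
apply: (le_trans (ler_norm _)); apply: (le_trans (Re_le_cabs _)).
rewrite cabsM u1 mul1r !cabsM cabs_i mulr1 cabs_pos; last by rewrite mulr_ge0 ?pi_ge0.
by rewrite ler_wpM2l ?mulr_ge0 ?pi_ge0 ?cabs_ge0// IH.
Qed.

Lemma echar1_int (m : int) : echar 1 (m%:~R : R)%:C = 1 :> R[i].
Proof.
have h1 : echar 1 (1 : R)%:C = 1 :> R[i].
  apply: complex_eqP; rewrite ?(Re_echar, Im_echar)/= !mulr0 oppr0 expR0 !mulr1 mul1r.
    by rewrite mulr_natl cos2pi.
  by rewrite mulr_natl sin2pi.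
have hn (n : nat) : echar 1 (n%:R : R)%:C = 1 :> R[i].
  elim: n => [|n IH]; first by rewrite echar0r.
  by rewrite -addn1 natrD rmorphD echarDr IH h1 mulr1.
case: m => n; first exact: hn.
rewrite NegzE mulrNz rmorphN/= -echarN.
by have := echarK 1 ((n.+1%:R : R)%:C); rewrite hn mul1r.
Qed.

End CharacterTaylor.

Section IntegralOfAnalytic.
Variables (R : realType) (d : measure_display) (T : measurableType d).
Variables (m : {measure set T -> \bar R}) (D : set T).
Hypothesis mD : measurable D.
Variables (f : T -> R[i] -> R[i]) (c : nat -> T -> R[i]) (G : T -> R) (p : R[i]) (r : R).
Hypothesis r0 : 0 < r.
Hypothesis mf : forall z, cmeasurable_fun D (f ^~ z).
Hypothesis mc : forall n, cmeasurable_fun D (c n).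
Hypothesis iG : m.-integrable D (EFin \o G).
Hypothesis fG : forall t N h, D t -> cabs h <= r ->
  cabs (f t (p + h) - \sum_(n < N) c n t * h ^+ n) <= G t * (cabs h / r) ^+ N.

(** Subtracting the estimates of orders [n] and [n.+1] at [h = r] gives [|c n| r^n <= 2 G]. *)
Let c_int n : cintegrableT m D (c n).
Proof.
apply: (@cintegrable_dom _ _ _ _ _ mD _ (fun t => 2 * r ^- n * G t)) => //.
  exact: (integrableZl mD _ iG).
move=> t Dt; have rr : cabs r%:C = r by rewrite cabs_pos// ltW.
have rl : cabs r%:C <= r by rewrite rr.
have h1 := fG n Dt rl; have h2 := fG n.+1 Dt rl.
rewrite !rr divff ?gt_eqF// !expr1n !mulr1 in h1 h2.
have rn : 0 < r ^+ n by rewrite exprn_gt0.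
rewrite mulrAC ler_pdivlMr// -[X in _ * X](cabs_pos (ltW rn)) -cabsM rmorphXn/=.
rewrite [X in cabs X](_ : _ = (f t (p + r%:C) - \sum_(j < n) c j t * r%:C ^+ j) -
   (f t (p + r%:C) - \sum_(j < n.+1) c j t * r%:C ^+ j)); last first.
  by rewrite big_ord_recr/=; ring.
by apply: (le_trans (cabsB _ _)); rewrite mulr2n mulrDl mul1r lerD.
Qed.

Let f_int z : cabs (z - p) <= r -> cintegrableT m D (f ^~ z).
Proof.
move=> zp; apply: (@cintegrable_dom _ _ _ _ _ mD _ G) => // t Dt.
by have := fG 0 Dt zp; rewrite big_ord0 subr0 expr0 mulr1 addrCA subrr addr0.
Qed.

(** The expansion is integrated with its finitely many terms and a dominated remainder; no
    interchange with an infinite series occurs. *)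
Lemma cint_canalytic : canalytic (fun z => cintT m D (f ^~ z)) p.
Proof.
exists r, (2 * \int[m]_(t in D) G t), (fun n => cintT m D (c n)); split => // N h hr.
have fi : cintegrableT m D (f ^~ (p + h)) by apply: f_int; rewrite addrAC subrr add0r.
have [E I] : cintT m D (f ^~ (p + h)) - \sum_(n < N) cintT m D (c n) * h ^+ n =
   cintT m D (fun t => f t (p + h) - \sum_(n < N) c n t * h ^+ n) /\
   cintegrableT m D (fun t => f t (p + h) - \sum_(n < N) c n t * h ^+ n).
  elim: N => [|N [IH II]].
    rewrite big_ord0 subr0; split; first by apply: eq_cint => t _; rewrite big_ord0 subr0.
    by apply: (cintegrableT_ext mD _ fi) => t _; rewrite big_ord0 subr0.
  have ci := cintegrableT_Z mD (- h ^+ N) (c_int N).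
  have e t : f t (p + h) - \sum_(n < N.+1) c n t * h ^+ n =
     (f t (p + h) - \sum_(n < N) c n t * h ^+ n) + (- h ^+ N) * c N t.
    by rewrite big_ord_recr/=; ring.
  split; last first.
    by apply: (cintegrableT_ext mD _ (cintegrableT_D mD II ci)) => t _; rewrite e.
  have -> : cintT m D (fun t => f t (p + h) - \sum_(n < N.+1) c n t * h ^+ n) =
     cintT m D (fun t => (f t (p + h) - \sum_(n < N) c n t * h ^+ n) + (- h ^+ N) * c N t).
    by apply: eq_cint => t _; exact: e.
  rewrite (cintD mD II ci) (cintZ mD _ (c_int N)) -IH big_ord_recr/=; ring.
rewrite E mulrAC -mulrA.
apply: le_trans (cabs_cint_le mD I (integrableZl mD ((cabs h / r) ^+ N) iG) _) _.
  by move=> t Dt; rewrite /= mulrC fG.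
by rewrite RintegralZl// mulrC; lra.
Qed.

End IntegralOfAnalytic.

Section Dirichlet.
Variables (R : realType) (a : R -> R[i]) (alpha : R).
Hypothesis arate : exponential_growth_rate a alpha.
Implicit Types (z p : R[i]) (l : R).

Definition growth_weight l : R := cabs (a l) * expR (- (alpha * `|l|)).

Let G := growth_weight.

Lemma alpha_gt0 : 0 < alpha. Proof. by case: arate. Qed.

Lemma growth_weight_ge0 l : 0 <= growth_weight l.
Proof. by rewrite mulr_ge0 ?cabs_ge0 ?expR_ge0. Qed.

Lemma growth_weight_lty (D : set R) : (\esum_(l in D) (growth_weight l)%:E < +oo)%E.
Proof.
case: arate => _; apply: le_lt_trans; rewrite [leLHS]esum_mkcond.
apply: le_esum => l _; case: ifP => // _; rewrite ?lee_fin ?growth_weight_ge0//.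
Qed.

Lemma growth_weight_integrable (D : set R) :
  (count_measure R R).-integrable D (EFin \o growth_weight).
Proof.
apply: integrable_counting; apply: le_lt_trans (growth_weight_lty D).
by apply: le_esum => l _; rewrite lee_fin ger0_norm ?growth_weight_ge0.
Qed.

(** Here [2 pi >= 1] is used to compare the decay of the character with the rate [alpha]. The
    parameter [q] is the radius of a Taylor disc, whose price in [echar_taylor] is the factor
    [exp(2 pi q l)]. *)
Lemma dirichlet_term_le z l (q : R) : 0 < l -> alpha <= complex.Im z - q -> 0 <= q ->
  cabs (a l * echar l z) * expR (2 * pi * q * l) <= growth_weight l.
Proof.
move=> l0 zq q0; rewrite cabsM -mulrA ler_wpM2l ?cabs_ge0// cabs_echar -expRD ler_expR.
rewrite (ger0_norm (ltW l0)).
have p2 := pi_ge2 R; have al := alpha_gt0.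
have : alpha <= 2 * pi * (complex.Im z - q).
  apply: le_trans (_ : 2 * pi * alpha <= _); first by rewrite ler_peMl ?ltW//; nra.
  by rewrite ler_wpM2l//; nra.
by move=> h; nra.
Qed.

Lemma dirichlet_summable z : alpha < complex.Im z ->
  csummable [set l : R | 0 < l] (dirichlet_term a z).
Proof.
move=> az; apply: (@csummable_dom _ R _ _ growth_weight); first exact: growth_weight_lty.
move=> l l0; have := @dirichlet_term_le z l 0 l0; rewrite subr0 !(mulr0, mul0r) expR0 mulr1.
by apply => //; exact: ltW.
Qed.

Lemma dirichlet_seriesE z : alpha < complex.Im z -> dirichlet_series a z =
  a 0 / 2 + cintT (count_measure R R) [set l : R | 0 < l] (fun l => a l * echar l z).
Proof.
by move=> az; rewrite /dirichlet_series (@csum_cint _ R)//; exact: dirichlet_summable.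
Qed.

Lemma dirichlet_canalytic p : alpha < complex.Im p -> canalytic (dirichlet_series a) p.
Proof.
move=> ap; pose r := (complex.Im p - alpha) / 2.
have r0 : 0 < r by rewrite divr_gt0// subr_gt0.
have mall (f : R -> R[i]) (D : set (discrete_space R)) : cmeasurable_fun D f.
  by split; exact: measurable_fun_discrete.
have K : canalytic (fun z => cintT (count_measure R R) [set l : R | 0 < l]
    (fun l => a l * echar l z)) p.
  apply: (@cint_canalytic _ _ _ (count_measure R R) _ (measurable_discrete _)
    (fun l z => a l * echar l z) (fun n l => a l * echar l p * echar_coef l n)
    growth_weight p r r0) => //.
    exact: growth_weight_integrable.
  move=> l N h l0 hr; rewrite echarDr.
  rewrite [X in cabs X](_ : _ = a l * echar l p *
     (echar l h - \sum_(n < N) echar_coef l n * h ^+ n)); last first.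
    by rewrite mulrBr mulr_sumr mulrA; congr (_ - _); apply: eq_bigr => n _; rewrite !mulrA.
  rewrite cabsM; apply: (@le_trans _ _ (cabs (a l * echar l p) *
     ((cabs h / r) ^+ N * expR (2 * pi * r * l)))).
    by rewrite ler_wpM2l ?cabs_ge0// echar_taylor// ltW.
  rewrite mulrCA mulrC ler_wpM2r//.
    by rewrite exprn_ge0// divr_ge0 ?cabs_ge0// ltW.
  apply: dirichlet_term_le => //; last exact: ltW.
  by rewrite /r; lra.
apply: (@canalytic_near _ _ _ _ (complex.Im p - alpha) _ _
  (canalyticD (canalytic_cst (a 0 / 2) p) K)); first by rewrite subr_gt0.
move=> z zp; rewrite dirichlet_seriesE//.
have := le_lt_trans (Im_le_cabs _) zp; rewrite cImD cImN ltr_norml => /andP[h _]; lra.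
Qed.

Definition dirichlet_bound : R :=
  cabs (a 0 / 2) + 2 * \int[count_measure R R]_(l in [set l : R | 0 < l]) growth_weight l.

Lemma dirichlet_bounded z : alpha < complex.Im z ->
  cabs (dirichlet_series a z) <= dirichlet_bound.
Proof.
move=> az; rewrite dirichlet_seriesE// (le_trans (cabsD _ _))// lerD2l.
apply: cabs_cint_le.
- exact: measurable_discrete.
- by apply: (@csummable_cintegrable _ R); exact: dirichlet_summable.
- exact: growth_weight_integrable.
- move=> l l0; have := @dirichlet_term_le z l 0 l0; rewrite subr0 !(mulr0, mul0r) expR0 mulr1.
  by apply => //; exact: ltW.
Qed.

End Dirichlet.

(** * Almost periodicity of the Dirichlet series *)

Section AlmostPeriodic.
Variable R : realType.

Lemma echar_real (l t : R) : echar l t%:C = echar 1 (l * t)%:C.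
Proof. by rewrite /echar rmorphM /=; congr cexp; ring. Qed.

Lemma echar_near1 (x : R) : `|x| <= 1 ->
  cabs (echar 1 x%:C - 1) <= `|x| * expR (2 * pi).
Proof.
move=> x1; have := @echar_taylor R 1 x%:C 1 1 ler01 ltr01.
rewrite cabs_real => /(_ x1); rewrite big_ord1 /echar_coef !expr0 fact0 invr1 !mulr1 expr1.
by rewrite divr1.
Qed.

(* Pigeonhole on the torus: subtract from [u] a representative of its cell. *)
Lemma simultaneous_return (ls : seq R) (e : R) : 0 < e ->
  relatively_dense [set t | forall l, l \in ls -> cabs (echar l t%:C - 1) <= e].
Proof.
move=> e0.
(* Two points in a cell of side [1/(M+1)] change each character by at most [e], by the estimate
   [echar_near1]. *)
pose M := Num.truncn (expR (2 * pi) / e : R).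
have MP : expR (2 * pi) / e < M.+1%:R by exact: truncnS_gt.
have M0 : 0 < M.+1%:R :> R by [].
pose frac (x : R) := x - (Num.floor x)%:~R.
have frac01 x : 0 <= frac x < 1.
  have /andP[h1 h2] := floor_itv x; rewrite /frac subr_ge0 h1 /= ltrBlDl.
  by rewrite intrD in h2.
pose cell (t : R) : {ffun 'I_(size ls) -> 'I_M.+1} :=
  [ffun j : 'I_(size ls) => inord (Num.truncn (M.+1%:R * frac (ls`_j * t)))].
pose rep c : R := xget 0 [set t | cell t = c].
pose L := \sum_(c : {ffun 'I_(size ls) -> 'I_M.+1}) `|rep c|.
have repL c : `|rep c| <= L by rewrite /L (bigD1 c)//= lerDl sumr_ge0.
have L0 : 0 <= L by rewrite sumr_ge0.
exists (2 * L + 1) => [|x]; first by rewrite ltr_wpDl// mulr_ge0.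
(* Since [|v| <= L], the shift by 1/2 places [u - v] strictly inside [(x, x + 2L + 1)]. *)
pose u := x + L + 2^-1; pose v := rep (cell u).
exists (u - v); last first.
  have := repL (cell u); rewrite -/v ler_norml /u => /andP[h1 h2].
  by apply/andP; split; lra.
move=> l lls /=.
have cv : cell v = cell u by rewrite /v /rep; apply: (@xgetPex _ 0 [set t | cell t = cell u]); exists u.
pose j : 'I_(size ls) := Ordinal (eq_ind _ is_true lls _ (esym (index_mem l ls))).
have lj : ls`_j = l by rewrite /= nth_index.
have tr (t : R) : (Num.truncn (M.+1%:R * frac (l * t)%R)%R < M.+1)%N.
  have /andP[f0 f1] := frac01 (l * t).
  by rewrite truncn_lt_nat ?mulr_ge0// gtr_pMr.
have : Num.truncn (M.+1%:R * frac (l * v)) = Num.truncn (M.+1%:R * frac (l * u)).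
  move/ffunP/(_ j): cv; rewrite !ffunE lj => /(congr1 (@nat_of_ord M.+1)).
  by rewrite !inordK ?tr.
move=> E; have /andP[u0 u1] := frac01 (l * u); have /andP[v0 v1] := frac01 (l * v).
have hu : (Num.truncn (M.+1%:R * frac (l * u)))%:R <= M.+1%:R * frac (l * u) < (Num.truncn (M.+1%:R * frac (l * u))).+1%:R.
  by apply: truncn_itv; rewrite mulr_ge0.
have hv : (Num.truncn (M.+1%:R * frac (l * v)))%:R <= M.+1%:R * frac (l * v) < (Num.truncn (M.+1%:R * frac (l * v))).+1%:R.
  by apply: truncn_itv; rewrite mulr_ge0.
rewrite E in hv; move: hu hv; rewrite -natr1.
set K := (Num.truncn _)%:R => /andP[hu1 hu2] /andP[hv1 hv2].
have fuv : `|frac (l * u) - frac (l * v)| < M.+1%:R^-1.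
  rewrite -(ltr_pM2l M0) divff ?gt_eqF// -[X in X * `|_|](gtr0_norm M0) -normrM mulrBr.
  by rewrite ltr_norml; apply/andP; split; lra.
have fuv1 : `|frac (l * u) - frac (l * v)| <= 1.
  by rewrite ler_norml; apply/andP; split; lra.
rewrite echar_real mulrBr.
have -> : (l * u - l * v)%:C = ((Num.floor (l * u) - Num.floor (l * v))%:~R : R)%:C +
    (frac (l * u) - frac (l * v))%:C :> R[i].
  by rewrite -rmorphD /= intrD mulrNz /frac; congr (_%:C); ring.
rewrite echarDr echar1_int mul1r (le_trans (echar_near1 fuv1))//.
apply: (@le_trans _ _ (M.+1%:R^-1 * expR (2 * pi))).
  by rewrite ler_wpM2r ?expR_ge0// ltW.
by rewrite mulrC ler_pdivrMr// -ler_pdivrMl// [_^-1 * _]mulrC ltW.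
Qed.

Variables (a : R -> R[i]) (alpha : R).
Hypothesis arate : exponential_growth_rate a alpha.

Let G := growth_weight a alpha.
Let D : set R := [set l | 0 < l].

Lemma growth_weight_tail (e : R) : 0 < e ->
  exists2 X : set R, finite_set X & (\esum_(l in D `&` ~` X) (G l)%:E <= e%:E)%E.
Proof.
move=> e0.
have G0 l : (0 <= (G l)%:E)%E by rewrite lee_fin growth_weight_ge0.
have fD : (\esum_(l in D) (G l)%:E \is a fin_num)%E.
  by rewrite ge0_fin_numE ?esum_ge0// (growth_weight_lty arate).
have [_ [X [finX XD] <-] h] := ub_ereal_sup_adherent e0 fD.
exists X => //; move: h; rewrite -/(esum _ _) (esumID X)// => h.
have E : (\esum_(l in D `&` X) (G l)%:E = \sum_(l \in X) (G l)%:E)%E.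
  by rewrite (_ : D `&` X = X) ?esum_fset//; apply/seteqP; split => [x []//|x Xx]; split => //; exact: XD.
move: h; rewrite E.
have fX : (\sum_(l \in X) (G l)%:E \is a fin_num)%E.
  have := fD; rewrite (esumID X)// E ge0_fin_numE; last by rewrite adde_ge0 ?fsume_ge0 ?esum_ge0.
  move=> h; rewrite ge0_fin_numE ?fsume_ge0//; apply: le_lt_trans h.
  by rewrite leeDl// esum_ge0.
have fY : (\esum_(l in D `&` ~` X) (G l)%:E \is a fin_num)%E.
  by rewrite ge0_fin_numE ?esum_ge0// (growth_weight_lty arate).
rewrite -(fineK fX) -(fineK fY) -!EFinD lte_fin lee_fin => h; lra.
Qed.

(** A finite set [X] of frequencies carries the series up to a small tail. Common almost periods of
    the characters in [X] come from [simultaneous_return]; on the tail a character changes by at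
    most 2. *)
Lemma dirichlet_almost_periodic (y : R) : alpha < y ->
  almost_periodic (fun x => dirichlet_series a (x +i* y)).
Proof.
move=> ay; split.
  move=> x; apply/cvgrPdist_le => e e0.
  have /andP[/eqP eI eR] : (0 == complex.Im e) && (0 < complex.Re e).
    by move: e0; rewrite ltcE/= eq_sym.
  have /canalytic_lipschitz[r [C [r0 C0 H]]] : canalytic (dirichlet_series a) (x +i* y).
    exact: (dirichlet_canalytic arate).
  near=> t; rewrite -cabsC lecE/= -eI eqxx/= cabs_distC.
  have tx : cabs ((t +i* y) - (x +i* y)) = `|t - x|.
    by rewrite cabsE /= subrr expr0n/= addr0 sqrtr_sqr.
  have t1 : `|t - x| <= r.
    by rewrite distrC ltW//; near: t; apply/nbhs_ballP; exists r.
  have t2 : `|t - x| <= complex.Re e / (C + 1).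
    rewrite distrC ltW//; near: t; apply/nbhs_ballP.
    by exists (complex.Re e / (C + 1)) => //=; rewrite divr_gt0// ltr_wpDl.
  apply: le_trans (H (t +i* y) _) _; rewrite tx//.
  move: t2; rewrite ler_pdivlMr; last by rewrite ltr_wpDl.
  by move=> h; have := normr_ge0 (t - x); lra.
move=> eps eps0.
pose S := fine (\esum_(l in D) (G l)%:E).
have S0 : 0 <= S by rewrite fine_ge0// esum_ge0// => l _; rewrite lee_fin growth_weight_ge0.
(* These choices give [e1 * S + 2 * e2 <= eps / 4]; the factor 2 of [cabs_cint_le] leaves [eps / 2],
   which secures the strict bound on the supremum. *)
pose e1 := eps / (8 * (S + 1)); pose e2 := eps / 16.
have e10 : 0 < e1 by rewrite divr_gt0// mulr_gt0// ltr_wpDl.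
have e20 : 0 < e2 by rewrite divr_gt0.
have [X finX XT] := growth_weight_tail e20.
exists [set t | forall l, l \in (fset_set X : seq R) -> cabs (echar l t%:C - 1) <= e1].
  exact: simultaneous_return.
move=> t tA.
apply: (@le_lt_trans _ _ (eps / 2)%:E); last by rewrite lte_fin ltr_pdivrMr// ltr_pMr// ltr1n.
apply: ge_ereal_sup => _ [x _ <-]; rewrite lee_fin.
pose u l := G l * cabs (echar l t%:C - 1).
have c1 l : cabs (echar l t%:C) = 1 by rewrite cabs_echar /= mulr0 oppr0 expR0.
have u0 l : (0 <= (u l)%:E)%E by rewrite lee_fin mulr_ge0 ?cabs_ge0 ?growth_weight_ge0.
have ul l : u l <= 2 * G l.
  rewrite /u mulrC ler_wpM2r ?growth_weight_ge0// (le_trans (cabsB _ _))// c1 cabs1; lra.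
have uD : (\esum_(l in D) (u l)%:E <= (e1 * S + 2 * e2)%:E)%E.
  rewrite (esumID X)// EFinD; apply: leeD.
    apply: (@le_trans _ _ (\esum_(l in D `&` X) (e1 * G l)%:E)%E).
      apply: le_esum => l [Dl Xl]; rewrite lee_fin /u mulrC ler_wpM2r ?growth_weight_ge0//.
      by apply: tA; rewrite in_fset_set// inE.
    apply: le_trans (esum_scale_le _ (ltW e10) (growth_weight_ge0 a alpha)) _.
    rewrite (EFinM e1 S); apply: lee_wpmul2l; first by rewrite lee_fin ltW.
    rewrite /S fineK ?ge0_fin_numE ?(growth_weight_lty arate) ?esum_ge0//; last first.
      by move=> l _; rewrite lee_fin growth_weight_ge0.
    rewrite [leRHS](esumID X)//; last by move=> l _; rewrite lee_fin growth_weight_ge0.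
    by rewrite leeDl// esum_ge0// => l _; rewrite lee_fin growth_weight_ge0.
  apply: (@le_trans _ _ (\esum_(l in D `&` ~` X) (2 * G l)%:E)%E).
    by apply: le_esum => l _; rewrite lee_fin.
  apply: le_trans (esum_scale_le _ (ler0n _ 2) (growth_weight_ge0 a alpha)) _.
  by rewrite (EFinM 2 e2); apply: lee_wpmul2l; rewrite ?lee_fin.
have Dm : measurable (D : set (discrete_space R)) by exact: measurable_discrete.
have uDy : (\esum_(l in D) (u l)%:E < +oo)%E by apply: (le_lt_trans uD); rewrite ltry.
have iu : (count_measure R R).-integrable D (EFin \o u).
  apply: integrable_counting; apply: le_lt_trans uDy; apply: le_esum => l _.
  by rewrite lee_fin ger0_norm// -lee_fin.
have si (s : R) : cintegrableT (count_measure R R) D (fun l => a l * echar l (s +i* y)).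
  by apply: (@csummable_cintegrable _ R); exact: (dirichlet_summable arate).
have zt l : a l * echar l ((x + t) +i* y) - a l * echar l (x +i* y) =
   a l * echar l (x +i* y) * (echar l t%:C - 1).
  rewrite (_ : (x + t) +i* y = (x +i* y) + t%:C); last by apply: complex_eqP; rewrite ?(cReD, cImD)/= ?addr0.
  by rewrite echarDr; ring.
rewrite !(dirichlet_seriesE arate)// opprD addrACA subrr add0r.
rewrite -[- cintT _ _ _]mulN1r -(cintZ Dm _ (si x)).
rewrite -(cintD Dm (si _) (cintegrableT_Z Dm _ (si x))).
apply: le_trans (cabs_cint_le (b := u) Dm _ iu _) _.
- exact: (cintegrableT_D Dm (si _) (cintegrableT_Z Dm _ (si x))).
- move=> l Dl; rewrite mulN1r zt cabsM ler_wpM2r ?cabs_ge0//.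
  have := @dirichlet_term_le _ _ _ arate (x +i* y) l 0 Dl.
  by rewrite subr0 !(mulr0, mul0r) expR0 mulr1; apply => //; exact: ltW.
rewrite (@Rintegral_counting _ R)//.
have : fine (\esum_(l in D) (u l)%:E) <= e1 * S + 2 * e2.
  rewrite -lee_fin fineK// ge0_fin_numE ?esum_ge0//.
have : e1 * S <= eps / 8.
  rewrite /e1 -mulrA ler_wpM2l ?(ltW eps0)// invfM -mulrA ger_pMr ?invr_gt0//.
  by rewrite ler_pdivrMl ?mulr1 ?lerDl// ltr_wpDl.
by rewrite /e2; lra.
Unshelve. all: by end_near. Qed.

End AlmostPeriodic.

Section DirichletHalfPlane.
Variables (R : realType) (a : R -> R[i]) (alpha : R).
Hypothesis arate : exponential_growth_rate a alpha.

Lemma canalytic_translate (f : R[i] -> R[i]) (p w : R[i]) :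
  canalytic f (p + w) -> canalytic (fun z => f (z + w)) p.
Proof.
move=> [r [C [c [r0 H]]]]; exists r, C, c; split => // N h hr.
by rewrite addrAC H.
Qed.

Lemma dirichlet_AP : holomorphic_almost_periodic_above alpha (dirichlet_series a).
Proof.
have Imz (z : R[i]) : complex.Im (z + 'i%C * alpha%:C) = complex.Im z + alpha.
  by rewrite cImD cImM/= mul0r add0r mul1r.
split.
- move=> z z0; apply: canalytic_cderivable; apply: canalytic_translate.
  by apply: (dirichlet_canalytic arate); rewrite Imz ltrDr.
- move=> b1 b2 b10 _; apply: (@le_lt_trans _ _ (dirichlet_bound a alpha)%:E).
    apply: ge_ereal_sup => _ [z /= /andP[z1 _] <-]; rewrite lee_fin.
    apply: (dirichlet_bounded arate); rewrite Imz ltrDr.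
    exact: lt_trans z1.
  exact: ltry.
- move=> y y0.
  rewrite (_ : (fun x => _) = fun x => dirichlet_series a (x +i* (y + alpha))).
    by apply: (dirichlet_almost_periodic arate); rewrite ltrDr.
  apply/funext => x; congr (dirichlet_series _ _); apply: complex_eqP => /=.
    by rewrite mulr0 mul0r subr0 addr0.
  by rewrite !mul0r mul1r add0r.
Qed.

End DirichletHalfPlane.

(** * Calculus of complex functions of a real variable *)

Section CompactSupportCalculus.
Variable R : realType.
Implicit Types (f g F G : R -> R[i]) (x T : R).

Lemma is_cderive_continuous f x d : is_cderive f x d ->
  {for x, continuous (fun t => complex.Re (f t))} /\
  {for x, continuous (fun t => complex.Im (f t))}.
Proof.
move=> [h1 h2]; split; apply: differentiable_continuous; apply/derivable1_diffP;
  exact: ex_derive.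
Qed.

Lemma is_cderive_unique f x d e : is_cderive f x d -> is_cderive f x e -> d = e.
Proof.
by move=> [a1 a2] [b1 b2]; apply: complex_eqP; [rewrite -(@derive_val _ _ _ _ _ _ _ a1) (@derive_val _ _ _ _ _ _ _ b1)|rewrite -(@derive_val _ _ _ _ _ _ _ a2) (@derive_val _ _ _ _ _ _ _ b2)].
Qed.

Lemma is_cderive_near f g x d (e : R) : 0 < e -> (forall t, `|t - x| < e -> f t = g t) ->
  is_cderive f x d -> is_cderive g x d.
Proof.
move=> e0 fg [h1 h2].
have nfg : \forall t \near x, f t = g t.
  by apply/nbhs_ballP; exists e => //= t; rewrite /ball/= distrC; exact: fg.
split; [move: h1|move: h2]; apply: near_eq_is_derive; by apply: filterS nfg => t ->.
Qed.

Lemma cderive0_eq F (a b : R) : (forall x, is_cderive F x 0) -> F a = F b.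
Proof.
move=> dF; wlog ab : a b / a <= b.
  by move=> H; have [/H|/ltW/H ->] := leP a b.
have key (p : R -> R) : (forall x, is_derive x 1 p 0) -> p b - p a = 0.
  move=> dp; have [|c _ ->] := @MVT_segment R p (fun=> 0) a b ab (fun x _ => dp x).
    by apply: derivable_within_continuous => x _; apply: ex_derive.
  by rewrite mul0r.
apply: complex_eqP; apply/esym/eqP; rewrite -subr_eq0; apply/eqP.
  by apply: (key (fun t => complex.Re (F t))) => x; case: (dF x).
by apply: (key (fun t => complex.Im (F t))) => x; case: (dF x).
Qed.

Lemma is_cderive_supp f x d T : T < `|x| -> (forall t, T < `|t| -> f t = 0) ->
  is_cderive f x d -> d = 0.
Proof.
move=> Tx f0 fx; apply: (is_cderive_unique fx).
apply: (@is_cderive_near (fun=> 0) _ _ _ (`|x| - T)); rewrite ?subr_gt0//.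
  move=> t tx; rewrite f0//; have := lerB_dist x t; rewrite distrC => h.
  by move: tx; rewrite ltrBrDl => tx; lra.
exact: is_cderive_cst.
Qed.

Definition lebesgueR : {measure set (measurableTypeR R) -> \bar R} := @lebesgue_measure R.

Definition ccontinuous f : Prop :=
  continuous (fun t => complex.Re (f t)) /\ continuous (fun t => complex.Im (f t)).

Lemma Rintegral_support (p : R -> R) (a b : R) :
  (forall x, x \notin `[a, b] -> p x = 0) ->
  \int[lebesgueR]_t p t = \int[lebesgueR]_(t in `[a, b]) p t.
Proof.
move=> p0; rewrite [RHS]Rintegral_mkcond; apply: eq_Rintegral => x _.
rewrite patchE; case: ifPn => // h; rewrite p0//.
by apply: contra h; rewrite inE.
Qed.

Lemma Rintegral_FTC2 (p P : R -> R) (a b : R) : a < b ->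
  (forall x, is_derive x 1 P (p x)) -> continuous p ->
  \int[lebesgueR]_(t in `[a, b]) p t = P b - P a.
Proof.
move=> ab dP cp; rewrite /Rintegral (@continuous_FTC2 R p P a b ab)//.
- by apply: continuous_subspaceT.
- split.
  + by move=> x _; apply: ex_derive.
  + apply: cvg_at_right_filter; apply: differentiable_continuous; apply/derivable1_diffP.
    exact: ex_derive.
  + apply: cvg_at_left_filter; apply: differentiable_continuous; apply/derivable1_diffP.
    exact: ex_derive.
- by move=> x _; rewrite derive1E derive_val.
Qed.

Lemma cintegral_FTC2 g G T S : (forall x, is_cderive G x (g x)) -> ccontinuous g ->
  (forall x, T < `|x| -> g x = 0) -> T <= S -> 0 < S ->
  cintegral_wrt lebesgueR setT g = G S - G (- S).
Proof.
move=> dG [c1 c2] g0 TS S0.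
have out x : x \notin `[- S, S] -> g x = 0.
  move=> h; apply: g0; apply: (le_lt_trans TS); rewrite ltNge ler_norml.
  by apply: contra h; rewrite in_itv.
have SS : - S < S by lra.
rewrite /cintegral_wrt; apply: complex_eqP; rewrite ?(cReD, cImD, cReN, cImN)/=.
  rewrite (@Rintegral_support (fun t => complex.Re (g t)) (- S) S); last by move=> x /out ->.
  by apply: (@Rintegral_FTC2 _ (fun t => complex.Re (G t))) => // x; case: (dG x).
rewrite (@Rintegral_support (fun t => complex.Im (g t)) (- S) S); last by move=> x /out ->.
by apply: (@Rintegral_FTC2 _ (fun t => complex.Im (G t))) => // x; case: (dG x).
Qed.

Lemma primitive_exists (p : R -> R) T : continuous p -> (forall x, T < `|x| -> p x = 0) ->
  exists P : R -> R, (forall x, is_derive x 1 P (p x)) /\ (forall x, x < - T -> P x = 0).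
Proof.
(* The base point lies one unit to the left of the support: for [x <= a], where the fundamental
   theorem does not reach, the primitive vanishes near [x]. *)
move=> cp p0; pose a := - T - 1.
pose P x := \int[lebesgueR]_(t in [set` `[a, x]]) p t.
have P0 x : x < - T -> P x = 0.
  move=> xT; rewrite /P (@eq_Rintegral _ _ _ _ _ (fun=> 0)).
    by rewrite Rintegral_cst//= mul0r.
  move=> t; rewrite inE/= in_itv/= => /andP[_ tx]; apply: p0.
  by rewrite ltr_normr; apply/orP; right; rewrite ltrNr (le_lt_trans tx).
exists P; split => // x; have [xa|xa] := ltP a x.
  have [||||d1 d2] := @continuous_FTC1_closed R p a x (x + 1).
  - by rewrite ltrDl.
  - apply: continuous_compact_integrable; first exact: segment_compact.
    exact: continuous_subspaceT.
  - exact: xa.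
  - exact: cp.
  by apply: DeriveDef => //; rewrite -derive1E.
have -> : p x = 0.
  by apply: p0; rewrite ltr_normr; apply/orP; right; move: xa; rewrite /a; lra.
have nP : \forall t \near x, P t = 0.
  apply/nbhs_ballP; exists 1 => //= t; rewrite /ball/= => tx; apply: P0.
  by move: tx xa; rewrite ltr_norml /a => /andP[]; lra.
apply: (@near_eq_is_derive _ _ _ (cst 0)).
by apply: filterS nP => t ->.
Qed.

Lemma cprimitive_exists g T : ccontinuous g -> (forall x, T < `|x| -> g x = 0) ->
  exists G, (forall x, is_cderive G x (g x)) /\ (forall x, x < - T -> G x = 0).
Proof.
move=> [c1 c2] g0.
have [P [dP P0]] := primitive_exists c1 (fun x Tx => congr1 (@complex.Re R) (g0 x Tx)).
have [Q [dQ Q0]] := primitive_exists c2 (fun x Tx => congr1 (@complex.Im R) (g0 x Tx)).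
exists (fun x => P x +i* Q x); split => [x|x xT].
  by split; [exact: dP|exact: dQ].
by rewrite P0// Q0.
Qed.

(* Off by one: [f] is (n+1) times differentiable. *)
Fixpoint smooth_upto n f : Prop :=
  exists2 f', (forall x, is_cderive f x (f' x)) &
    if n is m.+1 then smooth_upto m f' else True.

Definition csmooth f : Prop := forall n, smooth_upto n f.

Lemma smooth_uptoS n f : smooth_upto n.+1 f -> smooth_upto n f.
Proof. by elim: n f => [|n IH] f [f' df sf]; exists f' => //; exact: IH. Qed.

Lemma smooth_upto_prim n f f' : (forall x, is_cderive f x (f' x)) ->
  smooth_upto n f' -> smooth_upto n.+1 f.
Proof. by move=> df sf; exists f'. Qed.

Lemma smooth_uptoD n f g : smooth_upto n f -> smooth_upto n g ->
  smooth_upto n (fun x => f x + g x).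
Proof.
elim: n f g => [|n IH] f g [f' df sf] [g' dg sg]; exists (fun x => f' x + g' x).
- by move=> x; exact: is_cderiveD.
- by [].
- by move=> x; exact: is_cderiveD.
- exact: IH.
Qed.

Lemma smooth_uptoM n f g : smooth_upto n f -> smooth_upto n g ->
  smooth_upto n (fun x => f x * g x).
Proof.
elim: n f g => [|n IH] f g.
  by move=> [f' df _] [g' dg _]; exists (fun x => f' x * g x + f x * g' x) => // x; exact: is_cderiveM.
move=> Sf Sg; have sf1 := smooth_uptoS Sf; have sg1 := smooth_uptoS Sg.
case: Sf Sg => f' df sf [g' dg sg]; exists (fun x => f' x * g x + f x * g' x).
  by move=> x; exact: is_cderiveM.
by apply: smooth_uptoD; apply: IH.
Qed.

Lemma smooth_upto_cst n (z : R[i]) : smooth_upto n (fun=> z).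
Proof.
elim: n z => [|n IH] z; exists (fun=> 0) => //; first by move=> x; exact: is_cderive_cst.
by move=> x; exact: is_cderive_cst.
Qed.

Lemma smooth_upto_echar n (z : R[i]) : smooth_upto n (fun x => echar x z).
Proof.
elim: n => [|n IH]; exists (fun x => (2 * pi)%:C * 'i%C * z * echar x z) => //;
  try (by move=> x; exact: is_cderive_echar).
by apply: smooth_uptoM => //; exact: smooth_upto_cst.
Qed.

Lemma smooth_upto_shift n f (c : R) : smooth_upto n f -> smooth_upto n (fun x => f (x - c)).
Proof.
elim: n f => [|n IH] f [f' df sf]; exists (fun x => f' (x - c)) => //;
  try (by move=> x; exact: is_cderive_shift).
exact: IH.
Qed.

Lemma smooth_upto_continuous n f : smooth_upto n f -> ccontinuous f.
Proof.
by case: n => [|n] [f' df _]; split => x; case: (is_cderive_continuous (df x)).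
Qed.

Lemma csmooth_smooth f : csmooth f ->
  smooth (fun t => complex.Re (f t)) /\ smooth (fun t => complex.Im (f t)).
Proof.
move=> sf; split => n.
  have := sf n; elim: n f {sf} => [|n IH] f [f' df sf] x.
    by case: (df x) => h _; rewrite derive1n0; apply: ex_derive.
  rewrite derive1Sn (_ : derive1 (fun t => complex.Re (f t)) = fun t => complex.Re (f' t)); first exact: IH.
  by apply/funext => t; case: (df t) => h _; rewrite derive1E derive_val.
have := sf n; elim: n f {sf} => [|n IH] f [f' df sf] x.
  by case: (df x) => _ h; rewrite derive1n0; apply: ex_derive.
rewrite derive1Sn (_ : derive1 (fun t => complex.Im (f t)) = fun t => complex.Im (f' t)); first exact: IH.
by apply/funext => t; case: (df t) => _ h; rewrite derive1E derive_val.
Qed.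

Lemma is_cderive_comp_affine f x (c s : R) d : is_cderive f (c + s * x) d ->
  is_cderive (fun t => f (c + s * t)) x (s%:C * d).
Proof.
have h : is_derive x 1 (fun t : R => c + s * t) s.
  rewrite (_ : (fun _ => _) = cst c + s \*: (@id R)).
    by apply: is_derive_eq; rewrite /GRing.scale/= mulr1 add0r.
  by apply/funext => t /=.
move=> [f1 f2]; split.
  apply: is_derive_eq (@is_derive1_comp R (fun t => complex.Re (f t)) (fun t => c + s * t) x _ _ f1 h) _.
  by rewrite cReM/= mul0r subr0 mulrC.
apply: is_derive_eq (@is_derive1_comp R (fun t => complex.Im (f t)) (fun t => c + s * t) x _ _ f2 h) _.
by rewrite cImM/= mul0r addr0 mulrC.
Qed.

Lemma smooth_upto_affine n f (c s : R) : smooth_upto n f ->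
  smooth_upto n (fun t => f (c + s * t)).
Proof.
elim: n f => [|n IH] f [f' df sf]; exists (fun t => s%:C * f' (c + s * t)) => //;
  try (by move=> x; exact: is_cderive_comp_affine).
by apply: smooth_uptoM; [exact: smooth_upto_cst|exact: IH].
Qed.

End CompactSupportCalculus.

(** * Test functions and their Fourier transforms *)

Section Bump.
Variable R : realType.
Implicit Types (P : {poly R}) (x : R).

(** A family of functions flat at 0 and closed under differentiation: the derivative of
    [P(1/x) exp(-1/x)] has the same form, with [X^2 (P - P')] in place of [P]. Smoothness then
    follows by induction. *)
Definition expoly P x : R := if 0 < x then P.[x^-1] * expR (- x^-1) else 0.

(** From [exp(y) >= y^m / m!] with [y = 1/x] and [m = size P + 2]. The quadratic decay makes the
    derivative at 0 vanish. *)
Lemma expoly_bound P : exists2 C : R, 0 <= C & forall x, 0 < x <= 1 -> `|expoly P x| <= C * x ^+ 2.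
Proof.
pose n := size P; pose m := n.+2; pose S := \sum_(i < n) `|P`_i|.
have S0 : 0 <= S by rewrite sumr_ge0.
have f0 : 0 < m`!%:R :> R by rewrite ltr0n fact_gt0.
exists (S * m`!%:R); first by rewrite mulr_ge0// ltW.
move=> x /andP[x0 x1]; rewrite /expoly x0 normrM (ger0_norm (expR_ge0 _)).
have y0 : 0 < x^-1 by rewrite invr_gt0.
have y1 : 1 <= x^-1 by rewrite invf_ge1.
have hP : `|P.[x^-1]| <= S * x^-1 ^+ n.
  rewrite horner_coef (le_trans (ler_norm_sum _ _ _))// /S mulr_suml; apply: ler_sum => i _.
  rewrite normrM normrX (ger0_norm (ltW y0)) ler_wpM2l//.
  by apply: ler_weXn2l => //; exact: ltnW.
have hE : expR (- x^-1) <= m`!%:R * x ^+ m.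
  have mx : 0 < m`!%:R * x ^+ m by apply: mulr_gt0 => //; exact: exprn_gt0.
  rewrite expRN -[leRHS]invrK lef_pV2 ?posrE ?expR_gt0// ?invr_gt0//.
  rewrite (le_trans _ (@expR_ge1Dxn R x^-1 n.+1 (ltW y0)))//.
  by rewrite invfM mulrC exprVn lerDr.
have h : `|P.[x^-1]| * expR (- x^-1) <= S * x^-1 ^+ n * (m`!%:R * x ^+ m).
  exact: ler_pM (normr_ge0 _) (expR_ge0 _) hP hE.
apply: (le_trans h); rewrite [leLHS](_ : _ = S * m`!%:R * x ^+ 2)//.
rewrite exprVn /m -(addn2 n) exprD; field.
by rewrite expf_neq0// gt_eqF.
Qed.

Lemma is_derive_expoly P x : is_derive x 1 (expoly P) (expoly ('X^2 * (P - P^`())) x).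
Proof.
have [x0|x0|->] := ltgtP x 0.
- have -> : expoly ('X^2 * (P - P^`())) x = 0 by rewrite /expoly ltNge (ltW x0).
  apply: (@near_eq_is_derive _ _ _ (cst 0)).
  have : \forall t \near x, t < 0 by exact: lt_nbhsl.
  by apply: filterS => t t0; rewrite /expoly ltNge (ltW t0).
- have xn0 : x != 0 by rewrite gt_eqF.
  have hV : is_derive x 1 (fun t : R => t^-1) (- x ^- 2).
    have := is_deriveV (f := @id R) xn0 (is_derive_id x 1).
    by rewrite /GRing.scale/= mulr1.
  have hP := @is_derive1_comp R (horner P) _ x _ _ (is_derive_poly P x^-1) hV.
  have hE := @is_derive1_comp R expR (fun t => - t^-1) x _ _ (is_derive_expR _) (is_deriveN hV).
  apply: (@near_eq_is_derive _ _ _ ((horner P \o (fun t : R => t^-1)) * (expR \o (fun t : R => - t^-1)))).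
    have : \forall t \near x, 0 < t by exact: lt_nbhsr.
    by apply: filterS => t t0; rewrite /expoly t0.
  apply: is_derive_eq; rewrite /expoly x0 /GRing.scale/= hornerM hornerXn hornerD hornerN exprVn.
  by ring.
- have -> : expoly ('X^2 * (P - P^`())) 0 = 0 by rewrite /expoly ltxx.
  have [C C0 HC] := expoly_bound P.
  have lim : (fun h : R => h^-1 *: (expoly P (h *: 1 + 0) - expoly P 0)) @ 0^' --> (0 : R).
    apply/cvgrPdist_le => e e0.
    have : \forall h \near (0 : R), `|h| < Num.min 1 (e / (C + 1)).
      apply/nbhs_ballP; exists (Num.min 1 (e / (C + 1))) => /=.
        by rewrite lt_min ltr01 divr_gt0// ltr_wpDl.
      by move=> h; rewrite /ball/= sub0r normrN.
    move=> Hn; rewrite /dnbhs; near_simpl; apply: filterS Hn => h /=.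
    rewrite lt_min => /andP[h1 h2] hn0; rewrite sub0r normrN.
    rewrite /GRing.scale/= mulr1 addr0 {2}/expoly ltxx subr0.
    have [h0|h0] := ltP 0 h; last first.
      by rewrite /expoly ltNge h0/= mulr0 normr0 ltW.
    have hb : `|expoly P h| <= C * h ^+ 2 by apply: HC; rewrite h0 (le_trans (ler_norm _))// ltW.
    rewrite normrM ger0_norm ?invr_ge0 ?(ltW h0)// ler_pdivrMl//.
    apply: (le_trans hb); move: h2; rewrite gtr0_norm// ltr_pdivlMr; last by rewrite ltr_wpDl.
    by move=> h2; nra.
  apply: DeriveDef; first by apply/cvg_ex; exists 0.
  exact: (cvg_lim _ lim).
Unshelve. all: by end_near. Qed.

Lemma smooth_expoly n P : smooth_upto n (fun x => (expoly P x)%:C).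
Proof.
elim: n P => [|n IH] P; exists (fun x => (expoly ('X^2 * (P - P^`())) x)%:C) => //;
  by move=> x; split => /=; [exact: is_derive_expoly|exact: is_derive_cst].
Qed.

Definition raw_bump (e x : R) : R := expoly 1 (e - x) * expoly 1 (e + x).

Lemma expoly1_ge0 x : 0 <= expoly 1 x.
Proof. by rewrite /expoly; case: ifP => // _; rewrite hornerC mul1r expR_ge0. Qed.

Lemma raw_bump_ge0 e x : 0 <= raw_bump e x.
Proof. by rewrite mulr_ge0 ?expoly1_ge0. Qed.

Lemma raw_bump_even e x : raw_bump e (- x) = raw_bump e x.
Proof. by rewrite /raw_bump opprK mulrC. Qed.

Lemma raw_bump_supp e x : e < `|x| -> raw_bump e x = 0.
Proof.
rewrite ltr_normr /raw_bump => /orP[ex|ex].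
  by rewrite {1}/expoly subr_gt0 ltNge (ltW ex)/= mul0r.
by rewrite {2}/expoly -ltrBlDl sub0r ltNge ltW ?mulr0// ltrNr.
Qed.

Lemma raw_bump_gt0 e x : `|x| < e -> 0 < raw_bump e x.
Proof.
rewrite ltr_norml => /andP[h1 h2]; rewrite /raw_bump /expoly subr_gt0 h2.
by rewrite -ltrBlDl sub0r h1 !hornerC !mul1r mulr_gt0 ?expR_gt0.
Qed.

Lemma smooth_raw_bump n e : smooth_upto n (fun x => (raw_bump e x)%:C).
Proof.
rewrite (_ : (fun x => _) = fun x => (expoly 1 (e + (-1) * x))%:C * (expoly 1 (e + 1 * x))%:C).
  by apply: smooth_uptoM; apply: (@smooth_upto_affine _ _ (fun x => (expoly 1 x)%:C)); exact: smooth_expoly.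
by apply/funext => x; rewrite /raw_bump rmorphM mulN1r mul1r.
Qed.

(** [raw_bump e] is normalized by its total mass [I], and [P] is its distribution function. The
    value 1/2 of [P] at 0, due to evenness, is the origin of the term a(0)/2. *)
Lemma bump_exists (e : R) : 0 < e -> exists p P : R -> R,
  [/\ (forall n, smooth_upto n (fun x => (p x)%:C)),
      (forall x, is_derive x 1 P (p x)),
      (forall x, e < `|x| -> p x = 0),
      (forall x, 0 <= p x /\ p (- x) = p x) &
      [/\ (forall x, x < - e -> P x = 0), (forall x, e < x -> P x = 1) & P 0 = 2^-1]].
Proof.
move=> e0; pose b := raw_bump e.
have [cb _] := smooth_upto_continuous (smooth_raw_bump 0 e).
have [B [dB B0]] := primitive_exists cb (@raw_bump_supp e).
have mono x y : x <= y -> B x <= B y.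
  move=> xy; have [|c _ E] := @MVT_segment R B b x y xy (fun t _ => dB t).
    by apply: derivable_within_continuous => t _; apply: ex_derive.
  by rewrite -subr_ge0 E mulr_ge0 ?raw_bump_ge0 ?subr_ge0.
pose I := B (e + 1).
have Bc x : e < x -> B x = I.
  move=> ex; have key (u v : R) : e < u -> u <= v -> B u = B v.
    move=> eu uv; have [|c cuv E] := @MVT_segment R B b u v uv (fun t _ => dB t).
      by apply: derivable_within_continuous => t _; apply: ex_derive.
    apply/esym/eqP; rewrite -subr_eq0 E /b raw_bump_supp ?mul0r//.
    by move: cuv; rewrite in_itv/= => /andP[uc _]; rewrite (lt_le_trans eu)// (le_trans uc)// ler_norm.
  have [h|/ltW h] := leP x (e + 1); first exact: key.
  by apply/esym/key; rewrite ?ltrDl.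
have I0 : 0 < I.
  have h2 : 0 < e / 2 by rewrite divr_gt0.
  have he : e / 2 < e by lra.
  have [||c cI E] := @MVT R B b (- (e / 2)) (e / 2) _ (fun t _ => dB t).
  - lra.
  - by apply: derivable_within_continuous => t _; apply: ex_derive.
  have pc : 0 < b c.
    by apply: raw_bump_gt0; move: cI; rewrite in_itv/= ltr_norml => /andP[]; lra.
  have : 0 < B (e / 2) - B (- (e / 2)) by rewrite E mulr_gt0//; lra.
  have := mono (e / 2) (e + 1) ltac:(lra).
  have := mono (- e - 1) (- (e / 2)) ltac:(lra).
  by rewrite (B0 (- e - 1)) -?/I; lra.
exists (fun x => b x / I), (fun x => B x / I); split.
- move=> n; rewrite (_ : (fun x => _) = fun x => (b x)%:C * (I^-1)%:C).
    by apply: smooth_uptoM; [exact: smooth_raw_bump|exact: smooth_upto_cst].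
  by apply/funext => x; rewrite rmorphM.
- move=> x; rewrite (_ : (fun x => _) = I^-1 \*: B).
    by apply: is_derive_eq; rewrite /GRing.scale/= mulrC.
  by apply/funext => t /=; rewrite /GRing.scale/= mulrC.
- by move=> x ex; rewrite /b raw_bump_supp ?mul0r.
- by move=> x; rewrite divr_ge0 ?raw_bump_ge0 ?(ltW I0)// /b raw_bump_even.
split.
- by move=> x xe; rewrite B0 ?mul0r.
- by move=> x ex; rewrite Bc ?divff ?gt_eqF.
(* The sum [B t + B (- t)] has derivative 0 because the bump is even; it is evaluated at 0 and to
   the right of the support. *)
have sym : B 0 + B 0 = I.
  have dS x : is_cderive (fun t => (B t + B (- t))%:C) x 0.
    have hN : is_derive x 1 (fun t : R => - t) (- 1) by exact: is_deriveNid.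
    have h1 := @is_derive1_comp R B (fun t => - t) x _ _ (dB (- x)) hN.
    split => /=; last exact: is_derive_cst.
    apply: is_derive_eq (is_deriveD (dB x) h1) _.
    by rewrite -/(b _) raw_bump_even mulrN1 subrr.
  have /(congr1 (@complex.Re R)) /= := cderive0_eq 0 (e + 1) dS.
  by rewrite oppr0 (B0 (- (e + 1))) ?addr0// ltrN2 ltrDl.
by rewrite -sym; field; rewrite -mulr2n -mulr_natl mulf_eq0 negb_or pnatr_eq0/=; apply: contraTneq I0 => h; rewrite -sym h addr0 ltxx.
Qed.

End Bump.

Section FourierCompact.
Variable R : realType.
Implicit Types (phi f F G : R -> R[i]) (z w : R[i]) (x y T : R).

Lemma is_derive_linear (M t : R) : is_derive t 1 (fun x : R => M * x) M.
Proof.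
rewrite (_ : (fun _ => _) = M \*: (@id R)).
  by apply: is_derive_eq; rewrite /GRing.scale/= mulr1.
by apply/funext => x.
Qed.

Lemma cderive_le F f (B b : R -> R) x y : x <= y ->
  (forall t, is_cderive F t (f t)) -> (forall t : R, is_derive t 1 B (b t)) ->
  (forall t, x <= t <= y -> cabs (f t) <= b t) -> cabs (F y - F x) <= 2 * (B y - B x).
Proof.
move=> xy dF dB fb.
have key (p q : R -> R) : (forall t : R, is_derive t 1 p (q t)) ->
    (forall t, x <= t <= y -> `|q t| <= b t) -> p y - p x <= B y - B x.
  move=> dp qb; rewrite -subr_ge0.
  have [|c cxy E] := @MVT_segment R (B - p) (b - q) x y xy (fun t _ => is_deriveB (dB t) (dp t)).
    by apply: derivable_within_continuous => t _; apply: ex_derive.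
  have -> : B y - B x - (p y - p x) = (B - p) y - (B - p) x.
    by rewrite -[(B - p) y]/(B y - p y) -[(B - p) x]/(B x - p x); ring.
  rewrite E; apply: mulr_ge0; last by rewrite subr_ge0.
  rewrite -[(b - q) c]/(b c - q c) subr_ge0 (le_trans (ler_norm _))// qb//.
have keyN (p q : R -> R) : (forall t : R, is_derive t 1 p (q t)) ->
    (forall t, x <= t <= y -> `|q t| <= b t) -> `|p y - p x| <= B y - B x.
  move=> dp qb; rewrite ler_norml (key p q)// andbT lerNl.
  have := key (fun t => - p t) (fun t => - q t) (fun t => is_deriveN (dp t)).
  rewrite opprB addrC opprK => H; apply: H => t txy.
  by rewrite normrN qb.
apply: (le_trans (cabs_le _)); rewrite mulr2n mulrDl mul1r cReD cImD cReN cImN.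
apply: lerD.
  apply: (keyN (fun t => complex.Re (F t)) (fun t => complex.Re (f t))).
    by move=> t; case: (dF t).
  by move=> t txy; exact: le_trans (Re_le_cabs _) (fb t txy).
apply: (keyN (fun t => complex.Im (F t)) (fun t => complex.Im (f t))).
  by move=> t; case: (dF t).
by move=> t txy; exact: le_trans (Im_le_cabs _) (fb t txy).
Qed.

Lemma bounded_support phi T : 0 < T -> ccontinuous phi -> (forall x, T < `|x| -> phi x = 0) ->
  exists2 K : R, 0 <= K & forall x, cabs (phi x) <= K.
Proof.
move=> T0 [c1 c2] p0; have TT : - T <= T by lra.
have key (q : R -> R) : continuous q -> (forall x, T < `|x| -> q x = 0) ->
    exists2 K : R, 0 <= K & forall x, `|q x| <= K.
  move=> cq q0.
  have [|c cT Hc] := @EVT_max R (fun t => `|q t|) (- T) T TT.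
    by apply: continuous_subspaceT => t; apply: cvg_norm; exact: cq.
  exists `|q c| => // x; have [xT|xT] := leP `|x| T; last by rewrite q0 ?normr0.
  by apply: Hc; rewrite in_itv/= -ler_norml.
have [K1 K10 H1] := key _ c1 (fun x h => congr1 (@complex.Re R) (p0 x h)).
have [K2 K20 H2] := key _ c2 (fun x h => congr1 (@complex.Im R) (p0 x h)).
by exists (K1 + K2) => [|x]; rewrite ?addr_ge0// (le_trans (cabs_le _))// lerD.
Qed.

Lemma fourier_primitive_exists phi T z : smooth_upto 0 phi -> (forall x, T < `|x| -> phi x = 0) ->
  exists G, (forall x, is_cderive G x (phi x * echar (- x) z)) /\ (forall x, x < - T -> G x = 0).
Proof.
move=> sp p0; apply: cprimitive_exists; last by move=> x /p0 ->; rewrite mul0r.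
apply: (@smooth_upto_continuous _ 0); apply: smooth_uptoM => //.
by rewrite (_ : (fun x => _) = fun x => echar x (- z)); [exact: smooth_upto_echar|apply/funext => x; exact: echarN].
Qed.

(** The transform becomes the final value of a primitive vanishing on the left. Identities and
    bounds for transforms are then obtained by differentiating primitives instead of manipulating
    integrals. *)
Lemma fourier_primitive phi T G z x : 0 < T -> smooth_upto 0 phi ->
  (forall x, T < `|x| -> phi x = 0) ->
  (forall x, is_cderive G x (phi x * echar (- x) z)) -> (forall x, x < - T -> G x = 0) ->
  T < x -> G x = fourier phi z.
Proof.
move=> T0 sp p0 dG G0 Tx.
have cg : ccontinuous (fun x => phi x * echar (- x) z).
  apply: (@smooth_upto_continuous _ 0); apply: smooth_uptoM => //.
  by rewrite (_ : (fun x => _) = fun x => echar x (- z)); [exact: smooth_upto_echar|apply/funext => t; exact: echarN].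
have g0 t : T < `|t| -> phi t * echar (- t) z = 0 by move=> /p0 ->; rewrite mul0r.
have := cintegral_FTC2 dG cg g0 (ltW Tx) (lt_trans T0 Tx).
rewrite (G0 (- x)) ?ltrN2// subr0 => <-.
by rewrite /fourier; congr (cintegral_wrt _ _ _); apply/funext => t; rewrite echar_fourier.
Qed.

Lemma fourier_derivative phi phi' T z : 0 < T -> smooth_upto 0 phi -> smooth_upto 0 phi' ->
  (forall x, is_cderive phi x (phi' x)) -> (forall x, T < `|x| -> phi x = 0) ->
  fourier phi' z = (2 * pi)%:C * 'i%C * z * fourier phi z.
Proof.
move=> T0 sp sp' dp p0.
have p0' x : T < `|x| -> phi' x = 0 by move=> Tx; exact: is_cderive_supp Tx p0 (dp x).
have [G [dG G0]] := fourier_primitive_exists z sp p0.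
have [G' [dG' G0']] := fourier_primitive_exists z sp' p0'.
have TT : T < T + 1 by rewrite ltrDl.
rewrite -(fourier_primitive T0 sp p0 dG G0 TT) -(fourier_primitive T0 sp' p0' dG' G0' TT).
(* Integration by parts in differential form: [H] has derivative 0 and vanishes to the left of the
   support. *)
pose H x := phi x * echar x (- z) - G' x + (2 * pi)%:C * 'i%C * z * G x.
have dH x : is_cderive H x 0.
  apply: is_cderive_eq.
    apply: is_cderiveD; last by apply: is_cderiveM; [exact: is_cderive_cst|exact: dG].
    by apply: is_cderiveB (dG' x); apply: is_cderiveM (dp x) (is_cderive_echar _ _).
  by rewrite /= !echarN; ring.
have := cderive0_eq (T + 1) (- (T + 1)) dH.
have T1 : - (T + 1) < - T by rewrite ltrN2.
rewrite /H (G0 _ T1) (G0' _ T1) !p0 ?normrN; [|rewrite gtr0_norm// addr_gt0//..].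
rewrite !mul0r mulr0 !sub0r oppr0 addr0 => /eqP.
by rewrite addrC subr_eq0 => /eqP.
Qed.

(** Each differentiation gains a factor [2 pi z], of which [2 pi >= 1] is discarded. Uniformity on a
    horizontal strip, and not just on the line, is what the atoms require. *)
Lemma fourier_decay n phi T (s : R) : 0 < T -> smooth_upto n phi ->
  (forall x, T < `|x| -> phi x = 0) ->
  exists2 C : R, 0 <= C & forall z, `|complex.Im z| <= s -> cabs z ^+ n * cabs (fourier phi z) <= C.
Proof.
move=> T0; elim: n phi => [|n IH] phi sp p0.
  have [K K0 HK] := bounded_support T0 (smooth_upto_continuous sp) p0.
  pose S := T + 1; have S0 : 0 < S by rewrite addr_gt0.
  exists (4 * S * (K * expR (2 * pi * S * `|s|))).
    by rewrite !mulr_ge0 ?expR_ge0// ltW.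
  move=> z zs; rewrite expr0 mul1r.
  have [G [dG G0]] := fourier_primitive_exists z sp p0.
  have TS : T < S by rewrite ltrDl.
  rewrite -(fourier_primitive T0 sp p0 dG G0 TS) -[G S]subr0 -(G0 (- S)) ?ltrN2//.
  pose M := K * expR (2 * pi * S * `|s|).
  have := @cderive_le G _ (fun x => M * x) (fun=> M) (- S) S _ dG _ _.
  rewrite (_ : 2 * _ = 4 * S * M); last by ring.
  apply.
  - lra.
  - by move=> t; exact: is_derive_linear.
  - move=> t /andP[t1 t2]; rewrite cabsM /M; apply: ler_pM; rewrite ?cabs_ge0//.
    rewrite cabs_echar ler_expR.
    have p20 : 0 <= 2 * pi :> R by rewrite mulr_ge0// pi_ge0.
    have ts : t * complex.Im z <= S * `|s|.
      rewrite (le_trans (ler_norm _))// normrM; apply: ler_pM => //.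
        by rewrite ler_norml t1 t2.
      by rewrite (le_trans zs)// ler_norm.
    have := ler_wpM2l p20 ts; rewrite mulrN mulNr opprK !mulrA; lra.
case: (sp) => phi' dp sp'.
have p0' x : T < `|x| -> phi' x = 0 by move=> Tx; exact: is_cderive_supp Tx p0 (dp x).
have [C C0 HC] := IH phi' sp' p0'.
exists C => // z zs; have := HC z zs.
have s0 m f : smooth_upto m f -> smooth_upto 0 f by elim: m => // m I /smooth_uptoS.
rewrite (fourier_derivative z T0 (s0 _ _ sp) (s0 _ _ sp') dp p0) !cabsM cabs_i mulr1.
rewrite cabs_pos ?mulr_ge0 ?pi_ge0// => h; apply: le_trans h; rewrite exprSr.
have p1 : 1 <= 2 * pi :> R by have := pi_ge2 R; lra.
rewrite [leRHS](_ : _ = 2 * pi * (cabs z ^+ n * cabs z * cabs (fourier phi z))); last by ring.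
by rewrite ler_peMl// !mulr_ge0 ?exprn_ge0 ?cabs_ge0.
Qed.

Lemma echar_scale s z : echar s z = echar 1 (s%:C * z).
Proof. by rewrite /echar; congr cexp; ring. Qed.

Lemma echar_sub1 w : cabs w <= 1 -> cabs (echar 1 w - 1) <= cabs w * expR (2 * pi).
Proof.
move=> w1; have := @echar_taylor R 1 w 1 1 ler01 ltr01 w1.
by rewrite big_ord1 /echar_coef !expr0 fact0 invr1 !mulr1 expr1 divr1.
Qed.

(** Gives the continuity of the transform on the line, hence its measurability. *)
Lemma fourier_lipschitz phi T : 0 < T -> smooth_upto 0 phi -> (forall x, T < `|x| -> phi x = 0) ->
  exists2 C : R, 0 <= C & forall t u : R, `|t - u| * (T + 1) <= 1 ->
    cabs (fourier phi t%:C - fourier phi u%:C) <= C * `|t - u|.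
Proof.
move=> T0 sp p0; have [K K0 HK] := bounded_support T0 (smooth_upto_continuous sp) p0.
pose S := T + 1; have S0 : 0 < S by rewrite addr_gt0.
have TS : T < S by rewrite ltrDl.
exists (4 * S * (K * (S * expR (2 * pi)))).
  by rewrite !mulr_ge0 ?expR_ge0 ?(ltW S0).
move=> t u tu.
have [G [dG G0]] := fourier_primitive_exists t%:C sp p0.
have [H [dH H0]] := fourier_primitive_exists u%:C sp p0.
rewrite -(fourier_primitive T0 sp p0 dG G0 TS) -(fourier_primitive T0 sp p0 dH H0 TS).
pose M := K * (S * expR (2 * pi)) * `|t - u|.
have := @cderive_le (fun x => G x - H x) _ (fun x => M * x) (fun=> M) (- S) S _
  (fun x => is_cderiveB (dG x) (dH x)) _ _.
rewrite (_ : 2 * _ = 4 * S * (K * (S * expR (2 * pi))) * `|t - u|); last by rewrite /M; ring.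
rewrite (G0 (- S)) ?(H0 (- S)) ?ltrN2// !subr0; apply.
- lra.
- by move=> x; exact: is_derive_linear.
move=> x /andP[x1 x2]; rewrite -mulrBr cabsM /M -mulrA; apply: ler_pM; rewrite ?cabs_ge0//.
have c1 : cabs (echar (- x) u%:C) = 1 by rewrite cabs_echar /= mulr0 oppr0 expR0.
rewrite (_ : echar (- x) t%:C - _ = echar (- x) u%:C * (echar (- x) (t - u)%:C - 1)); last first.
  rewrite mulrBr mulr1 -echarDr; congr (echar _ _ - _).
  by rewrite -rmorphD /=; congr (_%:C); ring.
rewrite cabsM c1 mul1r echar_scale.
have xS : `|x| <= S by rewrite ler_norml x1 x2.
have xt : cabs ((- x)%:C * (t - u)%:C) <= S * `|t - u|.
  by rewrite cabsM !cabs_real normrN ler_wpM2r.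
apply: le_trans (echar_sub1 _) _; first by rewrite (le_trans xt)// mulrC.
by rewrite mulrAC ler_wpM2r ?expR_ge0.
Qed.

Lemma measurable_fourier phi T : 0 < T -> smooth_upto 0 phi -> (forall x, T < `|x| -> phi x = 0) ->
  cmeasurable_fun [set: measurableTypeR R] (fun t : measurableTypeR R => fourier phi t%:C).
Proof.
move=> T0 sp p0; have [C C0 HC] := fourier_lipschitz T0 sp p0.
have key (p : R[i] -> R) : (forall z w, `|p z - p w| <= cabs (z - w)) ->
    measurable_fun [set: measurableTypeR R] (fun t : measurableTypeR R => p (fourier phi t%:C)).
  move=> pl; apply: continuous_measurable_fun => t; apply/cvgrPdist_le => e e0.
  apply/nbhs_ballP; exists (Num.min (T + 1)^-1 (e / (C + 1))).
    by rewrite /= lt_min invr_gt0 addr_gt0//= divr_gt0// ltr_wpDl.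
  move=> u; rewrite /ball/= lt_min => /andP[h1 h2].
  apply: (le_trans (pl _ _)); apply: le_trans (HC _ _ _) _.
    by move: h1 => /ltW; rewrite -(ler_pM2r (x := T + 1)) ?addr_gt0// mulVf// gt_eqF// addr_gt0.
  move: h2; rewrite ltr_pdivlMr; last by rewrite ltr_wpDl.
  by have := normr_ge0 (t - u); nra.
split; apply: key => z w.
  by rewrite -cReN -cReD Re_le_cabs.
by rewrite -cImN -cImD Im_le_cabs.
Qed.

End FourierCompact.

(** * Smoothed step functions and their transforms *)

Section BumpFourier.
Variables (R : realType) (e : R) (p P : R -> R).
Hypothesis e0 : 0 < e.

Definition bump_pair : Prop :=
  [/\ (forall n, smooth_upto n (fun x => (p x)%:C)),
      (forall x : R, is_derive x 1 P (p x)),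
      (forall x, e < `|x| -> p x = 0),
      (forall x, 0 <= p x /\ p (- x) = p x) &
      [/\ (forall x, x < - e -> P x = 0), (forall x, e < x -> P x = 1) & P 0 = 2^-1]].

Hypothesis pP : bump_pair.
Implicit Types (z w : R[i]) (x : R).

Let phi : R -> R[i] := fun x => (p x)%:C.

Let sphi n : smooth_upto n phi. Proof. by case: pP. Qed.

Let phi0 x : e < `|x| -> phi x = 0.
Proof. by case: pP => _ _ h _ _ /h; rewrite /phi => ->. Qed.

Definition bump_fourier z : R[i] := fourier phi z.

(** With this twisted primitive, [f(x) = echar x z * theta z x] solves [f' = 2 pi i z f + p], which
    is why its transform at [w] is that of [p] divided by [2 pi i (w - z)]. Smoothing the step by
    [p] alone would put the transform of [p] at [w - z] in the numerator, whereas interpolation in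
    [z] needs a factor independent of [z]. *)
Definition theta z : R -> R[i] := sval (cid (fourier_primitive_exists z (sphi 0) phi0)).

Lemma theta_deriv z x : is_cderive (theta z) x ((p x)%:C * echar (- x) z).
Proof. by rewrite /theta; case: cid => G /= []. Qed.

Lemma theta_left z x : x < - e -> theta z x = 0.
Proof. by rewrite /theta; case: cid => G /= [_ h] /h. Qed.

Lemma theta_right z x : e < x -> theta z x = bump_fourier z.
Proof.
by apply: (fourier_primitive e0 (sphi 0) phi0 (theta_deriv z)); exact: theta_left.
Qed.

Lemma bump_primitive_mono x y : x <= y -> P x <= P y.
Proof.
case: pP => _ dP _ p0 _ xy; have [|c _ E] := @MVT_segment R P p x y xy (fun t _ => dP t).
  by apply: derivable_within_continuous => t _; apply: ex_derive.
by rewrite -subr_ge0 E mulr_ge0 ?subr_ge0//; case: (p0 c).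
Qed.

Lemma bump_primitive01 x : 0 <= P x <= 1.
Proof.
case: (pP) => _ _ _ _ [P0 P1 _].
have h1 := bump_primitive_mono (_ : Num.min x (- e - 1) <= x).
have h2 := bump_primitive_mono (_ : x <= Num.max x (e + 1)).
apply/andP; split.
  rewrite -(P0 (Num.min x (- e - 1))); first by apply: h1; rewrite ge_min lexx.
  by rewrite gt_min; apply/orP; right; lra.
rewrite -(P1 (Num.max x (e + 1))); first by apply: h2; rewrite le_max lexx.
by rewrite lt_max; apply/orP; right; lra.
Qed.

Lemma theta_bound z x : cabs (theta z x) <= 2 * expR (2 * pi * e * `|complex.Im z|).
Proof.
set K := expR _; have K0 : 0 <= K by exact: expR_ge0.
have [xe|xe] := ltP x (- e); first by rewrite theta_left// cabs0 mulr_ge0.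
case: (pP) => _ dP p0 pe [P0 _ _].
have xx : - e - 1 <= x by lra.
have := @cderive_le R (theta z) _ (fun t => K * P t) (fun t => K * p t) (- e - 1) x xx
  (theta_deriv z).
rewrite (theta_left z (_ : - e - 1 < - e)); last by lra.
rewrite (P0 (- e - 1)); last by lra.
rewrite subr0 mulr0 subr0 => H.
have {}H : cabs (theta z x) <= 2 * (K * P x).
  apply: H => t.
  move=> _; rewrite cabsM cabs_pos; last by case: (pe t).
  rewrite mulrC; have [te|te] := ltP e `|t|; first by rewrite p0// !mulr0.
  rewrite ler_wpM2r//; first by case: (pe t).
  rewrite cabs_echar ler_expR.
  have p20 : 0 <= 2 * pi :> R by rewrite mulr_ge0// pi_ge0.
  have ts : t * complex.Im z <= e * `|complex.Im z|.
    by rewrite (le_trans (ler_norm _))// normrM ler_wpM2r.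
  have := ler_wpM2l p20 ts; rewrite mulrN mulNr opprK !mulrA; lra.
apply: (le_trans H); rewrite ler_wpM2l//.
by have /andP[] := bump_primitive01 x; nra.
Qed.

Lemma bump_fourier_bound z : cabs (bump_fourier z) <= 2 * expR (2 * pi * e * `|complex.Im z|).
Proof. by rewrite -(@theta_right z (e + 1)) ?theta_bound// ltrDl. Qed.

(** On the support of the bump the character is close to 1. The estimate is applied at [x = 0],
    where [P] is 1/2, and to the right of the support, where [theta] is the transform of the
    bump. *)
Lemma theta_approx z x : e * cabs z <= 1 ->
  cabs (theta z x - (P x)%:C) <= 2 * (e * cabs z * expR (2 * pi)).
Proof.
move=> ez; set K := _ * expR _; have K0 : 0 <= K by rewrite !mulr_ge0 ?expR_ge0 ?cabs_ge0// ltW.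
case: (pP) => _ dP p0 pe [P0 _ _].
have [xe|xe] := ltP x (- e).
  by rewrite theta_left// P0// rmorph0 subr0 cabs0 mulr_ge0.
have xx : - e - 1 <= x by lra.
have dPC (t : R) : is_cderive (fun t => (P t)%:C : R[i]) t (p t)%:C.
  by split => /=; [exact: dP|exact: is_derive_cst].
have := @cderive_le R (fun t => theta z t - (P t)%:C) _ (fun t => K * P t) (fun t => K * p t)
  (- e - 1) x xx (fun t => is_cderiveB (theta_deriv z t) (dPC t)).
rewrite (theta_left z (_ : - e - 1 < - e)); last by lra.
rewrite (P0 (- e - 1)); last by lra.
rewrite rmorph0 !subr0 mulr0 subr0 => H.
have {}H : cabs (theta z x - (P x)%:C) <= 2 * (K * P x).
  apply: H => t.
  move=> _; rewrite -[X in _ - X]mulr1 -mulrBr cabsM cabs_pos; last by case: (pe t).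
  rewrite mulrC; have [te|te] := ltP e `|t|; first by rewrite p0// !mulr0.
  rewrite ler_wpM2r//; first by case: (pe t).
  rewrite echar_scale; have tz : cabs ((- t)%:C * z) <= e * cabs z.
    by rewrite cabsM cabs_real normrN ler_wpM2r ?cabs_ge0.
  apply: (le_trans (echar_sub1 (le_trans tz ez))).
  by rewrite /K ler_wpM2r ?expR_ge0.
apply: (le_trans H); rewrite ler_wpM2l//.
by have /andP[] := bump_primitive01 x; nra.
Qed.

Lemma bump_fourier_approx z : e * cabs z <= 1 ->
  cabs (bump_fourier z - 1) <= 2 * (e * cabs z * expR (2 * pi)).
Proof.
move=> ez; have ee : e < e + 1 by rewrite ltrDl.
have := theta_approx (e + 1) ez; rewrite (theta_right z ee).
by case: pP => _ _ _ _ [_ /(_ _ ee) -> _]; rewrite rmorph1.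
Qed.

(** As [p] is real and even, the conjugate of [theta] at the conjugate point and the reflected
    function [theta z (- t)] have opposite derivatives; their constant sum is compared on both sides
    of the support. *)
Lemma bump_fourier_conj z : (bump_fourier z^*%C)^*%C = bump_fourier z.
Proof.
case: (pP) => _ _ _ pe _.
have ee : e < e + 1 by rewrite ltrDl.
have em : - (e + 1) < - e by rewrite ltrN2.
have dJ (f : R -> R[i]) x d : is_cderive f x d -> is_cderive (fun t => (f t)^*%C) x d^*%C.
  move=> [h1 h2]; split.
    by under eq_fun do rewrite cReJ; rewrite cReJ.
  by under eq_fun do rewrite cImJ; rewrite cImJ; exact: is_deriveN.
have dH x : is_cderive (fun t => (theta z^*%C t)^*%C + theta z (0 + (-1) * t)) x 0.
  apply: is_cderive_eq.
    apply: is_cderiveD; first exact: dJ (theta_deriv _ _).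
    exact: is_cderive_comp_affine (theta_deriv _ _).
  rewrite add0r mulN1r (pe x).2 opprK conjcM conjc_real echarJ conjcK opprK.
  by rewrite rmorphN rmorph1 mulN1r; apply: subrr.
have := cderive0_eq (e + 1) (- (e + 1)) dH.
rewrite !add0r !mulN1r opprK !(theta_left _ em) (theta_right _ ee) (theta_right _ ee).
by rewrite addr0 conjc0 add0r.
Qed.

Lemma bump_fourier_temper k s : exists2 C : R, 0 <= C & forall z, `|complex.Im z| <= s ->
  cabs (bump_fourier z) <= C * temper (2 * k.+1) z.
Proof.
have [C C0 HC] := fourier_decay s e0 (sphi (2 * k.+1)) phi0.
have [B B0 HB] := fourier_decay s e0 (sphi 0) phi0.
exists (2 ^+ k.+1 * (B + C)); first by rewrite mulr_ge0 ?exprn_ge0 ?addr_ge0.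
move=> z zs; rewrite temperE ler_pdivlMr; last first.
  by rewrite exprn_gt0// ltr_wpDr// sqr_ge0.
have h1 := HC z zs; have h2 := HB z zs; rewrite expr0 mul1r in h2.
rewrite -/(bump_fourier z) in h1 h2.
have f0 := cabs_ge0 (bump_fourier z).
(* With [x = |z|^2], the inequality [(1 + x)^(k+1) <= 2^(k+1) (1 + x^(k+1))] reduces the bound to
   decay of orders 0 and [2k + 2]. *)
apply: (@le_trans _ _ (cabs (bump_fourier z) * (2 ^+ k.+1 * (1 + cabs z ^+ (2 * k.+1))))).
  rewrite ler_wpM2l// exprM; set x := cabs z ^+ 2.
  have x0 : 0 <= x by rewrite sqr_ge0.
  have [x1|x1] := leP x 1.
    apply: (@le_trans _ _ (2 ^+ k.+1)).
      have a1 : 1 + x <= 2 by lra.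
      have a2 : 0 <= 1 + x by lra.
      by apply: lerXn2r; rewrite ?nnegrE.
    by rewrite ler_peMr ?exprn_ge0// lerDl exprn_ge0.
  apply: (@le_trans _ _ ((2 * x) ^+ k.+1)).
    have a1 : 1 + x <= 2 * x by lra.
    have a2 : 0 <= 1 + x by lra.
    have a3 : 0 <= 2 * x by lra.
    by apply: lerXn2r; rewrite ?nnegrE.
  by rewrite exprMn ler_wpM2l ?exprn_ge0// lerDr.
rewrite mulrCA ler_wpM2l ?exprn_ge0// mulrDr mulr1 lerD//.
by rewrite mulrC.
Qed.

Lemma measurable_bump_fourier :
  cmeasurable_fun [set: measurableTypeR R] (fun t : measurableTypeR R => bump_fourier t%:C).
Proof. exact: (measurable_fourier e0 (sphi 0) phi0). Qed.

(* The test functions exhausting the one-sided exponential: their Fourier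
   transform is that of the bump times a truncated Cauchy kernel. *)
Definition chi z (X : R) (l : R) : R[i] := echar l z * (theta z l - theta z (l - X)).

Lemma chi_smooth z X n : smooth_upto n (chi z X).
Proof.
have st m : smooth_upto m (theta z).
  case: m => [|m]; first by exists (fun x => (p x)%:C * echar (- x) z) => //; exact: theta_deriv.
  apply: smooth_upto_prim (theta_deriv z) _; apply: smooth_uptoM; first exact: sphi.
  by rewrite (_ : (fun x => _) = fun x => echar x (- z)); [exact: smooth_upto_echar|apply/funext => x; exact: echarN].
apply: smooth_uptoM; first exact: smooth_upto_echar.
rewrite (_ : (fun x => _) = fun x => theta z x + (- 1) * theta z (x - X)).
  apply: smooth_uptoD => //; apply: smooth_uptoM; first exact: smooth_upto_cst.
  exact: smooth_upto_shift.
by apply/funext => x; rewrite mulN1r.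
Qed.

Lemma chi_supp z X l : 0 <= X -> X + e < `|l| -> chi z X l = 0.
Proof.
move=> X0; rewrite ltr_normr /chi => /orP[h|h].
  by rewrite !theta_right ?subrr ?mulr0//; lra.
by rewrite !theta_left ?subrr ?mulr0//; lra.
Qed.

Lemma chi_test z X : 0 <= X -> test_function (chi z X).
Proof.
move=> X0; have [h1 h2] := csmooth_smooth (chi_smooth z X); split => //.
by exists (X + e) => l; exact: chi_supp.
Qed.

Lemma fourier_chi z w X : 0 <= X -> z != w ->
  fourier (chi z X) w =
  bump_fourier w * (echar X (z - w) - 1) / ((2 * pi)%:C * 'i%C * (z - w)).
Proof.
move=> X0.
have hl s : s < - (X + e) -> s < - e /\ s - X < - e.
  by move=> h; split; move: h X0 e0; lra.
have [h1 h2] : e < X + e + 1 /\ e < X + e + 1 - X by split; move: X0; lra.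
move=> zw; set ka := (2 * pi)%:C * 'i%C * (z - w).
have ka0 : ka != 0.
  rewrite /ka !mulf_neq0 ?subr_eq0//.
    by rewrite -cabs_gt0 cabs_pos ?mulr_ge0 ?pi_ge0// mulr_gt0 ?pi_gt0.
  by rewrite -cabs_gt0 cabs_i.
(* A primitive of [echar s (z - w) * theta z s], found by integration by parts; [chi] combines it
   with its translate by [X]. *)
pose q s := (echar s (z - w) * theta z s - theta w s) / ka.
have dq s : is_cderive q s (echar s (z - w) * theta z s).
  apply: is_cderive_eq.
    apply: is_cderiveM; last exact: is_cderive_cst.
    apply: is_cderiveB (theta_deriv w s).
    exact: is_cderiveM (is_cderive_echar _ _) (theta_deriv z s).
  rewrite -/ka mulr0 addr0.
  have -> : echar s (z - w) * ((p s)%:C * echar (- s) z) = (p s)%:C * echar (- s) w.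
    rewrite echarDr -(echarN s w) -[RHS]mulr1 -(echarK s z); ring.
  by rewrite addrK mulrAC; field.
pose G s := q s - echar X (z - w) * q (s - X).
have dG s : is_cderive G s (chi z X s * echar (- s) w).
  apply: is_cderive_eq.
    apply: is_cderiveB (dq s) _; apply: is_cderiveM (is_cderive_cst _ _) _.
    exact: (is_cderive_shift (dq (s - X))).
  rewrite mul0r add0r mulrA -echarDl /chi (_ : X + (s - X) = s); last by rewrite addrC subrK.
  by rewrite echarDr -(echarN s w); ring.
have XT : 0 < X + e by rewrite ltr_wpDl.
have G0 s : s < - (X + e) -> G s = 0.
  move=> /hl[l1 l2].
  by rewrite /G /q !(theta_left _ l1) !(theta_left _ l2) !(mulr0, subr0, mul0r).
have Xs : X + e < X + e + 1 by rewrite ltrDl.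
rewrite -(fourier_primitive XT (chi_smooth z X 0) (fun l => @chi_supp z X l X0) dG G0 Xs).
rewrite /G /q !(theta_right _ h1) !(theta_right _ h2).
have -> : echar (X + e + 1) (z - w) = echar X (z - w) * echar (X + e + 1 - X) (z - w).
  by rewrite -echarDl (addrC X (X + e + 1 - X)) subrK.
by rewrite mulrA -mulrBl; congr (_ / _); ring.
Qed.

End BumpFourier.

(** * The summation formula off the strip *)

Section Representation.
Variables (R : realType) (k : nat) (sigma : R) (mu : strip_measure R) (a : R -> R[i]) (alpha : R).
Hypothesis fs : FS_pair sigma mu a.
Hypothesis ra : real_antipodal mu a.
Hypothesis rs : R_symmetric mu.
Hypothesis tmu : tempered_at mu (2 * k.+1).
Hypothesis arate : exponential_growth_rate a alpha.
Implicit Types (z w : R[i]) (l : R).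

Let tau := @tau R k.

(** Above this level [z] lies both outside the strip and in the half-plane of absolute
    convergence. *)
Definition height : R := Num.max sigma alpha.

Lemma height_gt0 : 0 < height.
Proof. by rewrite /height lt_max (alpha_gt0 arate) orbT. Qed.

Lemma in_support_strip w : in_support mu w -> `|complex.Im w| <= sigma.
Proof.
case: fs => _ _ [s0 As] _; case=> [->|/As/ltW//]; by rewrite normr0.
Qed.

Lemma cabs_2pi : cabs ((2 * pi)%:C * 'i%C : R[i]) = 2 * pi.
Proof. by rewrite cabsM cabs_i mulr1 cabs_pos// mulr_ge0// pi_ge0. Qed.

Lemma twopii_neq0 : (2 * pi)%:C * 'i%C != 0 :> R[i].
Proof. by rewrite -cabs_gt0 cabs_2pi mulr_gt0// pi_gt0. Qed.

Section OneBump.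
Variables (e : R) (p P : R -> R).
Hypothesis e0 : 0 < e.
Hypothesis pP : bump_pair e p P.

Local Notation bF := (bump_fourier p).
Let th := theta pP.

Definition cauchy_kernel z w : R[i] := bF w / ((2 * pi)%:C * 'i%C * (w - z)).

Lemma cmeasurable_real_id : cmeasurable_fun [set: measurableTypeR R] (fun t : measurableTypeR R => t%:C : R[i]).
Proof. by split => //=; exact: measurable_cst. Qed.

Lemma tame_cauchy_kernel z : sigma < `|complex.Im z| -> tame k mu (cauchy_kernel z).
Proof.
move=> sz; split.
  apply: cmeasurableM; first exact: (measurable_bump_fourier e0 pP).
  apply: cmeasurableV; apply: cmeasurableM; first exact: cmeasurable_cst.
  by apply: cmeasurableB; [exact: cmeasurable_real_id|exact: cmeasurable_cst].
have [C C0 HC] := bump_fourier_temper e0 pP k sigma.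
exists (C / (2 * pi * (`|complex.Im z| - sigma))).
  by rewrite divr_ge0// !mulr_ge0 ?pi_ge0// subr_ge0 ltW.
move=> w sw; have wi := in_support_strip sw.
rewrite /cauchy_kernel cabs_div cabsM cabs_2pi [leRHS]mulrAC.
have d0 : 0 < `|complex.Im z| - sigma by rewrite subr_gt0.
have dw : `|complex.Im z| - sigma <= cabs (w - z).
  apply: le_trans (Im_le_cabs _); rewrite cImD cImN distrC.
  by apply: le_trans (lerB_dist _ _); rewrite lerD2l lerN2.
apply: ler_pM; rewrite ?cabs_ge0 ?invr_ge0 ?mulr_ge0 ?pi_ge0 ?cabs_ge0//; first exact: HC.
have w0 : 0 < cabs (w - z) by exact: lt_le_trans d0 dw.
by rewrite lef_pV2 ?posrE ?mulr_gt0 ?pi_gt0// ler_pM2l// mulr_gt0 ?pi_gt0.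
Qed.

(** For [l] in [[-e, 0]] the smoothed step may be nonzero although [exp(-2 pi l y)] is at least 1;
    the constant factor pays for this interval. *)
Let growth_exp y l : alpha < y -> - e <= l ->
  expR (- (2 * pi * l * y)) <= expR (2 * pi * e * y + alpha * e) * expR (- (alpha * `|l|)).
Proof.
move=> ay el; rewrite -expRD ler_expR.
have p2 := pi_ge2 R; have al := alpha_gt0 arate.
have p20 : 0 <= pi - 2 :> R by lra.
have y0 : 0 < y by exact: lt_trans al ay.
have [l0|l0] := leP 0 l.
  rewrite ger0_norm//.
  have h1 : alpha * l <= y * l by rewrite ler_wpM2r// ltW.
  have h2 : 0 <= y * l by rewrite mulr_ge0// ltW.
  have h3 : 0 <= 2 * pi * e * y by rewrite !mulr_ge0 ?pi_ge0// ltW.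
  have h4 : 0 <= alpha * e by rewrite mulr_ge0 ?ltW.
  have h5 : 1 * (y * l) <= 2 * pi * (y * l) by rewrite ler_wpM2r//; lra.
  have -> : 2 * pi * l * y = 2 * pi * (y * l) by ring.
  lra.
rewrite ltr0_norm//.
have h1 : 0 <= alpha * (e + l) by rewrite mulr_ge0 ?(ltW al)//; lra.
have h2 : 0 <= 2 * pi * y * (e + l) by rewrite !mulr_ge0 ?pi_ge0 ?(ltW y0)//; lra.
have -> : 2 * pi * l * y = 2 * pi * y * l by ring.
have -> : 2 * pi * e * y = 2 * pi * y * e by ring.
by lra.
Qed.

Let dom z : R := expR (2 * pi * e * complex.Im z + alpha * e) * (2 * expR (2 * pi * e * `|complex.Im z|)).

Lemma theta_term_le z l : alpha < complex.Im z ->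
  cabs (a l * (echar l z * th z l)) <= dom z * growth_weight a alpha l.
Proof.
move=> az; rewrite /dom /growth_weight.
have [le_|le_] := ltP l (- e).
  by rewrite /th (theta_left pP)// !mulr0 cabs0 !mulr_ge0 ?expR_ge0 ?cabs_ge0.
rewrite cabsM [leRHS]mulrCA ler_wpM2l ?cabs_ge0// cabsM mulrAC.
apply: ler_pM; rewrite ?cabs_ge0//; last exact: (theta_bound pP).
by rewrite cabs_echar growth_exp.
Qed.

Lemma chi_term_le z l (X : R) : 0 <= X -> alpha < complex.Im z ->
  cabs (a l * chi pP z X l) <= 2 * dom z * growth_weight a alpha l.
Proof.
move=> X0 az; rewrite /dom /growth_weight /chi.
have [le_|le_] := ltP l (- e).
  rewrite !(theta_left pP) ?subrr ?mulr0 ?cabs0 ?mulr_ge0 ?expR_ge0 ?cabs_ge0//.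
  by rewrite (le_lt_trans _ le_)// gerBl.
rewrite cabsM [leRHS]mulrCA ler_wpM2l ?cabs_ge0// cabsM.
rewrite [leRHS](_ : _ = expR (2 * pi * e * complex.Im z + alpha * e) * expR (- (alpha * `|l|)) *
   (2 * expR (2 * pi * e * `|complex.Im z|) + 2 * expR (2 * pi * e * `|complex.Im z|))); last by ring.
apply: ler_pM; rewrite ?cabs_ge0//; first by rewrite cabs_echar growth_exp.
by apply: (le_trans (cabsB _ _)); apply: lerD; exact: (theta_bound pP).
Qed.

Lemma growth_summable (f : R -> R[i]) (C : R) : 0 <= C ->
  (forall l, cabs (f l) <= C * growth_weight a alpha l) -> csummable setT f.
Proof.
move=> C0 fC; apply: (@csummable_dom _ R _ _ (fun l => C * growth_weight a alpha l)) => //.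
apply: esum_scale_lty => //; last exact: (growth_weight_lty arate).
exact: growth_weight_ge0.
Qed.

Lemma dom_ge0 z : 0 <= dom z.
Proof. by rewrite !mulr_ge0 ?expR_ge0. Qed.

(** The summation formula is applied to the test functions [chi] with [X = n]. In the sum over
    frequencies dominated convergence removes the truncation; on the side of [mu] the factor
    [echar n (z - w)] tends to 0 because [z] lies above the strip. *)
Lemma theta_sum z : height < complex.Im z ->
  csum setT (fun l => a l * (echar l z * th z l)) = pairing mu (cauchy_kernel z).
Proof.
rewrite gt_max => /andP[sz az].
have z0 : 0 < complex.Im z by exact: lt_trans (alpha_gt0 arate) az.
have sz' : sigma < `|complex.Im z| by rewrite gtr0_norm.
have md (D : set (discrete_space R)) f : cmeasurable_fun D (f : discrete_space R -> R[i]).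
  by split; exact: measurable_fun_discrete.
have L : ccvg (fun n => csum setT (fun l => a l * chi pP z n%:R l))
   (csum setT (fun l => a l * (echar l z * th z l))).
  rewrite (@csum_cint _ R); last by apply: growth_summable (dom_ge0 z) _ => l; exact: theta_term_le.
  under eq_fun => n.
    rewrite (@csum_cint _ R); last first.
      apply: (@growth_summable _ (2 * dom z)); first by rewrite mulr_ge0 ?dom_ge0.
      by move=> l; exact: chi_term_le.
    over.
  apply: (@cint_cvg _ _ _ (count_measure R R) _ (measurable_discrete _) _ _
    (fun l => 2 * dom z * growth_weight a alpha l)) => //.
  (* For fixed [l] the sequence is eventually constant, once [l - n] has passed to the left of the
     bump. *)
  - move=> l _; apply: ccvgMl; rewrite /chi; apply: ccvgMl.
    apply: (ccvg_near _ (ccvg_cst _)); exists (Num.truncn (l + e)).+1 => // n /= ln.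
    have : l + e < n%:R by rewrite (lt_le_trans (truncnS_gt _))// ler_nat.
    by move=> h; rewrite (@theta_left _ _ _ _ pP z (l - n%:R)) ?subr0//; lra.
  - exact: (integrableZl (measurable_discrete _) (2 * dom z) (growth_weight_integrable arate _)).
  - by move=> n l _; exact: chi_term_le.
have zw w : in_support mu w -> z != w.
  move=> /in_support_strip wi; apply: contraTneq sz => ->; rewrite -leNgt.
  by rewrite (le_trans (ler_norm _)).
pose f n w := (echar n%:R (z - w) - 1) * (- cauchy_kernel z w).
have E n : csum setT (fun l => a l * chi pP z n%:R l) = pairing mu (f n).
  case: fs => _ _ _ /(_ _ (chi_test e0 pP z (ler0n R n))) ->.
  apply: eq_pairing => w sw; rewrite (fourier_chi e0 pP (ler0n R n) (zw _ sw)).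
  rewrite /f /cauchy_kernel -(opprB z w) (mulrN ((2 * pi)%:C * 'i%C)) invrN.
  by rewrite (mulrN (bF w)) opprK -/(bF w); ring.
have tK := tame_cauchy_kernel sz'.
have [mK [C C0 HC]] := tK.
have ce n w : in_support mu w -> cabs (echar n%:R (z - w)) = expR (- (2 * pi * (complex.Im z - complex.Im w))) ^+ n.
  by move=> _; rewrite cabs_echar cImD cImN -expRM_natl; congr expR; ring.
have q01 w : in_support mu w -> 0 <= expR (- (2 * pi * (complex.Im z - complex.Im w))) < 1.
  move=> /in_support_strip wi; rewrite expR_ge0 /= -expR0 ltr_expR oppr_lt0 mulr_gt0 ?mulr_gt0 ?pi_gt0//.
  by rewrite subr_gt0 (le_lt_trans (ler_norm _))// (le_lt_trans wi).
apply: (ccvg_unique L); under eq_fun do rewrite E.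
apply: (@pairing_cvg _ k mu tmu _ _ (2 * C)) => //.
- by rewrite mulr_ge0.
- move=> n; rewrite /f; apply: cmeasurableM; last exact: cmeasurableN.
  apply: cmeasurableB; last exact: cmeasurable_cst.
  have me : cmeasurable_fun [set: measurableTypeR R] (fun t : measurableTypeR R => echar t (n%:R%:C : R[i])).
    have [c1 c2] := smooth_upto_continuous (smooth_upto_echar 0 ((n%:R)%:C : R[i])).
    by split; [exact: (continuous_measurable_fun c1)|exact: (continuous_measurable_fun c2)].
  (* The character is symmetric in two real arguments, which turns measurability in the second into
     continuity in the first. *)
  rewrite (_ : (fun t => _) = fun t : R => echar n%:R z * (echar t (n%:R)%:C)^-1).
    by apply: cmeasurableM; [exact: cmeasurable_cst|exact: cmeasurableV].
  apply/funext => t; rewrite echarDr; congr (_ * _); apply: (mulIf (echar_neq0 t (n%:R)%:C)).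
  rewrite mulVf ?echar_neq0// (_ : echar t (n%:R)%:C = echar n%:R t%:C).
    by rewrite -echarDr addNr echar0r.
  by rewrite /echar; congr cexp; ring.
- move=> w sw; rewrite /f -[X in ccvg _ X](_ : (0 - 1) * (- cauchy_kernel z w) = _); last by ring.
  apply: ccvgM (ccvg_cst _); apply: ccvgB (ccvg_cst _).
  apply: (@ccvg_squeeze _ _ _ (fun n => expR (- (2 * pi * (complex.Im z - complex.Im w))) ^+ n)).
    by apply: nearW => n; rewrite subr0 ce.
  by apply: cvg_expr; have /andP[q0 q1] := q01 w sw; rewrite ger0_norm.
- move=> n w sw; rewrite /f cabsM cabsN -mulrA; apply: ler_pM; rewrite ?cabs_ge0 ?HC//.
  rewrite (le_trans (cabsB _ _))// cabs1 ce// (_ : 2 = 1 + 1)// lerD2r.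
  by have /andP[q0 /ltW q1] := q01 w sw; exact: exprn_ile1.
Qed.

End OneBump.

End Representation.

(** * Removing the bump, and interpolation *)

Section RepresentationLimit.
Variables (R : realType) (k : nat) (sigma : R) (mu : strip_measure R) (a : R -> R[i]) (alpha : R).
Hypothesis fs : FS_pair sigma mu a.
Hypothesis ra : real_antipodal mu a.
Hypothesis rs : R_symmetric mu.
Hypothesis tmu : tempered_at mu (2 * k.+1).
Hypothesis arate : exponential_growth_rate a alpha.
Implicit Types (z w : R[i]) (l : R).

Let height := height sigma alpha.

Lemma cint_support (T : pointedType) (A : set T) (f : T -> R[i]) (B : set T) :
  B `<=` A -> (forall x, A x -> ~ B x -> f x = 0) ->
  cintT (count_measure R T) A f = cintT (count_measure R T) B f.
Proof.
move=> BA f0; rewrite /cintT; congr (_ +i* _);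
  rewrite Rintegral_mkcond [RHS]Rintegral_mkcond; apply: eq_Rintegral => x _;
  rewrite !patchE; case: ifPn => xA; case: ifPn => xB //.
- by rewrite f0//; [rewrite inE in xA|move=> h; rewrite (mem_set h) in xB].
- by rewrite notin_setE in xA; rewrite inE in xB; have := BA _ xB.
- by rewrite f0//; [rewrite inE in xA|move=> h; rewrite (mem_set h) in xB].
- by rewrite notin_setE in xA; rewrite inE in xB; have := BA _ xB.
Qed.

Variables (p_ P_ : nat -> R -> R).
Hypothesis bp : forall n, bump_pair n.+1%:R^-1 (p_ n) (P_ n).

Let eps (n : nat) : R := n.+1%:R^-1.

Let eps0 n : 0 < eps n. Proof. by rewrite invr_gt0. Qed.
Let eps1 n : eps n <= 1. Proof. by rewrite invf_le1// ler1n. Qed.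

Let eps_cvg : eps @ \oo --> (0 : R).
Proof. exact: cvg_harmonic. Qed.

Let eps_lt (x : R) : 0 < x -> \forall n \near \oo, eps n < x.
Proof.
move=> x0; have /cvgrPdist_lt/(_ _ x0) := eps_cvg; apply: filterS => n.
by rewrite sub0r normrN gtr0_norm.
Qed.

Let approx_cvg z : (fun n => 2 * (eps n * cabs z * expR (2 * pi))) @ \oo --> (0 : R).
Proof.
rewrite -(mulr0 2) -(mul0r (expR (2 * pi))) -(mul0r (cabs z)).
by apply: cvgMr; apply: cvgMl; apply: cvgMl.
Qed.

Let eps_small z : \forall n \near \oo, eps n * cabs z <= 1.
Proof.
have h : 0 < (cabs z + 1)^-1 by rewrite invr_gt0 ltr_wpDl ?cabs_ge0.
apply: filterS (eps_lt h) => n /ltW hn.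
have z1 : 0 < cabs z + 1 by rewrite ltr_wpDl ?cabs_ge0.
apply: (@le_trans _ _ (eps n * (cabs z + 1))).
  by rewrite ler_wpM2l ?(ltW (eps0 n))// lerDl.
by rewrite -ler_pdivlMr// mul1r.
Qed.

Lemma bump_fourier_cvg z : ccvg (fun n => bump_fourier (p_ n) z) 1.
Proof.
apply: ccvg_squeeze (approx_cvg z); apply: filterS (eps_small z) => n h.
exact: (bump_fourier_approx (eps0 n) (bp n)).
Qed.

Lemma theta0_cvg z : ccvg (fun n => theta (bp n) z 0) (2^-1).
Proof.
apply: ccvg_squeeze (approx_cvg z); apply: filterS (eps_small z) => n h.
have := theta_approx (eps0 n) (bp n) 0 h.
have -> : P_ n 0 = 2^-1 by case: (bp n) => _ _ _ _ [].
by rewrite fmorphV rmorph_nat.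
Qed.

(** Three cases for the smoothed step: for [l > 0] it is eventually [bump_fourier], which tends to
    1; for [l < 0] it is eventually 0; at [l = 0] it tends to 1/2. *)
Lemma theta_sum_cvg z : alpha < complex.Im z ->
  ccvg (fun n => csum setT (fun l => a l * (echar l z * theta (bp n) z l))) (dirichlet_series a z).
Proof.
move=> az.
have z0 : 0 < complex.Im z by exact: lt_trans (alpha_gt0 arate) az.
(* The majorant of [theta_term_le] with the width [e] replaced by 1, hence uniform in the bump. *)
pose K : R := expR (2 * pi * complex.Im z + alpha) * (2 * expR (2 * pi * `|complex.Im z|)).
have p2 := pi_ge2 R; have al := alpha_gt0 arate.
have p20 : 0 <= 2 * pi :> R by rewrite mulr_ge0// pi_ge0.
have bnd n l : cabs (a l * (echar l z * theta (bp n) z l)) <= K * growth_weight a alpha l.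
  apply: le_trans (theta_term_le arate (eps0 n) (bp n) l az) _.
  rewrite ler_wpM2r ?growth_weight_ge0//; apply: ler_pM; rewrite ?mulr_ge0 ?expR_ge0//.
    rewrite ler_expR lerD//.
      by rewrite -mulrA ler_wpM2l// ler_piMl// ltW.
    by rewrite ler_piMr// ltW.
  rewrite ler_wpM2l// ler_expR ler_wpM2r//.
  by rewrite ler_piMr.
have K0 : 0 <= K by rewrite !mulr_ge0 ?expR_ge0.
have md (D : set (discrete_space R)) f : cmeasurable_fun D (f : discrete_space R -> R[i]).
  by split; exact: measurable_fun_discrete.
pose L l : R[i] := if 0 < l then a l * echar l z else if l == 0 then a 0 / 2 else 0.
have LE : cintT (count_measure R R) setT L = dirichlet_series a z.
  have iL : cintegrableT (count_measure R R) setT L.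
    apply: (@csummable_cintegrable _ R); apply: (growth_summable arate K0) => l.
    have K1 : 1 <= K.
      have e1 : 1 <= expR (2 * pi * complex.Im z + alpha).
        rewrite -{1}expR0 ler_expR; apply: addr_ge0; last exact: ltW.
        exact: (mulr_ge0 p20 (ltW z0)).
      have e2 : 1 <= expR (2 * pi * `|complex.Im z|) by rewrite -{1}expR0 ler_expR mulr_ge0.
      by rewrite /K; nra.
    have gK : growth_weight a alpha l <= K * growth_weight a alpha l.
      by rewrite ler_peMl// growth_weight_ge0.
    rewrite /L; case: ifPn => l0.
      apply: le_trans gK; have := dirichlet_term_le arate l0 (_ : alpha <= complex.Im z - 0) (lexx 0).
      by rewrite subr0 !(mulr0, mul0r) expR0 mulr1; apply; exact: ltW.
    case: ifPn => [/eqP l00|_]; last by rewrite cabs0 mulr_ge0 ?growth_weight_ge0.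
    apply: le_trans gK; rewrite l00 /growth_weight normr0 mulr0 oppr0 expR0 mulr1 cabs_div.
    rewrite (_ : cabs 2 = 2); last by rewrite -(rmorph_nat (real_complex R)) cabs_pos.
    by rewrite ler_pdivrMr// ler_peMr ?cabs_ge0// ler1n.
  rewrite (cint_setD1 (p := 0) iL)// (dirichlet_seriesE arate)//; congr (_ + _).
    by rewrite /L ltxx eqxx.
  transitivity (cintT (count_measure R R) [set l | 0 < l] L).
    apply: (@cint_support R).
    - by move=> l /= l0; split => //; apply/eqP; rewrite gt_eqF.
    - by move=> l [_ /eqP l0] /negP l1; rewrite /L (negbTE l1) (negbTE l0).
  by apply: eq_cint => l /= l0; rewrite /L l0.
rewrite -LE; under eq_fun => n.
  rewrite (@csum_cint _ R); last by apply: (growth_summable arate K0) => l; exact: bnd.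
  over.
apply: (@cint_cvg _ _ _ (count_measure R R) _ (measurable_discrete _) _ _
    (fun l => K * growth_weight a alpha l)) => //; last 1 first.
  exact: (integrableZl (measurable_discrete _) K (growth_weight_integrable arate _)).
move=> l _; rewrite /L.
have [l0|l0|<-] := ltgtP 0 l.
- rewrite -[X in ccvg _ X]mulr1; apply: ccvg_near (ccvgMl (a l * echar l z) (bump_fourier_cvg z)).
  by apply: filterS (eps_lt l0) => n h; rewrite (theta_right (eps0 n) (bp n))// mulrA.
- have l0' : 0 < - l by rewrite oppr_gt0.
  apply: (ccvg_near _ (ccvg_cst (0 : R[i]))); apply: filterS (eps_lt l0') => n h.
  by rewrite (theta_left (bp n)) ?mulr0// ltrNr.
- apply: ccvg_near (ccvgMl (a 0) (theta0_cvg z)).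
  by apply: nearW => n; rewrite echar0l mul1r.
Qed.

Definition dirichlet_ext z : R[i] :=
  if 0 < complex.Im z then dirichlet_series a z else - (dirichlet_series a z^*%C)^*%C.

(** Below the strip the formula is conjugated: the factor [i] of the Cauchy kernel changes sign,
    whence the minus sign in [dirichlet_ext]. *)
Lemma rep_cvg z : height < `|complex.Im z| ->
  ccvg (fun n => pairing mu (cauchy_kernel (p_ n) z)) (dirichlet_ext z).
Proof.
move=> hz; rewrite /dirichlet_ext; have [z0|z0] := ltP 0 (complex.Im z).
  rewrite gtr0_norm// in hz.
  have az : alpha < complex.Im z by apply: le_lt_trans hz; rewrite le_max lexx orbT.
  apply: ccvg_near (theta_sum_cvg az); apply: nearW => n.
  by rewrite (theta_sum fs tmu arate (eps0 n)).
have hzJ : height < complex.Im z^*%C by rewrite cImJ -(ler0_norm z0).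
have az : alpha < complex.Im z^*%C by apply: le_lt_trans hzJ; rewrite le_max lexx orbT.
apply: ccvg_near (ccvgN (ccvgJ (theta_sum_cvg az))); apply: nearW => n.
rewrite (theta_sum fs tmu arate (eps0 n))//.
have tK : tame k mu (cauchy_kernel (p_ n) z^*%C).
  apply: (tame_cauchy_kernel k fs (eps0 n) (bp n)).
  by rewrite (lt_le_trans _ (ler_norm _))// (le_lt_trans _ hzJ)// le_max lexx.
rewrite -(pairing_conj tmu ra.1 rs tK).
have -> : (fun w => (cauchy_kernel (p_ n) z^*%C w^*%C)^*%C) = fun w => - 1 * cauchy_kernel (p_ n) z w.
  apply/funext => w; rewrite /cauchy_kernel mulN1r.
  rewrite conjcM (bump_fourier_conj (eps0 n) (bp n)) conjc_inv !conjcM conjcB !conjcK conjc_real.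
  rewrite conjc_i.
  by rewrite mulrN mulNr invrN mulrN.
rewrite (pairingZ tmu) ?mulN1r ?opprK//.
apply: (tame_cauchy_kernel k fs (eps0 n) (bp n)).
by rewrite ler0_norm// -cImJ (le_lt_trans _ hzJ)// le_max lexx.
Qed.

(** The hypothesis on [g] says that its interpolation error equals that of the Cauchy kernel. This
    error pairs absolutely with [mu], so its product with [bump_fourier] has a pairing whose limit
    is computed twice: by dominated convergence, and by [rep_cvg] at [z] and at the nodes. *)
Lemma interpolation (g : R[i] -> R[i] -> R[i]) z m (x c : 'I_m -> R[i]) :
  height < `|complex.Im z| -> (forall j, height < `|complex.Im (x j)|) ->
  tame k mu (g z) -> (forall j, tame k mu (g (x j))) ->
  (forall w, in_support mu w -> g z w - \sum_(j < m) c j * g (x j) w =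
     (w - z)^-1 - \sum_(j < m) c j * (w - x j)^-1) ->
  let M y := pairing mu (g y) / ((2 * pi)%:C * 'i%C) in
  dirichlet_ext z - M z = \sum_(j < m) c j * (dirichlet_ext (x j) - M (x j)).
Proof.
move=> hz hx tz tx E M.
pose G w := (g z w - \sum_(j < m) c j * g (x j) w) / ((2 * pi)%:C * 'i%C).
have tG : tame k mu G.
  rewrite /G; under eq_fun do rewrite mulrC; apply: tameZ; apply: tameB => //.
  by apply: tame_sum => j; exact: tameZ.
have hs y : height < `|complex.Im y| -> sigma < `|complex.Im y|.
  by apply: le_lt_trans; rewrite le_max lexx.
have tc n y : height < `|complex.Im y| -> tame k mu (cauchy_kernel (p_ n) y).
  by move=> hy; apply: (tame_cauchy_kernel k fs (eps0 n) (bp n)); exact: hs.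
have L1 : ccvg (fun n => pairing mu (fun w => bump_fourier (p_ n) w * G w)) (pairing mu G).
  case: (tG) => mG [C C0 HC].
  apply: (@pairing_cvg _ k mu tmu _ _ (2 * expR (2 * pi * `|sigma|) * C)) => //.
  - by rewrite !mulr_ge0 ?expR_ge0.
  - by move=> n; apply: cmeasurableM => //; exact: (measurable_bump_fourier (eps0 n) (bp n)).
  - by move=> w sw; rewrite -[X in ccvg _ X]mul1r; apply: ccvgM (bump_fourier_cvg w) (ccvg_cst _).
  - move=> n w sw; rewrite cabsM -[X in _ <= X]mulrA; apply: ler_pM; rewrite ?cabs_ge0 ?HC//.
    apply: (le_trans (bump_fourier_bound (eps0 n) (bp n) w)).
    rewrite ler_wpM2l// ler_expR -mulrA ler_wpM2l ?mulr_ge0 ?pi_ge0//.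
    have wi := in_support_strip fs sw.
    apply: (@le_trans _ _ `|complex.Im w|); first by rewrite ler_piMl// eps1.
    exact: le_trans wi (ler_norm _).
have L2 : ccvg (fun n => pairing mu (fun w => bump_fourier (p_ n) w * G w))
    (dirichlet_ext z - \sum_(j < m) c j * dirichlet_ext (x j)).
  apply: ccvg_near (ccvgB (rep_cvg hz) (ccvg_sum (fun j => ccvgMl (c j) (rep_cvg (hx j))))).
  apply: nearW => n; rewrite -(pairing_sum tmu); last by move=> j; exact: tc.
  rewrite -(pairingB tmu); last 2 first.
  - exact: tc.
  - by apply: tame_sum => j; apply: tameZ; exact: tc.
  apply: eq_pairing => w sw; rewrite /G E// /cauchy_kernel.
  have BE (b A S t : R[i]) : b * ((A - S) * t) = b * t * A - b * t * S by ring.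
  rewrite BE mulr_sumr invfM mulrA; congr (_ - _).
  by apply: eq_bigr => j _; rewrite invfM; ring.
have := ccvg_unique L2 L1.
have -> : pairing mu G = M z - \sum_(j < m) c j * M (x j).
  rewrite /M /G; under eq_fun do rewrite mulrC.
  rewrite (pairingZ tmu); last by apply: tameB => //; apply: tame_sum => j; exact: tameZ.
  rewrite (pairingB tmu)//; last by apply: tame_sum => j; exact: tameZ.
  rewrite (pairing_sum tmu)// mulrBr mulr_sumr mulrC; congr (_ - _).
  by apply: eq_bigr => j _; ring.
under [in X in _ -> X]eq_bigr do rewrite mulrBr.
rewrite sumrB => H; rewrite -[dirichlet_ext z](subrK (\sum_(j < m) c j * dirichlet_ext (x j))) H; ring.
Qed.

End RepresentationLimit.

(** * The line term and the atoms term *)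

Section KernelIntegral.
Variables (R : realType) (d : measure_display) (T : measurableType d).
Variables (m : {measure set T -> \bar R}) (D : set T).
Hypothesis mD : measurable D.
Variables (k : nat) (s r : R) (ga W : T -> R[i]).
Hypotheses (sr : s < r) (r0 : 0 < r).
Hypotheses (mga : cmeasurable_fun D ga) (mW : cmeasurable_fun D W).
Hypothesis gas : forall t, D t -> `|complex.Im (ga t)| <= s.
Hypothesis iW : m.-integrable D (EFin \o (fun t => cabs (W t) * temper (2 * k.+1) (ga t))).
Implicit Types (z p : R[i]).

Let den t := (r ^+ 2)%:C + ga t ^+ 2.

Let mden : cmeasurable_fun D den.
Proof. by apply: cmeasurableD => //; exact: cmeasurableX. Qed.

Lemma measurable_strip_kernel z : cmeasurable_fun D (fun t => strip_kernel k r (ga t) z).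
Proof.
rewrite /strip_kernel; apply: cmeasurableM => //; last first.
  by apply: cmeasurableV => //; exact: cmeasurableX.
apply: cmeasurableM => //; last first.
  by apply: cmeasurableV => //; apply: cmeasurableB => //; exact: cmeasurable_cst.
apply: cmeasurableD => //.
by apply: cmeasurableM => //; exact: cmeasurable_cst.
Qed.

Lemma strip_kernel_integrable z e : 0 < e -> (forall t, D t -> e <= cabs (ga t - z)) ->
  cintegrableT m D (fun t => W t * strip_kernel k r (ga t) z).
Proof.
move=> e0 ge; have [B B0 HB] := kernel_bounds k z sr r0 e0.
apply: (@cintegrable_dom _ _ _ _ _ mD _ (fun t => B * (cabs (W t) * temper (2 * k.+1) (ga t)))).
- by apply: cmeasurableM => //; exact: measurable_strip_kernel.
- exact: (integrableZl mD B iW).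
- move=> t Dt; rewrite cabsM mulrCA ler_wpM2l ?cabs_ge0//.
  by case: (HB _ (gas Dt) (ge _ Dt)).
Qed.

Lemma strip_kernel_canalytic p e : 0 < e -> (forall t, D t -> e <= cabs (ga t - p)) ->
  canalytic (fun z => cintT m D (fun t => W t * strip_kernel k r (ga t) z)) p.
Proof.
move=> e0 ge; have [B B0 HB] := kernel_bounds k p sr r0 e0.
(* Before division by the common power, the kernels at [z] and [p] differ by
   [(z - p) (r^2 + g^2) / ((g - z) (g - p))]; the variable part is thus [z - p] times a Cauchy
   integral with density [V]. *)
pose V t := W t * (den t / den t ^+ k.+1) / (ga t - p).
have gap0 t : D t -> ga t - p != 0.
  by move=> Dt; rewrite -cabs_gt0 (lt_le_trans e0 (ge _ Dt)).
have mV : cmeasurable_fun D V.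
  apply: cmeasurableM => //; last first.
    by apply: cmeasurableV => //; apply: cmeasurableB => //; exact: cmeasurable_cst.
  by do 2 apply: cmeasurableM => //; apply: cmeasurableV => //; exact: cmeasurableX.
have iB := integrableZl mD B iW.
have Vb t : D t ->
    cabs (V t) <= B * (cabs (W t) * temper (2 * k.+1) (ga t)) * cabs (ga t - p).
  move=> Dt; have [_] := HB _ (gas Dt) (ge _ Dt).
  have g0 : 0 < cabs (ga t - p) by rewrite cabs_gt0 gap0.
  rewrite -/(den t) => h; rewrite /V cabs_div ler_pdivrMr // cabsM.
  apply: le_trans (ler_wpM2l (cabs_ge0 (W t)) h) _; rewrite le_eqVlt; apply/orP; left.
  by apply/eqP; ring.
have ca := cauchy_canalytic mD e0 ge mga mV iB Vb.
have e20 : 0 < e / 2 by rewrite divr_gt0.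
apply: (canalytic_near e20 _ (canalyticD
   (canalytic_cst (cintT m D (fun t => W t * strip_kernel k r (ga t) p)) p)
   (canalytic_mulXsub ca))) => z zp.
have gz t : D t -> e / 2 <= cabs (ga t - z).
  move=> Dt; have := cabs_distl (ga t - p) (z - p); rewrite (_ : _ - _ - _ = ga t - z); last by ring.
  have := ge _ Dt; lra.
have gaz0 t : D t -> ga t - z != 0.
  by move=> Dt; rewrite -cabs_gt0 (lt_le_trans e20 (gz _ Dt)).
have iV : cintegrableT m D (fun t => V t / (ga t - z)).
  apply: (@cintegrable_dom _ _ _ _ _ mD _ (fun t => 2 * (B * (cabs (W t) * temper (2 * k.+1) (ga t))))).
  - apply: cmeasurableM => //.
    by apply: cmeasurableV => //; apply: cmeasurableB => //; exact: cmeasurable_cst.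
  - exact: (integrableZl mD 2 iB).
  - move=> t Dt; rewrite cabs_div ler_pdivrMr ?cabs_gt0 ?gaz0//.
    apply: le_trans (Vb _ Dt) _; rewrite [X in _ <= X]mulrAC [X in _ <= X]mulrC.
    apply: ler_wpM2l; first by rewrite !mulr_ge0 ?cabs_ge0 ?temper_ge0.
    have := cabs_distl (ga t - z) (p - z); rewrite (_ : _ - _ - _ = ga t - p); last by ring.
    have := cabsD (ga t - z) (z - p); rewrite (_ : _ + _ = ga t - p); last by ring.
    have := gz _ Dt; lra.
rewrite -cintZ// -cintD//; last 2 first.
- exact: strip_kernel_integrable e0 ge.
- exact: cintegrableT_Z.
apply: eq_cint => t Dt; rewrite /V /strip_kernel -/(den t).
have := gap0 _ Dt; have := gaz0 _ Dt; rewrite -/(den t).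
have -> : (r ^+ 2)%:C = den t - ga t ^+ 2 by rewrite /den addrK.
move: (den t) => Dn h1 h2; move: (Dn ^+ k.+1)^-1 => X; field.
by rewrite h1 h2.
Qed.

End KernelIntegral.

Section KernelTerms.
Variables (R : realType) (k : nat) (sigma : R) (mu : strip_measure R).
Hypothesis adm : admissible mu.
Hypothesis strip : supported_on_strip sigma mu.
Hypothesis tmu : tempered_at mu (2 * k.+1).
Local Notation BR := (measurableTypeR R).
Local Notation nu := (cvariation (line_part mu)).
Local Notation h := (cphase (line_part mu)).
Local Notation A := (atoms mu).
Local Notation b := (weight mu).
Implicit Types (z p w : R[i]).

(** A nonreal point is no limit point of the atoms, and its distance to the line is at least
    [|Im p|]. An atom at [p] itself is left out, as [p] may be a pole. *)
Lemma support_gap p : complex.Im p != 0 ->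
  exists2 d : R, 0 < d & forall w, in_support mu w -> w != p -> d <= cabs (w - p).
Proof.
move=> p0; have [_ _ /(_ p) lim] := adm.
have : ~ limit_point (A : set R[i]^o) p by move=> /lim p1; rewrite p1 eqxx in p0.
move=> /existsNP[U /not_implyP[/nbhs_cabsP[d d0 dU] nex]].
have q0 : 0 < `|complex.Im p| by rewrite normr_gt0.
exists (Num.min d `|complex.Im p|); first by rewrite lt_min d0.
move=> w [w0|Aw] wp.
  rewrite ge_min; apply/orP; right; apply: le_trans (Im_le_cabs _).
  by rewrite cImD cImN w0 sub0r normrN.
rewrite ge_min leNgt; apply/orP; left; apply/negP => dw; apply: nex.
by exists w; split => //; apply: dU.
Qed.

Lemma line_kernelE z t : line_kernel k z t = strip_kernel k 1 t%:C z.
Proof.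
rewrite /line_kernel /strip_kernel expr1n; congr (_ / _).
by rewrite rmorphXn rmorphD rmorphXn rmorph1.
Qed.

Lemma atom_termE rho z g : atom_term mu k rho z g = b g * strip_kernel k rho g z.
Proof. by rewrite /atom_term /strip_kernel; ring. Qed.

Lemma line_gap p t : `|complex.Im p| <= cabs (t%:C - p).
Proof. by apply: le_trans (Im_le_cabs _); rewrite cImD cImN/= sub0r normrN. Qed.

Section Density.
Variable W : R -> R[i].
Hypothesis mW : cmeasurable_fun [set: BR] (W : BR -> R[i]).
Hypothesis W1 : forall t, cabs (W t) <= 1.

Let iW : nu.-integrable setT (EFin \o (fun t : BR => cabs (W t) * temper (2 * k.+1) t%:C)).
Proof.
apply: (le_integrable measurableT _ _ (tau_line_integrable tmu)).
  apply/measurable_EFinP; apply: measurable_funM; first exact: cmeasurable_cabs.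
  exact: measurable_temper.
move=> t _; rewrite lee_fin !ger0_norm ?mulr_ge0 ?cabs_ge0 ?temper_ge0//.
by rewrite ler_piMl ?temper_ge0.
Qed.

(** The weight [W] will be the phase itself, or the positive or negative part of its real part. *)
Lemma line_density_integrable z : complex.Im z != 0 ->
  cintegrableT nu setT (fun t : BR => W t * strip_kernel k 1 t%:C z).
Proof.
move=> z0; have e0 : 0 < `|complex.Im z| by rewrite normr_gt0.
apply: (strip_kernel_integrable measurableT ltr01 ltr01 _ mW _ iW e0) => //.
- exact: cmeasurable_real_id.
- by move=> t _ /=; rewrite normr0.
- by move=> t _; exact: line_gap.
Qed.

Lemma line_density_canalytic p : complex.Im p != 0 ->
  canalytic (fun z => cintT nu setT (fun t : BR => W t * strip_kernel k 1 t%:C z)) p.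
Proof.
move=> p0; have e0 : 0 < `|complex.Im p| by rewrite normr_gt0.
apply: (strip_kernel_canalytic measurableT ltr01 ltr01 _ mW _ iW e0) => //.
- exact: cmeasurable_real_id.
- by move=> t _ /=; rewrite normr0.
- by move=> t _; exact: line_gap.
Qed.

End Density.

Let h1 t : cabs (h t) <= 1. Proof. by rewrite cabs_cphase. Qed.

Lemma line_kernel_integrable z : complex.Im z != 0 ->
  cintegrable (line_part mu) (line_kernel k z).
Proof.
move=> z0; apply: (cintegrableT_ext measurableT _
  (line_density_integrable (measurable_phase mu) h1 z0)) => t _.
by rewrite line_kernelE mulrC.
Qed.

Definition monic_factor (r : R) : {poly R[i]} := ('X ^+ 2 + ((r ^+ 2)%:C)%:P) ^+ k.

Lemma monic_factorE r z : (monic_factor r).[z] = (z ^+ 2 + (r ^+ 2)%:C) ^+ k.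
Proof. by rewrite /monic_factor horner_exp hornerD hornerXn hornerC. Qed.

Lemma line_termE z : line_term mu k z = (monic_factor 1).[z] / ((2 * pi)%:C * 'i%C) *
  cintT nu setT (fun t : BR => h t * strip_kernel k 1 t%:C z).
Proof.
rewrite /line_term monic_factorE expr1n; congr (_ * _).
by apply: eq_cint => t _; rewrite line_kernelE mulrC.
Qed.

Lemma line_term_canalytic p : complex.Im p != 0 -> canalytic (line_term mu k) p.
Proof.
move=> p0.
apply: (canalytic_near ltr01 _ (canalyticM_poly ((2 * pi)%:C * 'i%C)^-1%:P (canalyticM_poly (monic_factor 1)
  (line_density_canalytic (measurable_phase mu) h1 p0)))) => z _.
by rewrite line_termE hornerC mulrA [_^-1 * _]mulrC.
Qed.

Section Atoms.
Variable rho : R.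
Hypothesis srho : sigma < rho.

Let rho0 : 0 < rho. Proof. by case: strip => s0 _; exact: le_lt_trans srho. Qed.

Let As g : A g -> `|complex.Im g| <= sigma.
Proof. by case: strip => _ H /H /ltW. Qed.

Let mdisc (D : set R[i]^o) (f : R[i]^o -> R[i]) : cmeasurable_fun (D : set (discrete_space R[i]^o)) f.
Proof. by split; exact: measurable_fun_discrete. Qed.

Let iA (D : set R[i]) : D `<=` A -> (count_measure R R[i]^o).-integrable D
  (EFin \o (fun g => cabs (b g) * temper (2 * k.+1) g)).
Proof.
by move=> DA; apply: integrableS (tau_atoms_integrable tmu) => //; exact: measurable_discrete.
Qed.

Lemma atoms_integrable (D : set R[i]) z (e : R) : D `<=` A -> 0 < e ->
  (forall g, D g -> e <= cabs (g - z)) ->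
  cintegrableT (count_measure R R[i]^o) D (fun g => b g * strip_kernel k rho g z).
Proof.
move=> DA e0 ge; apply: (strip_kernel_integrable (measurable_discrete _) srho rho0 _ _ _ (iA DA) e0) => //.
by move=> g /DA; exact: As.
Qed.

Lemma atoms_canalytic (D : set R[i]) p (e : R) : D `<=` A -> 0 < e ->
  (forall g, D g -> e <= cabs (g - p)) ->
  canalytic (fun z => cintT (count_measure R R[i]^o) D (fun g => b g * strip_kernel k rho g z)) p.
Proof.
move=> DA e0 ge; apply: (strip_kernel_canalytic (measurable_discrete _) srho rho0 _ _ _ (iA DA) e0) => //.
by move=> g /DA; exact: As.
Qed.

End Atoms.

End KernelTerms.

Section StripKernelPairing.
Variables (R : realType) (k : nat) (sigma : R) (mu : strip_measure R).
Hypothesis adm : admissible mu.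
Hypothesis strip : supported_on_strip sigma mu.
Hypothesis tmu : tempered_at mu (2 * k.+1).
Local Notation BR := (measurableTypeR R).
Local Notation nu := (cvariation (line_part mu)).
Local Notation h := (cphase (line_part mu)).
Local Notation A := (atoms mu).
Local Notation b := (weight mu).
Implicit Types (z p w : R[i]).

(** One kernel serves both parts of [mu], with parameter 1 on the line and [rho] off it. As no atom
    is real, the imaginary part tells the two apart; with parameter 1 an atom at [i] would make the
    denominator vanish. *)
Definition radius (rho : R) w : R := if complex.Im w == 0 then 1 else rho.

Definition weighted_kernel rho z w : R[i] :=
  (monic_factor k (radius rho w)).[z] * strip_kernel k (radius rho w) w z.

Section Rho.
Variable rho : R.
Hypothesis srho : sigma < rho.

Let rho0 : 0 < rho. Proof. by case: strip => s0 _; exact: le_lt_trans srho. Qed.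

Let As g : A g -> `|complex.Im g| <= sigma.
Proof. by case: strip => _ H /H /ltW. Qed.

Let A0 g : A g -> (complex.Im g == 0) = false.
Proof. by case: adm => _ H _ /H /negbTE. Qed.

Lemma atoms_summable z : complex.Im z != 0 -> csummable A (atom_term mu k rho z).
Proof.
move=> z0; have [e e0 ge] := support_gap adm z0.
have [B B0 HB] := kernel_bounds k z srho rho0 e0.
apply: (@csummable_dom _ R[i]^o _ _ (fun g => B * (cabs (b g) * temper (2 * k.+1) g))).
  apply: (@esum_scale_lty _ _ _ (fun g => cabs (b g) * temper (2 * k.+1) g)) => //.
    by move=> x; rewrite mulr_ge0 ?cabs_ge0 ?temper_ge0.
  exact: tau_atoms_lt tmu.
move=> g Ag; rewrite atom_termE cabsM mulrCA ler_wpM2l ?cabs_ge0//.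
(* At an atom equal to [z] the division by zero gives the term the value 0, so summability holds at
   the poles as well. *)
have [->|gz] := eqVneq g z.
  by rewrite /strip_kernel subrr invr0 mulr0 mul0r cabs0 mulr_ge0 ?temper_ge0.
by case: (HB g (As Ag) (ge _ (or_intror Ag) gz)).
Qed.

Lemma atoms_termE z : complex.Im z != 0 ->
  atoms_term mu k rho z = (monic_factor k rho).[z] / ((2 * pi)%:C * 'i%C) *
  cintT (count_measure R R[i]^o) A (fun g => b g * strip_kernel k rho g z).
Proof.
move=> z0; rewrite /atoms_term monic_factorE; congr (_ * _).
rewrite (@csum_cint _ R[i]^o _ _ (atoms_summable z0)).
by apply: eq_cint => g _; exact: atom_termE.
Qed.

Lemma tame_weighted_kernel z : complex.Im z != 0 -> ~ A z ->
  tame k mu (weighted_kernel rho z).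
Proof.
move=> z0 Az; have [e e0 ge] := support_gap adm z0.
have gz w : in_support mu w -> e <= cabs (w - z).
  move=> sw; apply: ge => //; apply/eqP => wz; case: sw; rewrite wz//.
  by move/eqP; rewrite (negbTE z0).
split.
  under eq_fun do rewrite /weighted_kernel /radius eqxx.
  apply: cmeasurableM => //; apply: measurable_strip_kernel => //.
  exact: cmeasurable_real_id.
have [B B0 HB] := kernel_bounds k z srho rho0 e0.
have [B1 B10 HB1] := kernel_bounds k z (@ltr01 R) ltr01 e0.
exists (cabs (monic_factor k 1).[z] * B1 + cabs (monic_factor k rho).[z] * B).
  by rewrite addr_ge0// mulr_ge0 ?cabs_ge0.
move=> w sw; rewrite /weighted_kernel /radius cabsM mulrDl.
have [w0|w0] := boolP (complex.Im w == 0).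
  have w0' : `|complex.Im w| <= 0 by rewrite (eqP w0) normr0.
  rewrite ler_wpDr//; first by rewrite !mulr_ge0 ?cabs_ge0 ?temper_ge0.
  by rewrite -mulrA ler_wpM2l ?cabs_ge0//; case: (HB1 w w0' (gz _ sw)).
rewrite ler_wpDl//; first by rewrite !mulr_ge0 ?cabs_ge0 ?temper_ge0.
rewrite -mulrA ler_wpM2l ?cabs_ge0//; case: (HB w _ (gz _ sw)) => //.
by case: (sw) => [/eqP|/As //]; rewrite (negbTE w0).
Qed.

Lemma pairing_weighted_kernel z : complex.Im z != 0 -> ~ A z ->
  pairing mu (weighted_kernel rho z) / ((2 * pi)%:C * 'i%C) =
  line_term mu k z + atoms_term mu k rho z.
Proof.
move=> z0 Az; rewrite line_termE atoms_termE// (pairingE tmu (tame_weighted_kernel z0 Az)).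
rewrite mulrDl; congr (_ + _).
  rewrite mulrAC; congr (_ / _); rewrite -cintZ//; last first.
    by apply: (line_density_integrable tmu (measurable_phase mu) _ z0) => t; rewrite cabs_cphase.
  by apply: eq_cint => t _; rewrite /weighted_kernel /radius eqxx -mulrA [h t * _]mulrC.
rewrite mulrAC; congr (_ / _).
have [e e0 ge] := support_gap adm z0.
have IA : cintegrableT (count_measure R R[i]^o) A (fun g => b g * strip_kernel k rho g z).
  apply: (atoms_integrable strip tmu srho _ e0) => // g Ag; apply: ge; first by right.
  by apply/eqP => gz; apply: Az; rewrite -gz.
rewrite -(cintZ (measurable_discrete _) _ IA).
by apply: eq_cint => g Ag; rewrite /weighted_kernel /radius A0// mulrCA.
Qed.

Lemma weighted_kernel_difference w : in_support mu w ->
  exists2 q : {poly R[i]}, (size q <= (2 * k).+1)%N &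
    forall z, w != z -> weighted_kernel rho z w = (w - z)^-1 + q.[z].
Proof.
move=> sw; have d0 : ((radius rho w) ^+ 2)%:C + w ^+ 2 != 0.
  rewrite /radius; have [w0|w0] := boolP (complex.Im w == 0).
    by apply: (denominator_neq0 (@ltr01 R) ltr01); rewrite (eqP w0) normr0.
  apply: (denominator_neq0 srho rho0).
  by case: (sw) => [/eqP|/As //]; rewrite (negbTE w0).
have [q sq Hq] := kernel_difference k d0; exists q => // z wz.
by rewrite /weighted_kernel monic_factorE Hq.
Qed.

Lemma weighted_kernel_conj z w : weighted_kernel rho z^*%C w^*%C = (weighted_kernel rho z w)^*%C.
Proof.
rewrite /weighted_kernel !monic_factorE /strip_kernel.
have -> : radius rho w^*%C = radius rho w by rewrite /radius cImJ oppr_eq0.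
by rewrite !(conjcX, conjcB, conjcM, conjc_inv, conjcD, conjc_real).
Qed.

Lemma term_conj z : real_valued mu -> R_symmetric mu -> complex.Im z != 0 -> ~ A z ->
  line_term mu k z^*%C + atoms_term mu k rho z^*%C =
  - (line_term mu k z + atoms_term mu k rho z)^*%C.
Proof.
move=> rv rs z0 Az.
have z0' : complex.Im z^*%C != 0 by rewrite cImJ oppr_eq0.
have Az' : ~ A z^*%C by move=> /(rs.1 z).2.
rewrite -!pairing_weighted_kernel//.
have -> : weighted_kernel rho z^*%C = fun w => (weighted_kernel rho z w^*%C)^*%C.
  by apply/funext => w; rewrite -weighted_kernel_conj conjcK.
rewrite (pairing_conj tmu rv rs (tame_weighted_kernel z0 Az)).
rewrite conjcM conjc_inv conjcM conjc_real.
rewrite conjc_i.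
by rewrite mulrN invrN mulrN opprK.
Qed.

End Rho.

End StripKernelPairing.

Section RealPolynomials.
Variable R : realType.

(** Symmetrizing [E] under conjugation keeps the real parts of its coefficients. Where [E] is
    already symmetric, its value is therefore that of the real polynomial. *)
Lemma real_part_poly (E : {poly R[i]}) n : (size E <= n)%N ->
  exists2 Q : {poly R}, (size Q <= n)%N &
    forall z, 2 * real_poly_eval Q z = E.[z] + (E.[z^*%C])^*%C.
Proof.
move=> sE; exists (\poly_(j < n) complex.Re E`_j); first exact: size_poly.
move=> z; rewrite /real_poly_eval.
have -> : map_poly (real_complex R) (\poly_(j < n) complex.Re E`_j) =
    \poly_(j < n) (complex.Re E`_j)%:C.
  by apply/polyP => j; rewrite coef_map !coef_poly; case: ifP.
rewrite horner_poly (horner_coef_wide _ sE) (horner_coef_wide _ sE).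
rewrite conjc_sum mulr_sumr -big_split/=; apply: eq_bigr => j _.
rewrite conjcM conjcX conjcK -mulrDl mulrA; congr (_ * _).
by apply: complex_eqP; rewrite ?cReD ?cImD ?cReJ ?cImJ ?cReM ?cImM /=; ring.
Qed.

End RealPolynomials.

(** * The real polynomial and its dependence on the parameter *)

Section RepresentationPolynomial.
Variables (R : realType) (k : nat) (sigma : R) (mu : strip_measure R) (a : R -> R[i]) (alpha : R).
Hypothesis fs : FS_pair sigma mu a.
Hypothesis ra : real_antipodal mu a.
Hypothesis rs : R_symmetric mu.
Hypothesis tmu : tempered_at mu (2 * k.+1).
Hypothesis arate : exponential_growth_rate a alpha.
Local Notation A := (atoms mu).
Implicit Types (z p w : R[i]).

Let adm : admissible mu. Proof. by case: fs. Qed.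
Let strip : supported_on_strip sigma mu. Proof. by case: fs. Qed.

Let height := height sigma alpha.

(** Distinct points on the imaginary axis above [height]; the choice is otherwise arbitrary. *)
Let node (j : nat) : R[i] := 'i%C * (height + 1 + j%:R)%:C.

Let Im_node j : complex.Im (node j) = height + 1 + j%:R.
Proof. by rewrite /node cImM/= mul0r mul1r add0r. Qed.

Let node_inj : injective node.
Proof.
move=> i j /(congr1 (@complex.Im _)); rewrite !Im_node => /addrI/eqP.
by rewrite eqr_nat => /eqP.
Qed.

Let n := (2 * k).+1.

Let ell (j : 'I_n) : {poly R[i]} := tnth (n.-lagrange node) j.

Let ellE (p : {poly R[i]}) z : (size p <= n)%N -> p.[z] = \sum_(j < n) (ell j).[z] * p.[node j].
Proof.
move=> sp; rewrite {1}(lagrange_gen (ltn0Sn _) node_inj sp) horner_sum.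
by apply: eq_bigr => j _; rewrite hornerM hornerC mulrC.
Qed.

Let node_height j : height < complex.Im (node j).
Proof. by rewrite Im_node -addrA ltrDl ltr_pwDl. Qed.

Let high_neq0 z : height < `|complex.Im z| -> complex.Im z != 0.
Proof.
move=> hz; rewrite -normr_gt0; apply: lt_trans hz; exact: (height_gt0 sigma arate).
Qed.

Let high_atom z : height < `|complex.Im z| -> ~ A z.
Proof.
move=> hz Az; case: strip => _ /(_ z Az) h; have := lt_trans hz h.
by rewrite ltNge le_max lexx.
Qed.

Let high_support z w : height < `|complex.Im z| -> in_support mu w -> w != z.
Proof.
move=> hz sw; apply/eqP => wz; case: sw; rewrite wz; last exact: high_atom.
by move/eqP; rewrite (negbTE (high_neq0 hz)).
Qed.

Let node_norm j : height < `|complex.Im (node j)|.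
Proof. exact: lt_le_trans (node_height j) (ler_norm _). Qed.

Lemma representation rho : sigma < rho ->
  exists2 Q : {poly R}, (size Q <= (2 * k).+1)%N & forall z, height < complex.Im z ->
    dirichlet_series a z =
    line_term mu k z + 'i%C * real_poly_eval Q z + atoms_term mu k rho z.
Proof.
move=> srho.
have /choice[pP bp] : forall j : nat, exists pP : (R -> R) * (R -> R),
    bump_pair j.+1%:R^-1 pP.1 pP.2.
  move=> j; have [|p [P H]] := @bump_exists R j.+1%:R^-1; first by rewrite invr_gt0.
  by exists (p, P).
pose M z := line_term mu k z + atoms_term mu k rho z.
(* By [interpolation], [dirichlet_ext - M] agrees wherever [|Im z| > height] with its own
   interpolant at the nodes; [E] is that interpolant divided by [i]. *)
pose E : {poly R[i]} := \sum_(j < n) ((dirichlet_ext a (node j) - M (node j)) / 'i%C) *: ell j.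
have i0 : 'i%C != 0 :> R[i] by exact: neq0Ci.
have ext z : height < `|complex.Im z| -> dirichlet_ext a z - M z = 'i%C * E.[z].
  move=> hz; have tk y : height < `|complex.Im y| -> tame k mu (weighted_kernel k rho y).
    by move=> hy; exact: (tame_weighted_kernel k adm strip srho (high_neq0 hy) (high_atom hy)).
  have Mp y : height < `|complex.Im y| ->
      pairing mu (weighted_kernel k rho y) / ((2 * pi)%:C * 'i%C) = M y.
    by move=> hy; exact: (pairing_weighted_kernel adm strip tmu srho (high_neq0 hy) (high_atom hy)).
  have := interpolation fs ra rs tmu arate bp (g := weighted_kernel k rho) (z := z)
    (x := fun j : 'I_n => node j) (c := fun j => (ell j).[z]) hz (fun j => node_norm j)
    (tk _ hz) (fun j => tk _ (node_norm j)).
  rewrite /= Mp// => -> ; last first.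
    move=> w sw; have [q sq Hq] := weighted_kernel_difference k strip srho sw.
    rewrite Hq ?(high_support hz)// (ellE z sq) -addrA; congr (_ + _).
    rewrite -sumrB -sumrN; apply: eq_bigr => j _.
    by rewrite Hq ?(high_support (node_norm j))//; ring.
  rewrite /E horner_sum mulr_sumr; apply: eq_bigr => j _.
  by rewrite Mp// hornerZ mulrA mulrCA divff// mulr1 mulrC.
have sE : (size E <= n)%N.
  rewrite /E; apply: (leq_trans (size_sum _ _ _)); apply/bigmax_leqP => j _.
  by rewrite (leq_trans (size_scale_leq _ _))// size_lagrange_.
have [Q sQ HQ] := real_part_poly sE; exists Q => // z hz.
have z0 : 0 < complex.Im z by apply: lt_trans hz; exact: (height_gt0 sigma arate).
have hzn : height < `|complex.Im z| by rewrite gtr0_norm.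
have hzJ : height < `|complex.Im z^*%C| by rewrite cImJ normrN.
(* The formula is used at the conjugate point, below the strip: [dirichlet_ext] and [M] both acquire
   a minus sign under conjugation, which the factor [i] absorbs. *)
have EJ : (E.[z^*%C])^*%C = E.[z].
  have := ext _ hzJ; rewrite /M (term_conj adm strip tmu srho ra.1 rs (high_neq0 hzn) (high_atom hzn)).
  rewrite -/(M z).
  have -> : dirichlet_ext a z^*%C = - (dirichlet_ext a z)^*%C.
    by rewrite /dirichlet_ext z0 cImJ oppr_gt0 ltNge (ltW z0)/= conjcK.
  rewrite -opprD -conjcB ext// conjcM.
  rewrite conjc_i.
  by rewrite mulNr opprK => /(mulfI i0) <-; rewrite conjcK.
have QE : real_poly_eval Q z = E.[z].
  have /mulfI : 2 != 0 :> R[i] by rewrite pnatr_eq0.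
  by apply; rewrite HQ EJ -mulr2n mulr_natl.
rewrite QE -ext// {1}/dirichlet_ext z0 /M; ring.
Qed.

(** For each [w] the kernels with [rho] and [rho'] differ by a polynomial in [z] of degree at most
    [2k]. The difference of their pairings is thus determined, at every nonreal [z] that is no atom,
    by its values at the nodes, where both formulas give the Dirichlet series. No analytic
    continuation is involved. *)
Lemma representation_unique rho rho' (Q Q' : {poly R}) z : sigma < rho -> sigma < rho' ->
  (size Q <= n)%N -> (size Q' <= n)%N ->
  (forall z, height < complex.Im z -> dirichlet_series a z =
     line_term mu k z + 'i%C * real_poly_eval Q z + atoms_term mu k rho z) ->
  (forall z, height < complex.Im z -> dirichlet_series a z =
     line_term mu k z + 'i%C * real_poly_eval Q' z + atoms_term mu k rho' z) ->
  0 < complex.Im z -> ~ A z ->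
  line_term mu k z + 'i%C * real_poly_eval Q z + atoms_term mu k rho z =
  line_term mu k z + 'i%C * real_poly_eval Q' z + atoms_term mu k rho' z.
Proof.
move=> s1 s2 sQ sQ' H H' z0 Az.
have z00 : complex.Im z != 0 by rewrite gt_eqF.
pose M r z := line_term mu k z + atoms_term mu k r z.
pose d w y := weighted_kernel k rho y w - weighted_kernel k rho' y w.
have td y : complex.Im y != 0 -> ~ A y -> tame k mu (fun w => d w y).
  by move=> y0 Ay; apply: tameB; exact: (tame_weighted_kernel k adm strip).
have Md y : complex.Im y != 0 -> ~ A y ->
    pairing mu (fun w => d w y) / ((2 * pi)%:C * 'i%C) = M rho y - M rho' y.
  move=> y0 Ay; rewrite (pairingB tmu); try exact: (tame_weighted_kernel k adm strip).
  rewrite mulrBl; congr (_ - _).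
    exact: (pairing_weighted_kernel adm strip tmu s1 y0 Ay).
  exact: (pairing_weighted_kernel adm strip tmu s2 y0 Ay).
have dE : pairing mu (fun w => d w z) = \sum_(j < n) (ell j).[z] * pairing mu (fun w => d w (node j)).
  rewrite -(pairing_sum tmu); last first.
    by move=> j; apply: td; [exact: high_neq0|exact: high_atom].
  apply: eq_pairing => w sw.
  have [q sq Hq] := weighted_kernel_difference k strip s1 sw.
  have [q' sq' Hq'] := weighted_kernel_difference k strip s2 sw.
  have dq y : w != y -> d w y = (q - q').[y].
    by move=> wy; rewrite /d Hq// Hq'// hornerD hornerN; ring.
  have wz : w != z.
    by apply/eqP => wz; case: sw; rewrite wz// => /eqP; rewrite (negbTE z00).
  rewrite dq// ellE; last by rewrite (leq_trans (size_polyD _ _))// size_polyN geq_max sq.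
  by apply: eq_bigr => j _; rewrite dq// (high_support (node_norm j)).
pose P : {poly R[i]} := 'i%C *: (map_poly (real_complex R) Q' - map_poly (real_complex R) Q).
have PE y : P.[y] = 'i%C * real_poly_eval Q' y - 'i%C * real_poly_eval Q y.
  by rewrite /P hornerZ hornerD hornerN mulrBr.
have sP : (size P <= n)%N.
  rewrite (leq_trans (size_scale_leq _ _))// (leq_trans (size_polyD _ _))// size_polyN geq_max.
  by rewrite !size_map_poly sQ'.
have key : M rho z - M rho' z = P.[z].
  rewrite -Md// dE mulr_suml (ellE z sP); apply: eq_bigr => j _.
  rewrite -mulrA Md; [|exact: high_neq0|exact: high_atom]; congr (_ * _).
  have alg (L q q' u v : R[i]) : L + q + u = L + q' + v -> L + u - (L + v) = q' - q.
    move=> h; rewrite [LHS](_ : _ = L + q + u - (L + q + v)); last by ring.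
    by rewrite h; ring.
  rewrite PE; apply: alg.
  by rewrite -(H _ (node_height j)) -(H' _ (node_height j)).
have alg (L q q' u v : R[i]) : L + u - (L + v) = q' - q -> L + q + u = L + q' + v.
  move=> h; rewrite [LHS](_ : _ = L + u - (L + v) + (L + v + q)); last by ring.
  by rewrite h; ring.
by apply: alg; rewrite -PE -key.
Qed.

End RepresentationPolynomial.

(** * Nevanlinna functions *)

Section NegativeEigenvalues.
Variable R : realType.
Local Notation C := R[i].
Local Open Scope sesquilinear_scope.

Lemma char_poly_conj n (P D : 'M[C]_n) : P \in unitmx ->
  char_poly (invmx P *m D *m P) = char_poly D.
Proof.
move=> uP; rewrite /char_poly.
have -> : char_poly_mx (invmx P *m D *m P) =
    map_mx polyC (invmx P) *m char_poly_mx D *m map_mx polyC P.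
  rewrite /char_poly_mx mulmxBr mulmxBl -!map_mxM; congr (_ - _).
  by rewrite mul_mx_scalar -scalemxAl -map_mxM mulVmx// map_mx1 scalemx1.
by rewrite !det_mulmx mulrAC -det_mulmx -map_mxM mulVmx// map_mx1 det1 mul1r.
Qed.

Lemma num_negative_diag n (M P : 'M[C]_n) (d : 'rV[C]_n) : P \in unitmx ->
  M = invmx P *m diag_mx d *m P ->
  num_negative_eigenvalues M = #|[pred i | d 0 i < 0]|.
Proof.
move=> uP ->; rewrite /num_negative_eigenvalues.
case: closed_field_poly_normal => s /=.
rewrite (monicP (char_poly_monic _)) scale1r char_poly_conj//.
rewrite char_poly_trig ?diag_mx_is_trig// => E.
have {}E : perm_eq s [seq d 0 i | i <- enum 'I_n].
  apply: prod_XsubC_eq; rewrite -E big_map big_enum/=.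
  by apply: eq_bigr => i _; rewrite mxE eqxx mulr1n.
by rewrite (permP E) count_map enumT cardE /enum_mem size_filter.
Qed.

(* On the span of the eigenvectors of negative eigenvalues the form is negative
   definite; if there were more than [k] of them, a nonzero combination would
   be annihilated by [U]. *)
Lemma negative_eigenvalues_le n k (M : 'M[C]_n) (U : 'M[C]_(n, k)) : M \is hermsymmx ->
  (forall x : 'rV[C]_n, x *m U = 0 -> 0 <= (x *m M *m x ^t*) 0 0) ->
  (num_negative_eigenvalues M <= k)%N.
Proof.
move=> hM posM; set P := spectralmx M; set d := spectral_diag M.
have uP : P \is unitarymx := spectral_unitarymx M.
have ME : M = invmx P *m diag_mx d *m P by apply/orthomx_spectralP; exact: hermitian_normalmx.
rewrite (num_negative_diag (unitarymx_unit uP) ME); set N := [pred i | _].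
rewrite leqNgt; apply/negP => kN.
pose T := rowsub (@enum_val _ N) P.
have /rowV0Pn[c /sub_kermxP cT c0] : kermx (T *m U) != 0.
  rewrite kermx_eq0 /row_free; apply/eqP => rT.
  by have := leq_ltn_trans (rank_leq_col (T *m U)) kN; rewrite rT ltnn.
have PM : P *m M = diag_mx d *m P by rewrite {1}ME !mulmxA (mulmxV (unitarymx_unit uP)) mul1mx.
have TM : T *m M = diag_mx (\row_i d 0 (enum_val i)) *m T.
  rewrite /T mul_rowsub_mx PM; apply/matrixP => i j; rewrite mxE mul_diag_mx mxE.
  by rewrite mul_diag_mx !mxE.
have TT : T *m T ^t* = 1%:M.
  apply/matrixP => i j; have /matrixP/(_ (enum_val i) (enum_val j)) := unitarymxP uP.
  rewrite !mxE (inj_eq enum_val_inj) => <-; apply: eq_bigr => l _; by rewrite !mxE.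
have cTU : c *m T *m U = 0 by rewrite -mulmxA.
have := posM _ cTU.
rewrite -(mulmxA c T M) TM trmx_mul map_mxM !mulmxA -(mulmxA _ T) TT mulmx1.
have -> : (c *m diag_mx (\row_i d 0 (enum_val i)) *m c ^t*) 0 0 =
    \sum_i d 0 (enum_val i) * (c 0 i * (c 0 i)^*).
  rewrite mxE; apply: eq_bigr => i _; rewrite mul_mx_diag !mxE; ring.
have /existsP[i0 ci0] : [exists i, c 0 i != 0].
  apply: contraR c0; rewrite negb_exists => /forallP h; apply/eqP/rowP => i.
  by rewrite mxE; apply/eqP; have := h i; rewrite negbK.
have dneg (i : 'I_#|N|) : d 0 (enum_val i) < 0.
  exact: (enum_valP i).
rewrite (bigD1 i0)//= lt_geF//.
rewrite -oppr_gt0 opprD -sumrN ltr_pwDl//.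
  by rewrite -mulNr mulr_gt0 ?oppr_gt0// mul_conjC_gt0.
by apply: sumr_ge0 => i _; rewrite -mulNr mulr_ge0 ?oppr_ge0 ?(ltW (dneg i))// mul_conjC_ge0.
Qed.

End NegativeEigenvalues.

Section NevanlinnaCriterion.
Variables (R : realType).
Local Notation C := R[i].

Definition herm_sum n (x : 'I_n -> C) (f : 'I_n -> 'I_n -> C) : C :=
  \sum_(p < n) \sum_(q < n) x p * (x q)^*%C * f p q.

Lemma nevanlinna_matrix_hermitian (G : C -> C) n (z : 'I_n -> C) :
  nevanlinna_matrix G z \is hermsymmx.
Proof.
apply/is_hermitianmxP; rewrite expr0 scale1r; apply/matrixP => p q; rewrite !mxE.
change ('i%C * ((G (z p) + (G (z q))^*%C) / (z p - (z q)^*%C)) =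
  ('i%C * ((G (z q) + (G (z p))^*%C) / (z q - (z p)^*%C)))^*%C).
rewrite !(conjcB, conjcM, conjc_inv, conjcD, conjcK).
rewrite (_ : ('i%C : C)^*%C = - 'i%C); last by apply: complex_eqP => /=; rewrite ?oppr0.
by rewrite -(opprB (z p)) invrN mulrN mulrNN addrC.
Qed.

(** The matrix [U] of [negative_eigenvalues_le] has the entries [z p ^+ j] with [j < k]: its columns
    are the [k] constraints under which the form has to be nonnegative. *)
Lemma nevanlinna_criterion k (G : C -> C) :
  (forall p, 0 < complex.Im p -> canalytic G p) ->
  (forall n (z x : 'I_n -> C), (forall p, 0 < complex.Im (z p)) ->
     (forall j, (j < k)%N -> \sum_(p < n) x p * z p ^+ j = 0) ->
     0 <= herm_sum x (fun p q => 'i%C * ((G (z p) + (G (z q))^*%C) / (z p - (z q)^*%C)))) ->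
  nevanlinna_le k G.
Proof.
move=> ca pos; split; first by move=> p p0; apply: canalytic_cderivable; exact: ca.
move=> n z _ z0.
apply: (@negative_eigenvalues_le _ _ _ _ (\matrix_(p < n, j < k) z p ^+ j)).
  exact: nevanlinna_matrix_hermitian.
move=> x xU; have := pos n z (fun p => x 0 p) z0.
have hx j : (j < k)%N -> \sum_(p < n) x 0 p * z p ^+ j = 0.
  move=> jk; have /matrixP/(_ 0 (Ordinal jk)) := xU.
  rewrite mxE [X in _ = X]mxE => xU0; rewrite -[RHS]xU0.
  by apply: eq_bigr => p _; rewrite mxE.
move=> /(_ hx); congr (0 <= _); rewrite /herm_sum exchange_big mxE/=.
apply: eq_bigr => q _; rewrite !mxE mulr_suml; apply: eq_bigr => p _.
by rewrite mxE mulrAC.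
Qed.

Section Vanishing.
Variables (n k : nat) (x z : 'I_n -> C).
Hypothesis xz : forall j, (j < k)%N -> \sum_(p < n) x p * z p ^+ j = 0.

Lemma eq_herm_sum f g : (forall p q, f p q = g p q) -> herm_sum x f = herm_sum x g.
Proof. by move=> fg; apply: eq_bigr => p _; apply: eq_bigr => q _; rewrite fg. Qed.

Lemma herm_sumD f g : herm_sum x (fun p q => f p q + g p q) = herm_sum x f + herm_sum x g.
Proof.
rewrite /herm_sum -big_split; apply: eq_bigr => p _; rewrite -big_split/=.
by apply: eq_bigr => q _; rewrite mulrDr.
Qed.

Lemma herm_sumZ c f : herm_sum x (fun p q => c * f p q) = c * herm_sum x f.
Proof.
rewrite /herm_sum mulr_sumr; apply: eq_bigr => p _; rewrite mulr_sumr.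
by apply: eq_bigr => q _; rewrite mulrCA.
Qed.

Lemma herm_sum_sum m (f : 'I_m -> 'I_n -> 'I_n -> C) :
  (forall j, herm_sum x (f j) = 0) -> herm_sum x (fun p q => \sum_(j < m) f j p q) = 0.
Proof.
move=> f0; rewrite /herm_sum.
under eq_bigr do under eq_bigr do rewrite mulr_sumr.
under eq_bigr do rewrite exchange_big/=.
by rewrite exchange_big/=; apply: big1 => j _; exact: f0.
Qed.

Lemma herm_sum_left (u : 'I_n -> C) j : (j < k)%N ->
  herm_sum x (fun p q => z p ^+ j * u q) = 0.
Proof.
move=> jk; rewrite /herm_sum exchange_big/=; apply: big1 => q _.
rewrite (eq_bigr (fun p => x p * z p ^+ j * ((x q)^*%C * u q))); last by move=> p _; ring.
by rewrite -mulr_suml xz// mul0r.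
Qed.

Lemma herm_sum_right (u : 'I_n -> C) j : (j < k)%N ->
  herm_sum x (fun p q => u p * (z q)^*%C ^+ j) = 0.
Proof.
move=> jk; apply: big1 => p _.
rewrite (eq_bigr (fun q => x p * u p * (x q * z q ^+ j)^*%C)); last first.
  by move=> q _; rewrite conjcM conjcX; ring.
by rewrite -mulr_sumr -conjc_sum xz// conjc0 mulr0.
Qed.

End Vanishing.

(** Written as a sum of monomials rather than as a quotient, so that vanishing on the constrained
    vectors is read off the exponents. *)
Definition divided_difference (P : {poly C}) (y w : C) : C :=
  \sum_(m < size P) P`_m * \sum_(i < m) y ^+ (m.-1 - i) * w ^+ i.

Lemma divided_differenceE P y w : P.[y] - P.[w] = (y - w) * divided_difference P y w.
Proof.
rewrite !horner_coef -sumrB /divided_difference mulr_sumr; apply: eq_bigr => m _.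
by rewrite -mulrBr subrXX mulrCA.
Qed.

Section VanishingDifferences.
Variables (n k : nat) (x z : 'I_n -> C).
Hypothesis xz : forall j, (j < k)%N -> \sum_(p < n) x p * z p ^+ j = 0.

Let pred_sub_lt (l i j : nat) : (i < l)%N -> (l <= i + j)%N -> (l.-1 - i < j)%N.
Proof. by case: l => // l il lij; rewrite ltn_subLR. Qed.

(** In a monomial [y^(m-1-i) w^i] with [m <= 2k] the exponents add up to at most [2k - 1], so one of
    them is below [k] and the corresponding constraint applies. *)
Lemma herm_sum_difference (P : {poly C}) : (size P <= (2 * k).+1)%N ->
  herm_sum x (fun p q => divided_difference P (z p) (z q)^*%C) = 0.
Proof.
move=> sP; apply: herm_sum_sum => m; rewrite herm_sumZ.
rewrite herm_sum_sum ?mulr0// => i.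
have [ik|ki] := ltnP i k; 
  first exact: (herm_sum_right xz (fun p => z p ^+ (m.-1 - i)) ik).
have mP : (m < (2 * k).+1)%N := leq_trans (ltn_ord m) sP.
apply: (herm_sum_left xz (fun q => (z q)^*%C ^+ i)).
apply: pred_sub_lt (ltn_ord i) _.
by rewrite -ltnS (leq_trans mP)// ltnS mul2n -addnn leq_add2r.
Qed.

(** For degree at most [k] every exponent is below [k]; the constraint is applied in the variable on
    which [u] does not depend. *)
Lemma herm_sum_difference_left (P : {poly C}) (u : 'I_n -> C) : (size P <= k.+1)%N ->
  herm_sum x (fun p q => u p * divided_difference P (z p) (z q)^*%C) = 0.
Proof.
move=> sP; under eq_herm_sum do rewrite /divided_difference mulr_sumr.
apply: herm_sum_sum => m; under eq_herm_sum do rewrite mulrCA mulr_sumr.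
rewrite herm_sumZ herm_sum_sum ?mulr0// => i.
under eq_herm_sum do rewrite mulrA.
apply: (herm_sum_right xz (fun p => u p * z p ^+ (m.-1 - i))).
exact: leq_trans (ltn_ord i) (leq_trans (ltn_ord m) sP).
Qed.

Lemma herm_sum_difference_right (P : {poly C}) (u : 'I_n -> C) : (size P <= k.+1)%N ->
  herm_sum x (fun p q => u q * divided_difference P (z p) (z q)^*%C) = 0.
Proof.
move=> sP; under eq_herm_sum do rewrite /divided_difference mulr_sumr.
apply: herm_sum_sum => m; under eq_herm_sum do rewrite mulrCA mulr_sumr.
rewrite herm_sumZ herm_sum_sum ?mulr0// => i.
under eq_herm_sum do rewrite mulrCA.
have mP : (m < k.+1)%N := leq_trans (ltn_ord m) sP.
apply: (herm_sum_left xz (fun q => u q * (z q)^*%C ^+ i)).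
apply: pred_sub_lt (ltn_ord i) _.
by rewrite -ltnS (leq_trans mP)// ltnS leq_addl.
Qed.

End VanishingDifferences.

End NevanlinnaCriterion.

(** * Nevanlinna functions from positive densities *)

Section PositiveDensity.
Variables (R : realType) (d : measure_display) (T : measurableType d).
Variables (m : {measure set T -> \bar R}) (D : set T).
Hypothesis mD : measurable D.

Lemma cint_ge0 (f : T -> R[i]) : (forall t, D t -> 0 <= f t) -> 0 <= cintT m D f.
Proof.
move=> f0; rewrite lecE /cintT /=; apply/andP; split.
  apply/eqP; transitivity (\int[m]_(t in D) (0 : R)); last by rewrite /Rintegral integral0.
  by apply: eq_Rintegral => t; rewrite inE => /f0; rewrite lecE /= => /andP[/eqP].
apply: Rintegral_ge0 => t Dt; have := f0 _ Dt.
by rewrite lecE => /andP[].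
Qed.

Lemma cintegrableT_sum n (f : 'I_n -> T -> R[i]) : (forall j, cintegrableT m D (f j)) ->
  cintegrableT m D (fun t => \sum_(j < n) f j t).
Proof.
elim: n f => [|n IH] f fi.
  by split; under eq_fun do rewrite big_ord0; exact: integrable0.
by under eq_fun do rewrite big_ord_recl; apply: cintegrableT_D => //; exact: IH.
Qed.

Lemma cint_sum n (c : 'I_n -> R[i]) (f : 'I_n -> T -> R[i]) : (forall j, cintegrableT m D (f j)) ->
  cintT m D (fun t => \sum_(j < n) c j * f j t) = \sum_(j < n) c j * cintT m D (f j).
Proof.
elim: n c f => [|n IH] c f fi.
  rewrite big_ord0 -[RHS](_ : cintT m D (fun=> 0) = 0).
    by apply: eq_cint => t _; rewrite big_ord0.
  by rewrite /cintT /Rintegral !integral0.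
rewrite big_ord_recl -(cintZ mD _ (fi ord0)) -(IH (fun j => c (lift ord0 j)))//.
rewrite -(cintD mD); last 2 first.
- exact: cintegrableT_Z.
- by apply: cintegrableT_sum => j; exact: cintegrableT_Z.
by apply: eq_cint => t _; rewrite big_ord_recl.
Qed.

End PositiveDensity.

Section DensityNevanlinna.
Variables (R : realType) (k : nat) (mu : strip_measure R).
Hypothesis tmu : tempered_at mu (2 * k.+1).
Local Notation BR := (measurableTypeR R).
Local Notation nu := (cvariation (line_part mu)).
Variable g : R -> R.
Hypothesis mg : measurable_fun [set: BR] (g : BR -> R).
Hypothesis g01 : forall t, 0 <= g t <= 1.
Variable Q : {poly R}.
Hypothesis sQ : (size Q <= (2 * k).+1)%N.
Implicit Types (y z w : R[i]).

Definition line_transform z : R[i] :=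
  cintT nu setT (fun t : BR => (g t)%:C * strip_kernel k 1 t%:C z).

Definition line_nevanlinna z : R[i] :=
  (monic_factor k 1).[z] / ((2 * pi)%:C * 'i%C) * line_transform z + 'i%C * real_poly_eval Q z.

Let mW : cmeasurable_fun [set: BR] (fun t : BR => (g t)%:C).
Proof. by split => //=; exact: measurable_cst. Qed.

Let W1 t : cabs (g t)%:C <= 1.
Proof. by have /andP[g0 g1] := g01 t; rewrite cabs_pos. Qed.

Let I := line_transform.

Let I_int z : complex.Im z != 0 ->
  cintegrableT nu setT (fun t : BR => (g t)%:C * strip_kernel k 1 t%:C z).
Proof. exact: (line_density_integrable tmu mW W1). Qed.

Let IJ z : complex.Im z != 0 -> (I z)^*%C = I z^*%C.
Proof.
move=> z0; rewrite /I /line_transform -(cintJ measurableT (I_int z0)).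
apply: eq_cint => t _; rewrite /strip_kernel.
by rewrite !(conjcX, conjcB, conjcM, conjc_inv, conjcD, conjc_real).
Qed.

(** The density left in the difference of two kernels: a factor [1 + t^2] in the numerator cancels
    one of the [k + 1] powers. *)
Let omega (t : R) : R := g t / (1 + t ^+ 2) ^+ k.

Let omega0 t : 0 <= omega t.
Proof.
have /andP[g0 _] := g01 t.
by rewrite divr_ge0// exprn_ge0// addr_ge0// sqr_ge0.
Qed.

Let line_neq0 (t : R) z : complex.Im z != 0 -> t%:C - z != 0.
Proof.
move=> z0; rewrite -cabs_gt0 (lt_le_trans _ (line_gap z t))// normr_gt0//.
Qed.

Let kernel_diff z w (t : R) : complex.Im z != 0 -> complex.Im w != 0 ->
  (g t)%:C * strip_kernel k 1 t%:C z - (g t)%:C * strip_kernel k 1 t%:C w =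
  (z - w) * ((omega t)%:C / ((t%:C - z) * (t%:C - w))).
Proof.
move=> z0 w0; have tz := line_neq0 t z0; have tw := line_neq0 t w0.
have D0 : 1 + t ^+ 2 != 0 by rewrite gt_eqF// ltr_wpDr// sqr_ge0.
have DE : (1 ^+ 2)%:C + t%:C ^+ 2 = (1 + t ^+ 2)%:C :> R[i].
  by rewrite expr1n rmorphD rmorphXn.
have DC0 : (1 + t ^+ 2)%:C != 0 :> R[i] by rewrite -cabs_gt0 cabs_real normr_gt0.
have oE : (omega t)%:C = (g t)%:C / (1 + t ^+ 2)%:C ^+ k :> R[i].
  by rewrite -rmorphXn -fmorphV -rmorphM.
rewrite /strip_kernel oE DE [_ ^+ k.+1]exprS.
have -> : (1 ^+ 2)%:C = (1 + t ^+ 2)%:C - t%:C ^+ 2 :> R[i] by rewrite -DE addrK.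
move: DC0; have : (1 + t ^+ 2)%:C ^+ k != 0 :> R[i].
  by rewrite expf_neq0// -cabs_gt0 cabs_real normr_gt0.
move: ((1 + t ^+ 2)%:C ^+ k) ((1 + t ^+ 2)%:C) => X Y X0 Y0.
by field; rewrite tz tw X0 Y0.
Qed.

Let J z w := cintT nu setT (fun t : BR => (omega t)%:C / ((t%:C - z) * (t%:C - w))).

Let J_int z w : complex.Im z != 0 -> complex.Im w != 0 -> z != w ->
  cintegrableT nu setT (fun t : BR => (omega t)%:C / ((t%:C - z) * (t%:C - w))).
Proof.
move=> z0 w0 zw.
have := cintegrableT_Z measurableT (z - w)^-1 (cintegrableT_D measurableT (I_int z0)
  (cintegrableT_Z measurableT (- 1) (I_int w0))).
apply: (cintegrableT_ext measurableT) => t _.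
by rewrite mulN1r kernel_diff// mulrA mulVf ?mul1r// subr_eq0.
Qed.

Let I_diff z w : complex.Im z != 0 -> complex.Im w != 0 -> z != w -> I z - I w = (z - w) * J z w.
Proof.
move=> z0 w0 zw; rewrite /J -(cintZ measurableT _ (J_int z0 w0 zw)).
rewrite -[- I w]mulN1r -(cintZ measurableT _ (I_int w0)).
rewrite -(cintD measurableT (I_int z0) (cintegrableT_Z measurableT (- 1) (I_int w0))).
by apply: eq_cint => t _; rewrite mulN1r kernel_diff.
Qed.

Lemma line_nevanlinna_canalytic p : 0 < complex.Im p -> canalytic line_nevanlinna p.
Proof.
move=> p0; have p00 : complex.Im p != 0 by rewrite gt_eqF.
apply: (canalytic_near ltr01 _ (canalyticD
  (canalyticM_poly ((2 * pi)%:C * 'i%C)^-1%:P (canalyticM_poly (monic_factor k 1)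
    (line_density_canalytic tmu mW W1 p00)))
  (canalytic_poly ('i%C *: map_poly (real_complex R) Q) p))) => z _.
by rewrite /line_nevanlinna hornerC hornerZ mulrA [_^-1 * _]mulrC.
Qed.

Let qp : {poly R[i]} := ('X + 'i%C%:P) ^+ k.
Let qm : {poly R[i]} := ('X - 'i%C%:P) ^+ k.

Let qpm y : (monic_factor k 1).[y] = qp.[y] * qm.[y].
Proof.
rewrite monic_factorE /qp /qm !horner_exp !hornerD hornerN hornerX !hornerC -exprMn.
congr (_ ^+ k); rewrite expr1n.
rewrite (_ : (y + 'i%C) * (y - 'i%C) = y ^+ 2 - 'i%C ^+ 2); last by ring.
by rewrite sqr_i opprK rmorph1.
Qed.

Let qJ y : (qp.[y])^*%C = qm.[y^*%C].
Proof.
by rewrite /qp /qm !horner_exp !hornerD hornerN !hornerX !hornerC conjcX conjcD conjc_i.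
Qed.

Let size_q c : (size (('X + c%:P : {poly R[i]}) ^+ k) <= k.+1)%N.
Proof.
rewrite (leq_trans (size_poly_exp_leq _ _))// ltnS -[X in (_ <= X)%N]mul1n leq_mul2r.
by rewrite -[c]opprK polyCN size_XsubC orbT.
Qed.

Let QC : {poly R[i]} := map_poly (real_complex R) Q.

Let QJ y : (QC.[y])^*%C = QC.[y^*%C].
Proof.
rewrite -[LHS](horner_map conjc) -map_poly_comp; congr (_.[_]).
by apply: eq_map_poly => s; apply: complex_eqP; rewrite /= ?oppr0.
Qed.

Let c0 : R[i] := ((2 * pi)%:C)^-1.

(* With [P = qp * qm], [P z * I z - P w * I w] splits into
   [qp z * qm w * (I z - I w)] and two terms carrying a divided difference of
   a polynomial of degree [k]. *)
Let entryE z w : 0 < complex.Im z -> 0 < complex.Im w ->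
  'i%C * ((line_nevanlinna z + (line_nevanlinna w)^*%C) / (z - w^*%C)) =
  c0 * (qp.[z] * (qp.[w])^*%C * J z w^*%C) +
  (c0 * (qp.[z] * I z * divided_difference qm z w^*%C +
     qm.[w^*%C] * I w^*%C * divided_difference qp z w^*%C) +
  - 1 * divided_difference QC z w^*%C).
Proof.
move=> z0 w0; set v := w^*%C.
have v0 : complex.Im v < 0 by rewrite cImJ oppr_lt0.
have zv : z != v by apply/eqP => zv; move: z0; rewrite zv ltNge (ltW v0).
have zv0 : z - v != 0 by rewrite subr_eq0.
have z00 : complex.Im z != 0 by rewrite gt_eqF.
have w00 : complex.Im w != 0 by rewrite gt_eqF.
have v00 : complex.Im v != 0 by rewrite lt_eqF.
have i0 : 'i%C != 0 :> R[i] by exact: neq0Ci.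
have p0 : (2 * pi)%:C != 0 :> R[i].
  by rewrite -cabs_gt0 cabs_real normr_gt0 mulf_neq0// gt_eqF// pi_gt0.
have GJ : (line_nevanlinna w)^*%C =
    - ((monic_factor k 1).[v] / ((2 * pi)%:C * 'i%C) * I v) - 'i%C * QC.[v].
  rewrite /line_nevanlinna conjcD !conjcM IJ// conjc_inv conjcM conjc_real conjc_i QJ -/v.
  rewrite mulrN invrN mulrN !mulNr; congr (- (_ / _ * _) - _).
  by rewrite !monic_factorE conjcX conjcD conjcX conjc_real.
rewrite GJ /line_nevanlinna -/(I z) -/(QC.[z]) !qpm qJ -/v /c0.
have alg (a a' b b' Iz Iv Jv e e' eq X X' p d : R[i]) : p != 0 -> d != 0 ->
    a - a' = d * e -> b - b' = d * e' -> Iz - Iv = d * Jv -> X - X' = d * eq ->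
    'i%C * ((a * b / (p * 'i%C) * Iz + 'i%C * X +
      (- (a' * b' / (p * 'i%C) * Iv) - 'i%C * X')) / d) =
    p^-1 * (a * b' * Jv) + (p^-1 * (a * Iz * e' + b' * Iv * e) + -1 * eq).
  move=> p00 d0 ha hb hI hX.
  have -> : a' = a - d * e by rewrite -ha; ring.
  have -> : b = b' + d * e' by rewrite -hb; ring.
  have -> : Iz = Iv + d * Jv by rewrite -hI; ring.
  have -> : X = X' + d * eq by rewrite -hX; ring.
  have i2 := sqr_i R.
  apply: (mulfI i0); apply: (mulfI p00); apply: (mulfI d0).
  rewrite [LHS](_ : _ = 'i%C ^+ 2 * ((a * (b' + d * e') / 'i%C * (Iv + d * Jv) + p * ('i%C * (X' + d * eq)) +
    (- ((a - d * e) * b' / 'i%C * Iv) - p * ('i%C * X'))))); last by field; rewrite d0 i0 p00.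
  rewrite i2; have -> : 'i%C^-1 = - 'i%C :> R[i].
    by apply: (mulfI i0); rewrite divff// mulrN -expr2 i2 opprK.
  by field.
apply: alg => //.
- exact: divided_differenceE.
- exact: divided_differenceE.
- exact: I_diff.
- exact: divided_differenceE.
Qed.

(** On the constrained vectors only the term with [J] survives, and it is the integral of [omega]
    times the squared modulus of a single sum; the divided differences, including that of [Q],
    contribute nothing. *)
Lemma line_nevanlinna_le : nevanlinna_le k line_nevanlinna.
Proof.
apply: nevanlinna_criterion; first exact: line_nevanlinna_canalytic.
move=> n z x z0 xz.
rewrite (eq_herm_sum x (fun p q => entryE (z0 p) (z0 q))).
rewrite !herm_sumD !herm_sumZ herm_sumD.
have sm : (size qm <= k.+1)%N by rewrite /qm -polyCN size_q.
rewrite (herm_sum_difference xz); last by rewrite size_map_poly.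
rewrite (herm_sum_difference_left xz (fun p => qp.[z p] * I (z p)) sm).
rewrite (herm_sum_difference_right xz (fun q => qm.[(z q)^*%C] * I (z q)^*%C) (size_q _)).
rewrite addr0 !mulr0 !addr0; apply: mulr_ge0.
  by rewrite /c0 -fmorphV lecR invr_ge0 mulr_ge0// pi_ge0.
pose y p := x p * qp.[z p].
have zq p q : z p != (z q)^*%C.
  apply/eqP => zz; have := z0 p; rewrite zz cImJ oppr_gt0 => /lt_trans/(_ (z0 q)).
  by rewrite ltxx.
have z00 p : complex.Im (z p) != 0 by rewrite gt_eqF.
have z0J p : complex.Im (z p)^*%C != 0 by rewrite cImJ oppr_eq0.
have -> : herm_sum x (fun p q => qp.[z p] * (qp.[z q])^*%C * J (z p) (z q)^*%C) =
   cintT nu setT (fun t : BR => \sum_(p < n) 1 * (\sum_(q < n) y p * (y q)^*%C *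
     ((omega t)%:C / ((t%:C - z p) * (t%:C - (z q)^*%C))))).
  have iJ p q := J_int (z00 p) (z0J q) (zq p q).
  rewrite (cint_sum measurableT); last first.
    by move=> p; apply: cintegrableT_sum => // q; exact: cintegrableT_Z.
  apply: eq_bigr => p _; rewrite mul1r (cint_sum measurableT)//.
  by apply: eq_bigr => q _; rewrite /y conjcM -/(J _ _); ring.
apply: cint_ge0 => t _.
have -> : \sum_(p < n) 1 * (\sum_(q < n) y p * (y q)^*%C *
     ((omega t)%:C / ((t%:C - z p) * (t%:C - (z q)^*%C)))) =
   (omega t)%:C * ((\sum_(p < n) y p / (t%:C - z p)) * (\sum_(p < n) y p / (t%:C - z p))^*%C).
  rewrite conjc_sum mulr_suml mulr_sumr; apply: eq_bigr => p _; rewrite mul1r.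
  rewrite mulr_sumr mulr_sumr; apply: eq_bigr => q _.
  move: (y p) (y q) => b c; rewrite conjcM conjc_inv conjcB conjc_real invfM; ring.
by apply: mulr_ge0; [rewrite lecR omega0|exact: mul_conjC_ge0].
Qed.

End DensityNevanlinna.

Section LineTermNevanlinna.
Variables (R : realType) (k : nat) (mu : strip_measure R).
Hypothesis tmu : tempered_at mu (2 * k.+1).
Hypothesis rv : real_valued mu.
Local Notation BR := (measurableTypeR R).
Local Notation nu := (cvariation (line_part mu)).
Local Notation h := (cphase (line_part mu)).

Lemma line_term_nevanlinna (Q : {poly R}) : (size Q <= (2 * k).+1)%N ->
  nevanlinna_diff k (fun z => line_term mu k z + 'i%C * real_poly_eval Q z).
Proof.
move=> sQ; pose gp t : R := Num.max (complex.Re (h t)) 0.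
pose gm t : R := Num.max (- complex.Re (h t)) 0.
have mRe := measurable_Re_cphase (line_part mu).
have mgp : measurable_fun [set: BR] (gp : BR -> R).
  by apply: measurable_maxr => //; exact: measurable_cst.
have mgm : measurable_fun [set: BR] (gm : BR -> R).
  by apply: measurable_maxr; [exact: measurable_funN|exact: measurable_cst].
have Re1 t : `|complex.Re (h t)| <= 1 by rewrite -(cabs_cphase (line_part mu) t) Re_le_cabs.
have gp01 t : 0 <= gp t <= 1.
  rewrite le_max lexx orbT ge_max ler01 andbT.
  by have := Re1 t; rewrite ler_norml => /andP[].
have gm01 t : 0 <= gm t <= 1.
  rewrite le_max lexx orbT ge_max ler01 andbT.
  by have := Re1 t; rewrite ler_norml => /andP[? _]; rewrite lerNl.
(* The polynomial is harmless in either term, since it vanishes on the constrained vectors; it goes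
   entirely to the first. *)
exists (line_nevanlinna k mu gp Q), (line_nevanlinna k mu gm 0); split.
- exact: line_nevanlinna_le.
- by apply: line_nevanlinna_le => //; rewrite size_poly0.
move=> z z0; have z00 : complex.Im z != 0 by rewrite gt_eqF.
rewrite line_termE /line_nevanlinna /real_poly_eval rmorph0 horner0 mulr0 addr0 addrAC -mulrBr.
congr (_ * _ + _).
have mK : cmeasurable_fun [set: BR] (fun t : BR => strip_kernel k 1 t%:C z).
  by apply: measurable_strip_kernel => //; exact: cmeasurable_real_id.
transitivity (cintT nu setT (fun t : BR => strip_kernel k 1 t%:C z * h t)).
  by apply: eq_cint => t _; rewrite mulrC.
rewrite (cint_phase_Re tmu rv mK) /line_transform.
have ip := line_density_integrable tmu (W := fun t => (gp t)%:C) _ _ z00.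
have im := line_density_integrable tmu (W := fun t => (gm t)%:C) _ _ z00.
have {}ip : cintegrableT nu setT (fun t : BR => (gp t)%:C * strip_kernel k 1 t%:C z).
  apply: ip; first by split => //=; exact: measurable_cst.
  by move=> t; have /andP[? ?] := gp01 t; rewrite cabs_pos.
have {}im : cintegrableT nu setT (fun t : BR => (gm t)%:C * strip_kernel k 1 t%:C z).
  apply: im; first by split => //=; exact: measurable_cst.
  by move=> t; have /andP[? ?] := gm01 t; rewrite cabs_pos.
rewrite -[X in _ - X]mul1r -mulNr -(cintZ measurableT _ im).
rewrite -(cintD measurableT ip (cintegrableT_Z measurableT (- 1) im)).
apply: eq_cint => t _.
have -> : complex.Re (h t) = gp t - gm t.
  rewrite /gp /gm; have [h0|h0] := leP 0 (complex.Re (h t)).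
    by rewrite max_r ?subr0// oppr_le0.
  by rewrite max_l ?sub0r ?opprK// oppr_ge0 ltW.
by rewrite rmorphB/=; ring.
Qed.

End LineTermNevanlinna.

(** * Poles and analytic continuation *)

Section LocalMeromorphy.
Variable R : realType.
Implicit Types (F G : R[i] -> R[i]) (p z : R[i]).

(** Expansions at all nearby points yield differentiability on a neighbourhood without re-expanding
    a power series. *)
Definition canalytic_around F p : Prop :=
  exists2 d : R, 0 < d & forall z, cabs (z - p) < d -> canalytic F z.

Definition at_most_simple_pole F p : Prop :=
  canalytic_around F p \/
  exists G, [/\ canalytic_around G p, G p != 0 & exists2 d : R, 0 < d &
    forall z, z != p -> cabs (z - p) < d -> F z = G z / (z - p)].

Lemma canalytic_around_at F p : canalytic_around F p -> canalytic F p.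
Proof. by move=> [d d0]; apply; rewrite subrr cabs0. Qed.

Lemma canalytic_around_holomorphic F p : canalytic_around F p -> holomorphic_at F p.
Proof.
move=> [d d0 H]; apply/nbhs_cabsP; exists d => // z /H; exact: canalytic_cderivable.
Qed.

Lemma canalytic_around_near F G p (d : R) : 0 < d ->
  (forall z, cabs (z - p) < d -> F z = G z) -> canalytic_around F p -> canalytic_around G p.
Proof.
move=> d0 FG [e e0 He]; exists (Num.min d e); first by rewrite lt_min d0.
move=> z; rewrite lt_min => /andP[zd ze].
apply: (@canalytic_near _ F _ _ (d - cabs (z - p))); rewrite ?subr_gt0//; last exact: He.
move=> w wz; apply: FG; rewrite (_ : w - p = (w - z) + (z - p)); last by ring.
by rewrite (le_lt_trans (cabsD _ _))// -ltrBrDr.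
Qed.

Lemma canalytic_aroundD F G p : canalytic_around F p -> canalytic_around G p ->
  canalytic_around (fun z => F z + G z) p.
Proof.
move=> [d d0 Hd] [e e0 He]; exists (Num.min d e); first by rewrite lt_min d0.
by move=> z; rewrite lt_min => /andP[zd ze]; apply: canalyticD; [exact: Hd|exact: He].
Qed.

Lemma canalytic_aroundM_poly (q : {poly R[i]}) F p : canalytic_around F p ->
  canalytic_around (fun z => q.[z] * F z) p.
Proof. by move=> [d d0 Hd]; exists d => // z /Hd; exact: canalyticM_poly. Qed.

Lemma canalytic_around_poly (q : {poly R[i]}) p : canalytic_around (fun z => q.[z]) p.
Proof. by exists 1 => // z _; exact: canalytic_poly. Qed.

Lemma at_most_simple_poleD F G p : canalytic_around F p -> at_most_simple_pole G p ->
  at_most_simple_pole (fun z => F z + G z) p.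
Proof.
move=> aF [aG|[H [aH H0 [d d0 GH]]]]; first by left; exact: canalytic_aroundD.
right; exists (fun z => ('X - p%:P).[z] * F z + H z); split.
- by apply: canalytic_aroundD => //; exact: canalytic_aroundM_poly.
- by rewrite hornerXsubC subrr mul0r add0r.
- exists d => // z zp zd; rewrite GH// hornerXsubC mulrDl.
  by rewrite mulrAC divff ?mul1r// subr_eq0.
Qed.

Lemma at_most_simple_poles_meromorphic (U : set R[i]) F :
  (forall p, U p -> at_most_simple_pole F p) -> meromorphic_on U F.
Proof.
move=> H p /H[aF|[G [aG G0 [d d0 FG]]]]; first by left; exact: canalytic_around_holomorphic.
right; exists 1%N, G; split => //; first exact: canalytic_around_holomorphic.
by apply/dnbhs_cabsP; exists d => // z zp zd; rewrite expr1 FG.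
Qed.

(* Two functions agreeing high up are compared along a vertical half-line:
   below the infimum of the agreement set they could not differ, and a pole
   of the first at that infimum is impossible. *)
Lemma vertical_identity F G (c H : R) :
  (forall p, c < complex.Im p -> at_most_simple_pole F p) ->
  (forall p, c < complex.Im p -> canalytic G p) ->
  (forall p, H < complex.Im p -> F p = G p) ->
  forall p, c < complex.Im p -> F p = G p.
Proof.
move=> pF aG FG p0 cp0.
pose pt (s : R) : R[i] := p0 + 'i%C * s%:C.
have Ipt s : complex.Im (pt s) = complex.Im p0 + s.
  by rewrite /pt cImD cImM/= mul0r mul1r add0r.
have ptD s u : pt (s + u) = pt s + 'i%C * u%:C by rewrite /pt rmorphD mulrDr addrA.
pose T := [set t : R | 0 <= t /\ forall s, t < s -> F (pt s) = G (pt s)].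
have T0 : T (Num.max 0 (H - complex.Im p0)).
  split; first by rewrite le_max lexx.
  move=> s; rewrite gt_max => /andP[_ sH]; apply: FG; rewrite Ipt; lra.
have hi : has_inf T by split; [exists (Num.max 0 (H - complex.Im p0))|exists 0 => t []].
pose t0 := inf T.
have t00 : 0 <= t0 by apply: lb_le_inf; [exact: (hi.1)|move=> t []].
have eqT s : t0 < s -> F (pt s) = G (pt s).
  move=> ts; have [|t [_ Ht] tt] := @inf_adherent _ T (s - t0) _ hi; first by rewrite subr_gt0.
  by apply: Ht; move: tt; rewrite -/t0 addrC subrK.
have cpt s : 0 <= s -> c < complex.Im (pt s) by move=> s0; rewrite Ipt ltr_wpDr.
have aGp := aG _ (cpt _ t00).
have [aF|[K [aK K0 [d d0 FK]]]] := pF _ (cpt _ t00); last first.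
  (* At a pole, [(z - p) G - K] would vanish on the segment above the infimum, hence near it, and so
     would [K] at the infimum itself. *)
  have [|d' d'0 Hd'] := @canalytic_eq0 _ (fun z => (z - pt t0) * G z - K z) (pt t0) d
    (canalyticB (canalytic_mulXsub aGp) (canalytic_around_at aK)) d0.
    move=> s /andP[s0 sd].
    have zp : pt (t0 + s) != pt t0.
      apply/eqP => /(congr1 (@complex.Im _)); rewrite !Ipt addrA => /eqP.
      by rewrite -[X in _ == X]addr0 (inj_eq (addrI _)) gt_eqF.
    rewrite -ptD -eqT ?ltrDl// FK//; last first.
      by rewrite ptD addrAC subrr add0r cabsM cabs_i mul1r cabs_pos// ltW.
    by rewrite mulrCA mulfV ?mulr1 ?subrr// subr_eq0.
  have := Hd' (pt t0); rewrite subrr cabs0 => /(_ d'0)/eqP.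
  by rewrite mul0r sub0r oppr_eq0 (negbTE K0).
have [|d d0 Hd] := @canalytic_eq0 _ (fun z => F z - G z) (pt t0) 1
    (canalyticB (canalytic_around_at aF) aGp) ltr01.
  by move=> s /andP[s0 _]; rewrite -ptD eqT ?subrr// ltrDl.
have eqd s : `|s| < d -> F (pt (t0 + s)) = G (pt (t0 + s)).
  move=> sd; apply/eqP; rewrite -subr_eq0; apply/eqP; apply: Hd.
  by rewrite ptD addrAC subrr add0r cabsM cabs_i mul1r cabs_real.
have p0E : p0 = pt 0 by rewrite /pt mulr0 addr0.
have [t0pos|] := ltP 0 t0; last first.
  move=> t0neg; have t0E : t0 = 0 by apply/eqP; rewrite eq_le t0neg.
  by have := eqd 0; rewrite normr0 addr0 t0E -p0E; apply.
(* Agreement extends below the infimum by [d / 2], which is impossible when the infimum is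
   positive. *)
have : T (Num.max 0 (t0 - d / 2)).
  split; first by rewrite le_max lexx.
  move=> s; rewrite gt_max => /andP[_ sd]; have [/eqT//|st] := ltP t0 s.
  have -> : s = t0 + (s - t0) by rewrite addrC subrK.
  apply: eqd; rewrite ler0_norm ?subr_le0// opprB; lra.
move=> /(ge_inf hi.2); rewrite -/t0 le_max => /orP[h|h].
  by have := lt_le_trans t0pos h; rewrite ltxx.
by move: h; rewrite lerBrDr gerDl leNgt divr_gt0.
Qed.

End LocalMeromorphy.

Section TermsMeromorphic.
Variables (R : realType) (k : nat) (sigma : R) (mu : strip_measure R).
Hypothesis adm : admissible mu.
Hypothesis strip : supported_on_strip sigma mu.
Hypothesis tmu : tempered_at mu (2 * k.+1).
Local Notation A := (atoms mu).
Local Notation b := (weight mu).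
Implicit Types (z p : R[i]).

Let disc_Im p z : cabs (z - p) < complex.Im p -> complex.Im z != 0.
Proof.
move=> zp; rewrite gt_eqF//; have := le_lt_trans (Im_le_cabs _) zp.
by rewrite cImD cImN ltr_norml => /andP[h _]; lra.
Qed.

Lemma line_term_around p : 0 < complex.Im p -> canalytic_around (line_term mu k) p.
Proof.
by move=> p0; exists (complex.Im p) => // z /disc_Im; exact: line_term_canalytic.
Qed.

Variable rho : R.
Hypothesis srho : sigma < rho.

Let rho0 : 0 < rho. Proof. by case: strip => s0 _; exact: le_lt_trans srho. Qed.

Let Kint (D : set R[i]) z :=
  cintT (count_measure R R[i]^o) D (fun g => b g * strip_kernel k rho g z).

Let rest_around p : complex.Im p != 0 -> canalytic_around (Kint (A `\ p)) p.
Proof.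
move=> p0; have [e e0 ge] := support_gap adm p0.
have e20 : 0 < e / 2 by rewrite divr_gt0.
exists (e / 2) => // z zp; apply: (atoms_canalytic strip tmu srho _ e20).
  by move=> g [].
move=> g [Ag /eqP gp]; have := ge g (or_intror Ag) gp.
have := cabsD (g - z) (z - p); rewrite (_ : _ + _ = g - p); last by ring.
lra.
Qed.

Let KintE z : complex.Im z != 0 ->
  atoms_term mu k rho z = (((2 * pi)%:C * 'i%C)^-1 *: monic_factor k rho).[z] * Kint A z.
Proof. by move=> z0; rewrite (atoms_termE adm strip tmu srho z0) hornerZ [_^-1 * _]mulrC. Qed.

Let A_integrable z : complex.Im z != 0 ->
  cintegrableT (count_measure R R[i]^o) A (fun g => b g * strip_kernel k rho g z).
Proof.
move=> z0; apply: (@csummable_cintegrable _ R[i]^o).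
have := atoms_summable adm strip tmu srho z0; congr (csummable _ _).
by apply/funext => g; exact: atom_termE.
Qed.

(** Only the atom at [p] can be singular, the others staying at a positive distance. An atom of
    weight 0 produces no pole; otherwise the residue is nonzero because [rho > sigma] prevents
    [rho^2 + p^2] from vanishing. *)
Lemma atoms_term_simple_pole p : 0 < complex.Im p ->
  at_most_simple_pole (atoms_term mu k rho) p.
Proof.
move=> p0; have p00 : complex.Im p != 0 by rewrite gt_eqF.
pose M : {poly R[i]} := ((2 * pi)%:C * 'i%C)^-1 *: monic_factor k rho.
have aT := canalytic_aroundM_poly M (rest_around p00).
have regular : (forall z, complex.Im z != 0 -> Kint A z = Kint (A `\ p) z) ->
    at_most_simple_pole (atoms_term mu k rho) p.
  move=> H; left; apply: (canalytic_around_near p0 _ aT) => z /disc_Im z0.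
  by rewrite KintE// H.
have [Ap|nAp] := pselect (A p); last first.
  by apply: regular => z _; rewrite not_setD1.
have split z : complex.Im z != 0 -> Kint A z = b p * strip_kernel k rho p z + Kint (A `\ p) z.
  by move=> z0; exact: (@cint_setD1 _ R[i]^o _ _ _ (A_integrable z0)).
have [bp|bp] := eqVneq (b p) 0.
  by apply: regular => z z0; rewrite split// bp mul0r add0r.
pose dp := ((rho ^+ 2)%:C + p ^+ 2).
have dp0 : dp != 0.
  by apply: (denominator_neq0 srho rho0); case: strip => _ /(_ p Ap) /ltW.
(* The numerator of the isolated term; the sign comes from writing its denominator as [z - p]
   instead of [p - z]. *)
pose q : {poly R[i]} := (- (b p / dp ^+ k.+1)) *: (((rho ^+ 2)%:C)%:P + p *: 'X).
right; exists (fun z => (M * q).[z] + ('X - p%:P).[z] * (M.[z] * Kint (A `\ p) z)); split.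
- by apply: canalytic_aroundD; [exact: canalytic_around_poly|exact: canalytic_aroundM_poly].
- rewrite hornerXsubC subrr mul0r addr0 hornerM /M /q !hornerZ !hornerD hornerC hornerZ hornerX monic_factorE.
  rewrite -expr2 -/dp (addrC (p ^+ 2)) -/dp.
  have i0 : ((2 * pi)%:C * 'i%C)^-1 != 0 :> R[i] by rewrite invr_eq0 twopii_neq0.
  apply: mulf_neq0; first by apply: mulf_neq0 => //; exact: expf_neq0.
  apply: mulf_neq0 => //; rewrite oppr_eq0; apply: mulf_neq0 => //.
  by rewrite invr_eq0 expf_neq0.
- exists (complex.Im p) => // z zp /disc_Im z0.
  have zp0 : z - p != 0 by rewrite subr_eq0.
  have pz0 : p - z != 0 by rewrite subr_eq0 eq_sym.
  have qz : q.[z] = - (b p / dp ^+ k.+1) * ((rho ^+ 2)%:C + p * z).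
    by rewrite /q hornerZ hornerD hornerC hornerZ hornerX.
  rewrite KintE// split// -/M hornerXsubC hornerM qz.
  rewrite /strip_kernel -/dp.
  move: (Kint _ _) (M.[z]) => X Y.
  have dk0 : dp ^+ k.+1 != 0 by rewrite expf_neq0.
  move: (dp ^+ k.+1) dk0 => D D0.
  by field; rewrite zp0 pz0 D0.
Qed.

End TermsMeromorphic.

Theorem theorem1 (R : realType) :
  exists2 c : R -> R, (forall alpha : R, 0 < alpha -> 0 < c alpha) &
  forall (k : nat) (sigma : R) (mu : strip_measure R) (a : R -> R[i]),
    FS_pair sigma mu a ->
    real_antipodal mu a ->
    R_symmetric mu ->
    (ord mu <= 2 * k.+1)%N ->
    finite_exponential_growth a ->
    (forall alpha : R, exponential_growth_rate a alpha ->
       (forall z : R[i], c alpha < complex.Im z ->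
          csummable [set l : R | 0 < l] (dirichlet_term a z)) /\
       holomorphic_almost_periodic_above (c alpha) (dirichlet_series a)) /\
    exists F : R[i] -> R[i],
      [/\ meromorphic_on (@upper_half_plane R) F,
          (forall (alpha : R) (z : R[i]), exponential_growth_rate a alpha ->
             c alpha < complex.Im z ->
             F z = dirichlet_series a z) &
          forall rho : R, sigma < rho ->
          exists2 Q : {poly R}, (size Q <= (2 * k).+1)%N &
          let N z := line_term mu k z + 'i%C * real_poly_eval Q z in
          let S z := atoms_term mu k rho z in
          [/\ nevanlinna_diff k N,
              meromorphic_on (@upper_half_plane R) S,
              (forall z, upper_half_plane z ->
                 cintegrable (line_part mu) (line_kernel k z) /\
                 csummable (atoms mu) (atom_term mu k rho z)) &
              forall z, upper_half_plane z -> ~ atoms mu z ->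
                F z = N z + S z]].
Proof.
(* The abscissa is the growth rate itself, [2 pi] being larger than 1. *)
exists id => // k sigma mu a fs ra rs om [alpha0 rate0].
split; first by move=> alpha rate; split; [exact: dirichlet_summable|exact: dirichlet_AP].
have [_ adm strip _] := fs; have [s0 _] := strip.
have tmu : tempered_at mu (2 * k.+1) by apply: tempered_ord om; case: adm.
(* Any admissible parameter may define [F]; by [representation_unique] the others give the same
   function away from the atoms. *)
pose rho0 := sigma + 1.
have srho0 : sigma < rho0 by rewrite ltrDl.
have [Q0 sQ0 HQ0] := representation fs ra rs tmu rate0 srho0.
pose F z := line_term mu k z + 'i%C * real_poly_eval Q0 z + atoms_term mu k rho0 z.
have F_poles p : 0 < complex.Im p -> at_most_simple_pole F p.
  move=> p0; apply: at_most_simple_poleD; last exact: (atoms_term_simple_pole adm strip tmu srho0 p0).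
  apply: canalytic_aroundD; first exact: (line_term_around tmu p0).
  have := canalytic_around_poly ('i%C *: map_poly (real_complex R) Q0) p.
  by apply: canalytic_around_near ltr01 _ => z _; rewrite hornerZ.
exists F; split; first by apply: at_most_simple_poles_meromorphic => p; exact: F_poles.
(* The formula holds above [height sigma alpha0] for one rate [alpha0]; the vertical identity
   carries it down to [alpha] for every growth rate [alpha]. *)
- move=> alpha z rate; apply: (@vertical_identity _ F _ _ (height sigma alpha0)).
  + by move=> p ap; apply: F_poles; exact: lt_trans (alpha_gt0 rate) ap.
  + by move=> p; exact: dirichlet_canalytic.
  + by move=> p hp; rewrite HQ0.
- move=> rho srho; have [Q sQ HQ] := representation fs ra rs tmu rate0 srho.
  exists Q; [exact: sQ|move=> N S; split].
  + exact: (line_term_nevanlinna tmu ra.1 sQ).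
  + by apply: at_most_simple_poles_meromorphic => p p0; exact: (atoms_term_simple_pole adm strip tmu srho p0).
  + move=> z z0; have z00 : complex.Im z != 0 by rewrite gt_eqF.
    by split; [exact: (line_kernel_integrable tmu z00)|exact: (atoms_summable adm strip tmu srho z00)].
  + move=> z z0 Az; exact: (representation_unique fs tmu rate0 srho0 srho sQ0 sQ HQ0 HQ z0 Az).
Qed.
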